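(* Let $\alpha,\beta\in(1/2,1)$, let $\max\{2-2\alpha,\,2-2\beta\}<s<2$, and let $\theta^0\in H^s(\mathbb{R}^2)$ be real-valued. Let $T_0>0$ be a time such that the anisotropic quasi-geostrophic system $$\partial_t\theta+u_\theta\cdot\nabla\theta+|\partial_1|^{2\alpha}\theta+|\partial_2|^{2\beta}\theta=0\ \ (x\in\mathbb{R}^2),\qquad u_\theta=\mathcal{R}^\perp\theta,\qquad \theta(\cdot,0)=\theta^0,$$ has a unique solution $\theta\in C([0,T_0];H^s(\mathbb{R}^2))$ on $[0,T_0]$, this solution satisfying $\sup_{t\in[0,T_0]}\|\theta(t)\|_{H^s}\le 2\|\theta^0\|_{H^s}$. Then there exists a time $T_1$ with $0<T_1\le T_0$ such that $$\left(t\mapsto e^{t\left(|\partial_1|^{\alpha}+|\partial_2|^{\beta}\right)}\theta(t)\right)\in L^\infty([0,T_1];H^s(\mathbb{R}^2)).$$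
   Context: Fourier transform: $\widehat f(\xi)=\mathcal F(f)(\xi)=\int_{\mathbb{R}^2}e^{-ix\cdot\xi}f(x)\,dx$. Operators: $|\partial_j|^{a}$ is the Fourier multiplier with symbol $|\xi_j|^{a}$ ($j=1,2$), and $e^{t(|\partial_1|^{\alpha}+|\partial_2|^{\beta})}$ is the Fourier multiplier with symbol $e^{t(|\xi_1|^{\alpha}+|\xi_2|^{\beta})}$. The velocity is $u_\theta=\mathcal{R}^\perp\theta=(u_\theta^1,u_\theta^2)$ with $u^1_\theta=-\partial_2(-\Delta)^{-1/2}\theta$ and $u^2_\theta=\partial_1(-\Delta)^{-1/2}\theta$, i.e. $\widehat{u_\theta}(\xi)=\left(-\tfrac{i\xi_2}{|\xi|},\tfrac{i\xi_1}{|\xi|}\right)\widehat\theta(\xi)$. In particular $\mathrm{div}\,u_\theta=0$, so $u_\theta\cdot\nabla\theta=\mathrm{div}(\theta u_\theta)$. Sobolev space: $H^s(\mathbb{R}^2)$ is the inhomogeneous Sobolev space with norm $\|f\|_{H^s}=\left(\int_{\mathbb{R}^2}(1+|\xi|^2)^s|\widehat f(\xi)|^2d\xi\right)^{1/2}$. Notion of solution: functions are real-valued, and the system is understood in its integral form. With $A(\xi)=|\xi_1|^{2\alpha}+|\xi_2|^{2\beta}$ and $e^{-tA(D)}$ the Fourier multiplier with symbol $e^{-tA(\xi)}$, a solution $\theta\in C([0,T_0],H^s)$ satisfies for all $t\in[0,T_0]$ $$\theta(t)=e^{-tA(D)}\theta^0-\int_0^t e^{-(t-\tau)A(D)}\,\mathrm{div}(\theta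 u_\theta)(\tau)\,d\tau,$$ i.e., on the Fourier side, for a.e. $\xi$, $\widehat\theta(t,\xi)=e^{-tA(\xi)}\widehat{\theta^0}(\xi)-\int_0^te^{-(t-\tau)A(\xi)}\,i\xi\cdot\widehat{(\theta u_\theta)}(\tau,\xi)\,d\tau$ (note $\theta u_\theta(\tau)\in L^1(\mathbb{R}^2)$ since $s\geq 0$). Local existence: for every $\theta^0\in H^s(\mathbb{R}^2)$ with $s$ as in the claim, a time $T_0>0$ as in the claim exists (all sufficiently small times, depending on $\alpha,\beta,s,\|\theta^0\|_{H^s}$, have this property). *)

(* Defs.v *)
From HB Require Import structures.
From mathcomp Require Import all_boot all_order all_algebra.
From mathcomp Require Import all_classical all_reals all_analysis.
From mathcomp.real_closed Require Import complex.

Set Implicit Arguments.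
Unset Strict Implicit.
Unset Printing Implicit Defensive.

Import Order.TTheory GRing.Theory Num.Theory.
Import numFieldNormedType.Exports.

Local Open Scope classical_set_scope.
Local Open Scope ring_scope.

Notation leb1 R := (@lebesgue_measure R).
Notation leb2 R := (leb1 R \x leb1 R)%E.

Section Fourier.
Variable R : realType.
Implicit Types (f g : R * R -> R) (F m : R * R -> R[i]) (x xi : R * R) (s t : R).

Definition expi t : R[i] := (cos t +i* sin t)%C.

Definition Cintegral d (T : measurableType d) (mu : {measure set T -> \bar R})
    (D : set T) (h : T -> R[i]) : R[i] :=
  (Rintegral mu D (fun w => complex.Re (h w)) +i*
   Rintegral mu D (fun w => complex.Im (h w)))%C.

Definition dot2 x xi : R := x.1 * xi.1 + x.2 * xi.2.

Definition norm2 xi : R := Num.sqrt (xi.1 ^+ 2 + xi.2 ^+ 2).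

(* Fourier integral of an integrable function, without normalising factor. *)
Definition fourier1 f xi : R[i] :=
  Cintegral (leb2 R) setT (fun x => expi (- dot2 x xi) * (f x)%:C%C).

Definition L2 f : Prop := f \in Lfun (leb2 R) 2%:E.

Definition L2C F : Prop :=
  L2 (fun xi => complex.Re (F xi)) /\ L2 (fun xi => complex.Im (F xi)).

(* Plancherel transform: F is the L^2 limit of the Fourier integrals of the
   truncations of f to the balls of radius n. *)
Definition is_fourier f F : Prop :=
  L2C F /\
  (fun n : nat => \int[leb2 R]_xi
     ((Normc.normc (F xi - fourier1 (f \_ [set x | norm2 x <= n%:R]) xi)) ^+ 2)%:E)%E
    @ \oo --> 0%E.

(* A representative of the transform of f in L^2, which exists and is unique
   up to null sets by Plancherel's theorem.  For f outside L^2 the value has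
   no meaning. *)
Definition fourier f : R * R -> R[i] := xget (fun=> 0) [set F | is_fourier f F].

(* Transform-side norm of H^s, in \bar R. *)
Definition sobolev_norm s f : \bar R :=
  ((\int[leb2 R]_xi
      ((1 + norm2 xi ^+ 2) `^ s * Normc.normc (fourier f xi) ^+ 2)%:E) `^ 2^-1)%E.

(* Real-valued elements of H^s(R^2), given by representatives.  The
   requirement of square integrability makes this H^s only for s >= 0. *)
Definition sobolev s : set (R * R -> R) :=
  [set f | L2 f /\ (sobolev_norm s f < +oo)%E].

(* g is a real-valued square integrable function equal to m(D) f. *)
Definition is_multiplier m f g : Prop :=
  L2 g /\ {ae leb2 R, forall xi, fourier g xi = m xi * fourier f xi}.

(* m(D) f as a function; meaningful only if f is in the (L^2, real-valued)
   domain of m(D), that is if is_multiplier m f has a solution. *)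
Definition multiplier m f : R * R -> R := xget (fun=> 0) [set g | is_multiplier m f g].

Definition multiplier_dom m : set (R * R -> R) :=
  [set f | L2 f /\ exists g, is_multiplier m f g].

(* u_theta = R^perp theta.  Both symbols are bounded and Hermitian, hence
   every real-valued f in L^2 is in their domain. *)
Definition velocity1 f : R * R -> R :=
  multiplier (fun xi => (0 -i* (xi.2 / norm2 xi))%C) f.
Definition velocity2 f : R * R -> R :=
  multiplier (fun xi => (0 +i* (xi.1 / norm2 xi))%C) f.

Definition aniso (a b : R) xi : R := `|xi.1| `^ a + `|xi.2| `^ b.

Implicit Types theta G : R -> R * R -> R.

Definition C_sobolev (T s : R) theta : Prop :=
  (forall t, 0 <= t <= T -> sobolev s (theta t)) /\
  (forall t, 0 <= t <= T -> forall e : R, 0 < e ->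
     exists2 d : R, 0 < d & forall t', 0 <= t' <= T -> `|t' - t| < d ->
       (sobolev_norm s (theta t' \- theta t)%R < e%:E)%E).

(* Transform of div (f u_f): the products f u_f are integrable, so their
   transforms are pointwise Fourier integrals. *)
Definition div_flux_hat f xi : R[i] :=
  (0 +i* xi.1)%C * fourier1 (f \* velocity1 f) xi +
  (0 +i* xi.2)%C * fourier1 (f \* velocity2 f) xi.

Definition mild_solution (alpha beta s T : R) (theta0 : R * R -> R) theta : Prop :=
  let A := aniso (2 * alpha) (2 * beta) in
  C_sobolev T s theta /\
  forall t, 0 <= t <= T -> {ae leb2 R, forall xi,
    fourier (theta t) xi =
      (expR (- (t * A xi)))%:C%C * fourier theta0 xi -
      Cintegral (leb1 R) `[0, t] (fun tau : R =>
        (expR (- ((t - tau) * A xi)))%:C%C * div_flux_hat (theta tau) xi)}.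

Definition unique_mild_solution (alpha beta s T : R)
    (theta0 : R * R -> R) theta : Prop :=
  mild_solution alpha beta s T theta0 theta /\
  forall theta', mild_solution alpha beta s T theta0 theta' ->
    forall t, 0 <= t <= T -> {ae leb2 R, forall x, theta' t x = theta t x}.

Definition simple_sobolev s G : Prop :=
  exists (n : nat) (B : 'I_n -> set R) (c : 'I_n -> R * R -> R),
    (forall i, measurable (B i)) /\ (forall i, sobolev s (c i)) /\
    G = (fun t x => \sum_(i < n) \1_(B i) t * c i x).

(* Bochner space L^oo([0,T]; H^s): strongly measurable, essentially bounded. *)
Definition Linfty_sobolev (T s : R) G : Prop :=
  [/\ forall t, 0 <= t <= T -> sobolev s (G t),
      exists2 S : nat -> R -> R * R -> R, forall n, simple_sobolev s (S n) &
        {ae leb1 R, forall t, 0 <= t <= T ->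
          (fun n => sobolev_norm s (S n t \- G t)%R) @ \oo --> 0%E} &
      exists M : R, {ae leb1 R, forall t, 0 <= t <= T ->
        (sobolev_norm s (G t) <= M%:E)%E}].

(* exp (t (|d_1|^alpha + |d_2|^beta)) *)
Definition gevrey_symbol (alpha beta t : R) xi : R[i] :=
  (expR (t * aniso alpha beta xi))%:C%C.

End Fourier.

(* Main.v *)
(* Write E(t) for the squared H^s norm of exp (2 t (|d_1|^alpha + |d_2|^beta)) theta(t).
   On the Fourier side everything reduces to the amplitude |theta^(t, xi)|: by the mild
   equation it is at most exp (- t A) |theta0^| plus a Duhamel integral of
   exp (- (t - tau) A) |xi| (|theta^| * |theta^|), the product bound coming from
   Parseval's identity.  Since alpha, beta <= 1 the symbol Phi = |xi_1|^alpha + |xi_2|^beta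
   is subadditive, so the weight exp (2 t Phi) is submultiplicative and passes onto both
   factors of the convolution; and 2 Phi <= A / 2 + 4, so moving the weight from time tau to
   time t uses only half of the dissipation.  The other half gives
   exp (- r A / 2) |xi| <= c r^(-p) <xi>^(-k) with p < 1 and k + s > 1, where s > 2 - 2 min(alpha, beta)
   is used, and Cauchy-Schwarz in frequency and in time yields
   E(t) <= a + b T^(2 (1 - p)) sup E^2.  Running this for capped weights and doubling the cap
   bounds E on a short interval.  The bound with exp (2 t Phi) instead of exp (t Phi) leaves
   room to prove that t |-> exp (t Phi) theta(t) is left continuous in H^s, hence strongly
   measurable.  Plancherel's theorem is obtained through the Hartley transform, starting from
   indicators of rectangles. *)
Require Import Defs.
From HB Require Import structures.
From mathcomp Require Import all_boot all_order all_algebra.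
From mathcomp Require Import all_classical all_reals all_analysis.
From mathcomp Require Import measurable_realfun.
From mathcomp.real_closed Require Import complex.
From mathcomp Require Import ring lra.

Set Implicit Arguments.
Unset Strict Implicit.
Unset Printing Implicit Defensive.

Import Order.TTheory GRing.Theory Num.Theory.
Import numFieldNormedType.Exports.

Local Open Scope classical_set_scope.
Local Open Scope ring_scope.

(** * Square integrable functions *)

Section SquareIntegrable.
Context d (T : measurableType d) (R : realType).
Context (mu : {measure set T -> \bar R}).
Implicit Types (f g u v : T -> R) (a b : R).

(** The uncapped norm may a priori be infinite at every positive time, and the final time must not
    depend on the cap. Hence every estimate is uniform in the cap, and integrals stay in [\bar R]
    until a finite bound for them is proved.

    The exponent p is subject to two demands: p < 1, and 2 a p > max(1, 2 - s) with a = min(alpha,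
    beta). The second keeps the frequency decay k = 2 a p - 1 nonnegative and makes a suitable power
    of 1 + |xi|^2 integrable over the plane. Such a p exists because a > 1/2 and s > 2 - 2 a.

    Tonelli's theorem in time and frequency requires the transform of the flux to be jointly
    measurable. At each fixed frequency this transform is continuous under L^2 convergence of theta,
    so it is a pointwise limit of functions that are piecewise constant in time. The same
    left-endpoint grids later yield the simple functions required for strong measurability. They
    approach t from below, where exp (t' Phi) is dominated by exp (t Phi); this is why left
    continuity suffices. *)

Definition sqint f : \bar R := (\int[mu]_x ((f x) ^+ 2)%:E)%E.

Definition Lsq f : Prop := measurable_fun setT f /\ (sqint f < +oo)%E.

Definition ip f g : R := \int[mu]_x (f x * g x).

Lemma LsqP f : Lsq f <-> f \in Lfun mu 2%:E.
Proof.
split=> [[mf ff]|lf].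
  apply/andP; split; first by rewrite inE.
  rewrite inE/= /finite_norm unlock poweR_lty//.
  by under eq_integral => x _ do rewrite /= powR_mulrn// -normrX ger0_norm ?sqr_ge0//.
split; first by move: lf; rewrite inE => /andP[]; rewrite inE.
have /integrableP[_] := Lfun2_integrable_sqr lf.
apply: le_lt_trans; rewrite /sqint le_eqVlt; apply/orP; left; apply/eqP.
by apply: eq_integral => x _ /=; rewrite ger0_norm ?sqr_ge0.
Qed.

Lemma sqint_ge0 f : (0 <= sqint f)%E.
Proof. by apply: integral_ge0 => x _; rewrite lee_fin sqr_ge0. Qed.

Lemma Lsq_meas f : Lsq f -> measurable_fun setT f. Proof. by case. Qed.
Hint Resolve Lsq_meas : core.

Lemma Lsq_mul f g : Lsq f -> Lsq g ->
  mu.-integrable setT (fun x => (f x * g x)%:E).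
Proof. by move=> /LsqP Lf /LsqP Lg; have /Lfun1_integrable := Lfun2_mul_Lfun1 Lf Lg. Qed.

Lemma Lsq_ip f : Lsq f -> sqint f = (ip f f)%:E.
Proof.
move=> Lf; rewrite /ip /Rintegral fineK; last exact/integrable_fin_num/Lsq_mul.
by apply: eq_integral => x _; rewrite expr2.
Qed.

Lemma integrable_Lsq f : measurable_fun setT f ->
  mu.-integrable setT (fun x => (f x * f x)%:E) -> Lsq f.
Proof.
move=> mf /integrableP[_ i]; split => //; apply: le_lt_trans i.
rewrite le_eqVlt; apply/orP; left; apply/eqP; apply: eq_integral => x _ /=.
by rewrite -expr2 ger0_norm ?sqr_ge0.
Qed.

Lemma ipC f g : ip f g = ip g f.
Proof. by apply: eq_Rintegral => x _; rewrite mulrC. Qed.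

Lemma LsqZ a f : Lsq f -> Lsq (fun x => a * f x).
Proof.
move=> Lf; apply: integrable_Lsq; first exact: measurable_funM (Lsq_meas Lf).
have := integrableZl measurableT (a ^+ 2) (Lsq_mul Lf Lf).
by apply: eq_integrable => // x _ /=; congr EFin; rewrite expr2; ring.
Qed.

Lemma LsqD f g : Lsq f -> Lsq g -> Lsq (fun x => f x + g x).
Proof.
move=> Lf Lg; apply: integrable_Lsq; first by apply: measurable_funD; exact: Lsq_meas.
have h1 := integrableD measurableT (Lsq_mul Lf Lf) (Lsq_mul Lf Lg).
have h2 := integrableD measurableT (Lsq_mul Lf Lg) (Lsq_mul Lg Lg).
have := integrableD measurableT h1 h2.
by apply: eq_integrable => // x _ /=; congr EFin; ring.
Qed.

Lemma LsqN f : Lsq f -> Lsq (fun x => - f x).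
Proof. by move=> /(LsqZ (-1)); congr Lsq; apply/funext => x; rewrite mulN1r. Qed.

Lemma LsqB f g : Lsq f -> Lsq g -> Lsq (fun x => f x - g x).
Proof. by move=> Lf /LsqN; exact: LsqD. Qed.

Lemma Lsq_norm f : Lsq f -> Lsq (fun x => `|f x|).
Proof.
move=> [mf ff]; split; first exact: measurableT_comp.
by rewrite /sqint; under eq_integral do rewrite real_normK ?num_real//.
Qed.

Lemma Lsq_le f g : measurable_fun setT f -> Lsq g ->
  (forall x, `|f x| <= `|g x|) -> Lsq f.
Proof.
move=> mf [mg gg] fg; split => //; apply: le_lt_trans gg.
apply: ge0_le_integral => //.
- by move=> x _; rewrite lee_fin sqr_ge0.
- exact/measurable_EFinP/measurable_funX.
- exact/measurable_EFinP/measurable_funX.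
- move=> x _; rewrite lee_fin -(real_normK (num_real (f x))).
  by rewrite -(real_normK (num_real (g x))) lerXn2r ?nnegrE.
Qed.

Lemma Lsq_patch f (A : set T) : measurable A -> Lsq f -> Lsq (f \_ A).
Proof.
move=> mA Lf; apply: (Lsq_le _ Lf); first by apply/(measurable_restrictT _ _).1 => //; apply: measurable_funTS; exact: Lsq_meas.
by move=> x; rewrite patchE; case: ifP => // _; rewrite normr0.
Qed.

Lemma ipZl a f g : Lsq f -> Lsq g -> ip (fun x => a * f x) g = a * ip f g.
Proof.
move=> Lf Lg; rewrite /ip -RintegralZl//; last exact: Lsq_mul.
by apply: eq_Rintegral => x _; rewrite mulrA.
Qed.

Lemma ipDl f g u : Lsq f -> Lsq g -> Lsq u ->
  ip (fun x => f x + g x) u = ip f u + ip g u.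
Proof.
move=> Lf Lg Lu; rewrite /ip -RintegralD//; do 2? exact: Lsq_mul.
by apply: eq_Rintegral => x _; rewrite mulrDl.
Qed.

Lemma ipBl f g u : Lsq f -> Lsq g -> Lsq u ->
  ip (fun x => f x - g x) u = ip f u - ip g u.
Proof.
move=> Lf Lg Lu; rewrite /ip -RintegralB//; do 2? exact: Lsq_mul.
by apply: eq_Rintegral => x _; rewrite mulrBl.
Qed.

Lemma ipZr a f g : Lsq f -> Lsq g -> ip f (fun x => a * g x) = a * ip f g.
Proof. by move=> Lf Lg; rewrite ipC ipZl// ipC. Qed.

Lemma ipDr f g u : Lsq f -> Lsq g -> Lsq u ->
  ip u (fun x => f x + g x) = ip u f + ip u g.
Proof. by move=> Lf Lg Lu; rewrite ipC ipDl// !(ipC u). Qed.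

Lemma ipBr f g u : Lsq f -> Lsq g -> Lsq u ->
  ip u (fun x => f x - g x) = ip u f - ip u g.
Proof. by move=> Lf Lg Lu; rewrite ipC ipBl// !(ipC u). Qed.

Lemma ip_ge0 f : 0 <= ip f f.
Proof. by apply: Rintegral_ge0 => x _; rewrite -expr2 sqr_ge0. Qed.

Lemma ip_sq_sub f g : Lsq f -> Lsq g ->
  ip (fun x => f x - g x) (fun x => f x - g x) = ip f f - 2 * ip f g + ip g g.
Proof.
move=> Lf Lg; have Lfg := LsqB Lf Lg.
by rewrite ipBl// !ipBr// (ipC g f); ring.
Qed.

Lemma ip_sq_add f g : Lsq f -> Lsq g ->
  ip (fun x => f x + g x) (fun x => f x + g x) = ip f f + 2 * ip f g + ip g g.
Proof.
move=> Lf Lg; have Lfg := LsqD Lf Lg.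
by rewrite ipDl// !ipDr// (ipC g f); ring.
Qed.

(** The parallelogram law with the square of the difference dropped. *)
Lemma ip_sq_add_le f g : Lsq f -> Lsq g ->
  ip (fun x => f x + g x) (fun x => f x + g x) <= 2 * ip f f + 2 * ip g g.
Proof.
move=> Lf Lg; have := ip_ge0 (fun x => f x - g x).
by rewrite ip_sq_sub// ip_sq_add//; move: (ip f f) (ip g g) (ip f g) => a b c; lra.
Qed.

Lemma ip_cauchy f g : Lsq f -> Lsq g -> (ip f g) ^+ 2 <= ip f f * ip g g.
Proof.
move=> Lf Lg.
have H t : 0 <= ip f f - 2 * (t * ip f g) + t ^+ 2 * ip g g.
  have Ltg := LsqZ t Lg.
  have := ip_ge0 (fun x => f x - t * g x).
  by rewrite ip_sq_sub// ipZr// ipZl// ipZr// [t ^+ 2]expr2 -mulrA.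
have [g0|g0] := eqVneq (ip g g) 0.
  rewrite g0 mulr0; have [->|n0] := eqVneq (ip f g) 0; first by rewrite expr0n.
  (* With [ip g g = 0] the quadratic in t is affine, and at this t it equals -1. *)
  have := H ((ip f f + 1) / (2 * ip f g)); rewrite g0 mulr0 addr0.
  have -> : 2 * ((ip f f + 1) / (2 * ip f g) * ip f g) = ip f f + 1 by field.
  by rewrite opprD addrA subrr add0r lerNr oppr0 ler10.
have gp : 0 < ip g g by rewrite lt_neqAle eq_sym g0 ip_ge0.
have := H (ip f g / ip g g).
have -> : ip f f - 2 * (ip f g / ip g g * ip f g) + (ip f g / ip g g) ^+ 2 * ip g g
   = (ip f f * ip g g - ip f g ^+ 2) / ip g g by field.
by rewrite pmulr_lge0 ?invr_gt0// subr_ge0.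
Qed.

Lemma ip_cauchy_norm f g : Lsq f -> Lsq g ->
  `|ip f g| <= Num.sqrt (ip f f) * Num.sqrt (ip g g).
Proof.
move=> Lf Lg; rewrite -sqrtrM ?ip_ge0// -sqrtr_sqr ler_wsqrtr//.
exact: ip_cauchy.
Qed.

Lemma ip_eq0_ae f : Lsq f -> ip f f = 0 -> {ae mu, forall x, f x = 0}.
Proof.
move=> Lf f0.
have : (\int[mu]_(x in setT) `|(f x ^+ 2)%:E| = 0)%E.
  under eq_integral => x _ do rewrite /= ger0_norm ?sqr_ge0//.
  by rewrite -/(sqint f) Lsq_ip// f0.
have mf2 : measurable_fun setT (fun x => (f x ^+ 2)%:E).
  by apply/measurable_EFinP/measurable_funX; exact: Lsq_meas.
move=> /(ae_eq_integral_abs mu measurableT mf2) ae0.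
apply: filterS ae0 => x /(_ I) /= /eqP.
by rewrite eqe expf_eq0/= => /eqP.
Qed.

Lemma eq_ae_sqint f g : measurable_fun setT f -> measurable_fun setT g ->
  {ae mu, forall x, f x = g x} -> sqint f = sqint g.
Proof.
move=> mf mg fg; apply: ae_eq_integral => //.
- exact/measurable_EFinP/measurable_funX.
- exact/measurable_EFinP/measurable_funX.
- by apply: filterS fg => x -> _.
Qed.

Lemma eq_ae_ip f g u : Lsq f -> Lsq g -> Lsq u ->
  {ae mu, forall x, f x = g x} -> ip f u = ip g u.
Proof.
move=> Lf Lg Lu fg; rewrite /ip /Rintegral; congr fine; apply: ae_eq_integral => //.
- exact: measurable_int (Lsq_mul Lf Lu).
- exact: measurable_int (Lsq_mul Lg Lu).
- by apply: filterS fg => x -> _.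
Qed.

Lemma eq_ae_Lsq f g : measurable_fun setT g -> Lsq f ->
  {ae mu, forall x, f x = g x} -> Lsq g.
Proof. by move=> mg [mf ff] fg; split => //; rewrite -(eq_ae_sqint mf mg fg). Qed.

Definition cvgL2 (u_ : nat -> T -> R) f :=
  (fun n => ip (fun x => u_ n x - f x) (fun x => u_ n x - f x)) @ \oo --> (0 : R).

Lemma cvgL2_ip (u_ : nat -> T -> R) f g : (forall n, Lsq (u_ n)) -> Lsq f -> Lsq g ->
  cvgL2 u_ f -> (fun n => ip (u_ n) g) @ \oo --> ip f g.
Proof.
move=> Lu Lf Lg uf.
have s0 : (fun n => Num.sqrt (ip (fun x => u_ n x - f x) (fun x => u_ n x - f x)) *
    Num.sqrt (ip g g)) @ \oo --> (0 : R).
  rewrite -(mul0r (Num.sqrt (ip g g))) -[X in X * _](sqrtr0 R); apply: cvgMl.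
  by have := cvg_comp _ _ uf (@sqrt_continuous R 0); apply.
apply/subr_cvg0; apply: norm_cvg0.
apply: (squeeze_cvgr _ (cvg_cst 0) s0).
by near=> n; rewrite normr_ge0/= -ipBl//; apply: ip_cauchy_norm => //; exact: LsqB.
Unshelve. all: by end_near. Qed.

(** Expanding the square of [u_ n - f] leaves only the cross term, which converges by [cvgL2_ip]. *)
Lemma cvgL2_nsq (u_ : nat -> T -> R) f : (forall n, Lsq (u_ n)) -> Lsq f ->
  cvgL2 u_ f -> (fun n => ip (u_ n) (u_ n)) @ \oo --> ip f f.
Proof.
move=> Lu Lf uf; have h := cvgL2_ip Lu Lf Lf uf.
have -> : (fun n => ip (u_ n) (u_ n)) = (fun n =>
  ip (fun x => u_ n x - f x) (fun x => u_ n x - f x) + 2 * ip (u_ n) f - ip f f).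
  by apply/funext => n; rewrite ip_sq_sub//; ring.
rewrite [X in _ --> X](_ : _ = 0 + 2 * ip f f - ip f f); last by ring.
by apply: cvgB; [apply: cvgD => //; apply: cvgMr|exact: cvg_cst].
Qed.

Lemma cvgL2D (u_ v_ : nat -> T -> R) f g : (forall n, Lsq (u_ n)) -> Lsq f ->
  (forall n, Lsq (v_ n)) -> Lsq g -> cvgL2 u_ f -> cvgL2 v_ g ->
  cvgL2 (fun n x => u_ n x + v_ n x) (fun x => f x + g x).
Proof.
move=> Lu Lf Lv Lg uf vg.
have s0 : (fun n => 2 * ip (fun x => u_ n x - f x) (fun x => u_ n x - f x) +
    2 * ip (fun x => v_ n x - g x) (fun x => v_ n x - g x)) @ \oo --> (0 : R).
  have -> : 0 = 2 * 0 + 2 * 0 :> R by ring.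
  by apply: cvgD; apply: cvgMr.
apply: (squeeze_cvgr _ (cvg_cst 0) s0).
near=> n; rewrite ip_ge0/=.
have -> : (fun x => u_ n x + v_ n x - (f x + g x)) =
   (fun x => (u_ n x - f x) + (v_ n x - g x)) by apply/funext => x; ring.
by apply: ip_sq_add_le; exact: LsqB.
Unshelve. all: by end_near. Qed.

Lemma cvgL2Z a (u_ : nat -> T -> R) f : (forall n, Lsq (u_ n)) -> Lsq f ->
  cvgL2 u_ f -> cvgL2 (fun n x => a * u_ n x) (fun x => a * f x).
Proof.
move=> Lu Lf uf; rewrite /cvgL2.
have -> : (fun n => ip (fun x => a * u_ n x - a * f x) (fun x => a * u_ n x - a * f x))
  = (fun n => a ^+ 2 * ip (fun x => u_ n x - f x) (fun x => u_ n x - f x)).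
  apply/funext => n; have Lb := LsqB (Lu n) Lf.
  have -> : (fun x => a * u_ n x - a * f x) = (fun x => a * (u_ n x - f x)).
    by apply/funext => x; ring.
  by rewrite ipZl ?ipZr//; [ring|exact: LsqZ].
by rewrite -[X in _ --> X](mulr0 (a ^+ 2)); apply: cvgMr.
Qed.

(** The zero sequence [u_ n - u_ n] converges both to 0 and to [f - g]. *)
Lemma cvgL2_unique (u_ : nat -> T -> R) f g : (forall n, Lsq (u_ n)) -> Lsq f -> Lsq g ->
  cvgL2 u_ f -> cvgL2 u_ g -> {ae mu, forall x, f x = g x}.
Proof.
move=> Lu Lf Lg uf ug.
have := cvgL2D Lu Lf (fun n => LsqZ (-1) (Lu n)) (LsqZ (-1) Lg) uf
  (@cvgL2Z (-1) _ _ Lu Lg ug).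
have Lfg := LsqD Lf (LsqZ (-1) Lg).
have Ln n := LsqD (Lu n) (LsqZ (-1) (Lu n)).
move=> /(cvgL2_nsq Ln Lfg).
have -> : (fun n => ip (fun x => u_ n x + -1 * u_ n x) (fun x => u_ n x + -1 * u_ n x))
  = cst 0.
  apply/funext => n; rewrite /ip.
  have -> : (fun x => (u_ n x + -1 * u_ n x) * (u_ n x + -1 * u_ n x)) = cst 0.
    by apply/funext => x/=; ring.
  by rewrite Rintegral_cst// mul0r.
move=> c0.
have /(ip_eq0_ae Lfg) : ip (fun x => f x + -1 * g x) (fun x => f x + -1 * g x) = 0.
  by apply/esym; exact: cvg_unique (@cvg_cst _ _ _ _ _) c0.
by apply: filterS => x; lra.
Qed.

End SquareIntegrable.

(** * Completeness of L^2 and limit theorems *)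

Section Completeness.
Context d (T : measurableType d) (R : realType).
Context (mu : {measure set T -> \bar R}).
Implicit Types (f g u v : T -> R) (a b : R).

Lemma limn_einf_le (u : (\bar R)^nat) (c : \bar R) :
  (\forall n \near \oo, (u n <= c)%E) -> (limn_einf u <= c)%E.
Proof.
move=> uc; rewrite limn_einf_lim; apply: lime_le; first exact: is_cvg_einfs.
case: uc => N _ uc; apply: nearW => n.
apply: (@le_trans _ _ (u (maxn n N))); last by apply: uc => /=; exact: leq_maxr.
by apply: ereal_inf_lbound; exists (maxn n N) => //=; exact: leq_maxl.
Qed.

Lemma fatou_sqint (u_ : nat -> T -> R) f (c : \bar R) :
  (forall n, measurable_fun setT (u_ n)) ->
  (forall x, (fun n => u_ n x) @ \oo --> f x) ->
  (\forall n \near \oo, (sqint mu (u_ n) <= c)%E) -> (sqint mu f <= c)%E.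
Proof.
move=> mu_ uf uc.
apply: (@le_trans _ _ (limn_einf (fun n => sqint mu (u_ n)))); last exact: limn_einf_le.
apply: le_trans (fatou mu measurableT _ _).
- rewrite le_eqVlt; apply/orP; left; apply/eqP; apply: eq_integral => x _.
  apply/esym; apply: (cvg_limn_einf_sup _).1.
  apply: cvg_EFin; first exact: nearW.
  have -> : fine \o (fun n => ((u_ n x) ^+ 2)%:E) = (fun n => u_ n x * u_ n x).
    by apply/funext => n /=; rewrite expr2.
  by rewrite expr2; apply: cvgM.
- by move=> n; apply/measurable_EFinP/measurable_funX.
- by move=> n x _; rewrite lee_fin sqr_ge0.
Qed.

(** The factor 4^-j is chosen so that the sum of 4^j |v_(j+1) - v_j|^2 has integral at most the sum
    of 2^-(j+1). That sum is then finite almost everywhere, say equal to b, and |v_(j+1) - v_j| <=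
    sqrt b / 2^j is summable. *)
Let q j : R := 4 ^- j / (2 ^ j.+1)%:R.

Lemma fast_cauchy_cvg (v_ : nat -> T -> R) : (forall j, Lsq mu (v_ j)) ->
  (forall j, ip mu (fun x => v_ j.+1 x - v_ j x) (fun x => v_ j.+1 x - v_ j x) <= q j) ->
  exists E : set T, [/\ measurable E, mu (~` E) = 0%E &
   forall x, E x -> cvgn (fun j => v_ j x)].
Proof.
move=> Lv vq.
have Ld j := LsqB (Lv j.+1) (Lv j).
pose F j x : \bar R := (4 ^+ j * (v_ j.+1 x - v_ j x) ^+ 2)%:E.
have F0 j x : (0 <= F j x)%E by rewrite lee_fin mulr_ge0// ?sqr_ge0// exprn_ge0.
have mF j : measurable_fun setT (F j).
  by apply/measurable_EFinP/measurable_funM => //; exact/measurable_funX/(Lsq_meas (Ld j)).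
have iF j : (\int[mu]_x F j x = (4 ^+ j * ip mu (fun x => v_ j.+1 x - v_ j x) (fun x => v_ j.+1 x - v_ j x))%:E)%E.
  rewrite /F; under eq_integral do rewrite EFinM.
  rewrite ge0_integralZl//; first by rewrite -/(sqint mu _) Lsq_ip// EFinM.
  - exact/measurable_EFinP/measurable_funX/(Lsq_meas (Ld j)).
  - by move=> x _; rewrite lee_fin sqr_ge0.
pose B x := (\sum_(j <oo) F j x)%E.
have mB : measurable_fun setT B by apply: ge0_emeasurable_sum => // j x _ _; exact: F0.
have iB : (\int[mu]_x B x < +oo)%E.
  rewrite integral_nneseries//.
  apply: (@le_lt_trans _ _ (1%:E : \bar R)%E); last exact: ltry.
  apply: le_trans (@epsilon_trick0 R 1 xpredT ler01).
  apply: lee_nneseries => [j _ _|j _]; first by apply: integral_ge0.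
  rewrite iF lee_fin.
  have := ler_wpM2l (exprn_ge0 j (ler0n R 4)) (vq j).
  by rewrite /q mulrA mulfV ?expf_neq0.
have iBi : mu.-integrable setT B.
  apply/integrableP; split => //; under eq_integral => x _.
    rewrite gee0_abs; last by apply: nneseries_ge0 => j _ _; exact: F0.
    over.
  exact: iB.
have [N [mN N0 Nsub]] := integrable_ae measurableT iBi.
exists (~` N); split; [exact: measurableC|by rewrite setCK|].
move=> x Nx.
have Bfin : B x \is a fin_num.
  by apply: contrapT => h; apply: Nx; apply: Nsub => /= /(_ I).
pose b := fine (B x).
have b0 : 0 <= b by apply: fine_ge0; apply: nneseries_ge0 => j _ _; exact: F0.
have Fb j : 4 ^+ j * (v_ j.+1 x - v_ j x) ^+ 2 <= b.
  rewrite -lee_fin /b fineK//.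
  have : (F j x <= \sum_(0 <= i < j.+1) F i x)%E.
    by rewrite big_nat_recr//= leeDr// sume_ge0.
  by move=> /le_trans; apply; apply: nneseries_lim_ge => n _ _; exact: F0.
have dv j : `|v_ j.+1 x - v_ j x| <= geometric (Num.sqrt b) 2^-1 j.
  rewrite /geometric /= -sqrtr_sqr.
  have -> : (2^-1 : R) ^+ j = Num.sqrt ((4 ^+ j)^-1).
    have -> : (4 : R) = 2 ^+ 2 by ring.
    by rewrite -exprM mulnC exprM -exprVn sqrtr_sqr ger0_norm ?exprVn// invr_ge0 exprn_ge0.
  by rewrite -sqrtrM// ler_wsqrtr// ler_pdivlMr ?exprn_gt0// mulrC.
have cs : cvgn (series (telescope (fun j => v_ j x))).
  apply: normed_cvg; apply: (series_le_cvg _ _ dv).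
  - by move=> n; exact: normr_ge0.
  - by move=> n; apply: geometric_ge0.
  - by apply: is_cvg_geometric_series; rewrite ger0_norm; lra.
have -> : (fun j => v_ j x) = (fun j => v_ 0%N x + series (telescope (fun j => v_ j x)) j).
  by apply/funext => j; rewrite -eq_sum_telescope.
by apply: is_cvgD => //; exact: is_cvg_cst.
Qed.

(** A fast subsequence converges almost everywhere. Fatou's lemma in the subsequence index then
    turns the Cauchy condition into convergence of the whole sequence to that limit. *)
Lemma Lsq_complete (u_ : nat -> T -> R) : (forall n, Lsq mu (u_ n)) ->
  (forall e, 0 < e -> exists N, forall m n, (N <= m)%N -> (N <= n)%N ->
    ip mu (fun x => u_ m x - u_ n x) (fun x => u_ m x - u_ n x) <= e) ->
  exists2 f, Lsq mu f & cvgL2 mu u_ f.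
Proof.
move=> Lu cu.
have q0 j : 0 < q j by rewrite /q divr_gt0 ?invr_gt0 ?exprn_gt0 ?ltr0n ?expn_gt0.
have /choice[K hK] : forall j, exists N, forall m n, (N <= m)%N -> (N <= n)%N ->
    ip mu (fun x => u_ m x - u_ n x) (fun x => u_ m x - u_ n x) <= q j.
  by move=> j; exact: cu.
(* The partial sum makes [k] monotone and at least [K]; the summand [j] makes it tend to
   infinity. *)
pose k j := (\sum_(i < j.+1) K i + j)%N.
have kK j : (K j <= k j)%N by rewrite /k big_ord_recr/= addnAC leq_addl.
have kS j : (k j <= k j.+1)%N.
  by rewrite /k [X in (_ <= X + _)%N]big_ord_recr/= leq_add// leq_addr.
pose v j := u_ (k j).
have Lv j : Lsq mu (v j) by exact: Lu.
have [E [mE E0 cE]] := @fast_cauchy_cvg v Lv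
  (fun j => hK j _ _ (leq_trans (kK j) (kS j)) (kK j)).
(* Setting the functions to 0 off the convergence set gives a limit at every point, which is
   therefore measurable. *)
pose w j := v j \_ E.
have Lw j : Lsq mu (w j) by exact: Lsq_patch.
pose f x := limn (fun j => w j x).
have wf x : (fun j => w j x) @ \oo --> f x.
  rewrite /f /w; have [Ex|Ex] := pselect (E x).
    have -> : (fun j => (v j \_ E) x) = (fun j => v j x).
      by apply/funext => j; rewrite patchE mem_set.
    exact: cE.
  have -> : (fun j => (v j \_ E) x) = cst 0.
    by apply/funext => j; rewrite patchE memNset.
  exact: is_cvg_cst.
have mf : measurable_fun setT f.
  by apply: (@measurable_fun_cvg _ _ _ _ w) => // j; exact: Lsq_meas (Lw j).
have aeE : {ae mu, forall x, E x}.
  by exists (~` E); split => //; exact: measurableC.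
have wu n j : sqint mu (fun x => u_ n x - w j x) = sqint mu (fun x => u_ n x - v j x).
  apply: eq_ae_sqint; try by apply: measurable_funB; exact: Lsq_meas.
  by apply: filterS aeE => x Ex; rewrite /w patchE mem_set.
have key e : 0 < e -> exists N, forall n, (N <= n)%N ->
   (sqint mu (fun x => (u_ n x - f x)%R) <= e%:E)%E.
  move=> e0; have [N hN] := cu _ e0; exists N => n Nn.
  apply: (@fatou_sqint (fun j x => u_ n x - w j x)).
  - by move=> j; apply: measurable_funB; exact: Lsq_meas.
  - by move=> x; apply: cvgB => //; exact: cvg_cst.
  - exists N => // j /= Nj; rewrite wu Lsq_ip; last exact: LsqB.
    by rewrite lee_fin; apply: hN => //; rewrite (leq_trans Nj)// /k leq_addl.
have Lf : Lsq mu f.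
  have [N hN] := key 1 ltr01.
  have L1 : Lsq mu (fun x => u_ N x - f x).
    split; first by apply: measurable_funB => //; exact: Lsq_meas.
    by apply: le_lt_trans (hN N (leqnn N)) _; exact: ltry.
  have := LsqB (Lu N) L1; congr Lsq; apply/funext => x; ring.
exists f => //; apply/cvgrPdist_le => e e0.
have [N hN] := key _ e0; exists N => // n /= Nn.
rewrite sub0r normrN ger0_norm ?ip_ge0// -lee_fin -Lsq_ip; first exact: hN.
exact: LsqB.
Qed.

(** The squared differences are dominated by 4 g^2. *)
Lemma dominated_cvgL2 (f_ : nat -> T -> R) f g :
  (forall n, measurable_fun setT (f_ n)) -> measurable_fun setT f -> Lsq mu g ->
  (forall n x, `|f_ n x| <= `|g x|) -> (forall x, `|f x| <= `|g x|) ->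
  {ae mu, forall x, (fun n => f_ n x) @ \oo --> f x} -> cvgL2 mu f_ f.
Proof.
move=> mf_ mf Lg f_g fg f_f.
have Lf : Lsq mu f by exact: Lsq_le Lg fg.
have Lf_ n : Lsq mu (f_ n) by exact: Lsq_le Lg (f_g n).
have Ld n := LsqB (Lf_ n) Lf.
have i4 : mu.-integrable setT (fun x => (4%:E * (g x * g x)%:E)%E).
  exact: integrableZl (Lsq_mul Lg Lg).
have [| | | |_ _ h] := @dominated_convergence _ _ _ mu setT measurableT
  (fun n x => ((f_ n x - f x) * (f_ n x - f x))%:E) (cst 0%E) _ _ _ _ i4.
- by move=> n; exact: measurable_int (Lsq_mul (Ld n) (Ld n)).
- exact: measurable_cst.
- apply: filterS f_f => x fx _; apply: cvg_EFin; first exact: nearW.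
  have -> : 0 = (f x - f x) * (f x - f x) by ring.
  by apply: cvgM; apply: cvgB => //; exact: cvg_cst.
- apply: aeW => x n _ /=; rewrite lee_fin -expr2 ger0_norm ?sqr_ge0//.
  rewrite -(real_normK (num_real (f_ n x - f x))) -[g x * g x]expr2.
  rewrite -(real_normK (num_real (g x))) (_ : 4 = 2 ^+ 2); last by ring.
  rewrite -exprMn lerXn2r ?nnegrE ?mulr_ge0//.
  by rewrite (le_trans (ler_normB _ _))// mulr_natl mulr2n lerD.
move: h; rewrite integral0 => /fine_cvg; exact.
Qed.

End Completeness.

(** * The Lebesgue measure of the plane *)

Notation line R := (measurableTypeR R).
Notation plane R := (measurableTypeR R * measurableTypeR R)%type.
Notation mfun2 R f := (measurable_fun [set: plane R] f).

Section Reflection.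
Context (R : realType).
Implicit Types (a x : R * R) (f : R * R -> R).

Lemma measurable_reflect1 (a : R) : measurable_fun [set: line R] (fun x : line R => (a - x)%R : line R).
Proof. exact: measurable_funB. Qed.

(** Reflection turns a half-open interval into one of the same length, closed at the other end, and
    Lebesgue measure is determined by its values on half-open intervals. *)
Lemma lebesgue_reflect1 (a : R) (A : set R) : measurable A ->
  leb1 R ((fun x : R => a - x) @^-1` A) = leb1 R A.
Proof.
move=> mA.
pose phi_mixin := isMeasurableFun.Build _ _ _ _ _ (measurable_reflect1 a).
pose phi : {mfun _ >-> _} := HB.pack (fun x : line R => (a - x)%R : line R) phi_mixin.
apply/esym/(lebesgue_measure_unique (mu := pushforward (leb1 R) phi)) => //.
move=> X [[p q] _ <-] /=; rewrite /pushforward /=.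
have -> : (fun x : R => a - x) @^-1` `]p, q] = `[a - q, a - p[%classic.
  by apply/seteqP; split=> x /=; rewrite !in_itv/=; lra.
rewrite !lebesgue_measure_itv/= !lte_fin ltrD2l ltrN2.
by case: ifPn => // _; rewrite -!EFinB; congr EFin; ring.
Qed.

Definition reflect a x : R * R := (a.1 - x.1, a.2 - x.2).

Lemma reflectK a : involutive (reflect a).
Proof. by move=> [x y]; rewrite /reflect/=; congr pair; ring. Qed.

Lemma measurable_reflect a : measurable_fun [set: plane R] (reflect a : plane R -> plane R).
Proof.
by apply/measurable_fun_pair => /=; apply: measurable_funB;
  [exact: measurable_cst|exact: measurable_fst|exact: measurable_cst|exact: measurable_snd].
Qed.

Lemma lebesgue_reflect a (A : set (plane R)) : measurable A ->
  leb2 R (reflect a @^-1` A) = leb2 R A.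
Proof.
move=> mA.
pose phi_mixin := isMeasurableFun.Build _ _ _ _ _ (measurable_reflect a).
pose phi : {mfun _ >-> _} := HB.pack (reflect a : plane R -> plane R) phi_mixin.
apply/esym/(product_measure_unique (m' := pushforward (leb2 R) phi)) => //.
move=> B C mB mC; rewrite /pushforward /=.
transitivity (leb2 R (((fun x : R => a.1 - x) @^-1` B) `*` ((fun x : R => a.2 - x) @^-1` C))).
  by [].
rewrite product_measure1E//; last 2 first.
- by rewrite -[X in measurable X]setTI; apply: measurable_reflect1.
- by rewrite -[X in measurable X]setTI; apply: measurable_reflect1.
by congr (_ * _)%E; [exact: (lebesgue_reflect1 _ mB)|exact: (lebesgue_reflect1 _ mC)].
Qed.

Lemma ge0_integral_reflect a (f : R * R -> \bar R) : mfun2 R f ->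
  (forall x, 0 <= f x)%E -> (\int[leb2 R]_x f (reflect a x) = \int[leb2 R]_x f x)%E.
Proof.
move=> mf f0.
have := ge0_integral_pushforward (measurable_reflect a) (leb2 R) measurableT mf (fun x _ => f0 x).
rewrite preimage_setT /= => <-.
apply: eq_measure_integral => [|mp A mA _]; first exact: measurable_reflect.
exact: (lebesgue_reflect a mA).
Qed.

Lemma integral_reflect a (f : R * R -> \bar R) : mfun2 R f ->
  (\int[leb2 R]_x f (reflect a x) = \int[leb2 R]_x f x)%E.
Proof.
move=> mf; rewrite integralE [RHS]integralE; congr (_ - _)%E.
- rewrite -(ge0_integral_reflect a (f := f^\+%E)) //; last exact: measurable_funepos.
  by apply: eq_integral => x _; rewrite /= !funeposE.
- rewrite -(ge0_integral_reflect a (f := f^\-%E)) //; last exact: measurable_funeneg.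
  by apply: eq_integral => x _; rewrite /= !funenegE.
Qed.

Lemma ae2_imp (P Q : plane R -> Prop) : (forall x, P x -> Q x) ->
  {ae leb2 R, forall x, P x} -> {ae leb2 R, forall x, Q x}.
Proof.
move=> PQ [A [mA A0 PA]]; exists A; split => // x /= nQ; apply: PA => /= Px.
exact/nQ/PQ.
Qed.

Lemma ae2_and (P Q : plane R -> Prop) : {ae leb2 R, forall x, P x} ->
  {ae leb2 R, forall x, Q x} -> {ae leb2 R, forall x, P x /\ Q x}.
Proof.
move=> [A [mA A0 PA]] [B [mB B0 PB]]; exists (A `|` B); split.
- exact: measurableU.
- by rewrite null_set_setU.
- move=> x /= nPQ; have [Px|nPx] := pselect (P x); last by left; exact: PA.
  by right; apply: PB => /= Qx; apply: nPQ.
Qed.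

Lemma ae_reflect a (P : R * R -> Prop) : {ae leb2 R, forall x, P x} ->
  {ae leb2 R, forall x, P (reflect a x)}.
Proof.
move=> [A [mA A0 PA]]; exists (reflect a @^-1` A); split.
- by rewrite -[X in measurable X]setTI; apply: measurable_reflect.
- by rewrite lebesgue_reflect.
- by move=> x /= nP; apply: PA => /= Px; exact: nP.
Qed.

Lemma Lsq_reflect a f : Lsq (leb2 R) f -> Lsq (leb2 R) (f \o reflect a).
Proof.
move=> [mf ff]; split; first exact: measurableT_comp mf (measurable_reflect a).
rewrite /sqint (@ge0_integral_reflect a (fun x => ((f x) ^+ 2)%:E))//.
- by apply/measurable_EFinP; exact: measurable_funX.
- by move=> x; rewrite lee_fin sqr_ge0.
Qed.

Lemma ip_reflect a f g : mfun2 R f -> mfun2 R g ->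
  ip (leb2 R) (f \o reflect a) (g \o reflect a) = ip (leb2 R) f g.
Proof.
move=> mf mg; rewrite /ip /Rintegral; congr fine.
rewrite -(@integral_reflect a (fun x => (f x * g x)%:E))//.
by apply/measurable_EFinP; exact: measurable_funM.
Qed.

End Reflection.

(** * Density of step functions on rectangles *)

Section Density.
Context (R : realType).
Notation mu := (leb2 R).
Implicit Types (f g : R * R -> R).

Definition rect (a b c e : R) : set (plane R) := `]a, b]%classic `*` `]c, e]%classic.

Lemma measurable_rect a b c e : measurable (rect a b c e).
Proof. exact: measurableX. Qed.

Lemma lebesgue_rect a b c e : (mu (rect a b c e) < +oo)%E.
Proof.
have h p q : (leb1 R `]p, q]%classic < +oo)%E.
  by rewrite lebesgue_measure_itv/=; case: ifP => // _; rewrite -EFinB ltry.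
rewrite /rect product_measure1E// lte_mul_pinfty//; last exact: h.
by rewrite ge0_fin_numE//; exact: h.
Qed.

Lemma rectI a b c e a' b' c' e' : rect a b c e `&` rect a' b' c' e' =
  rect (Num.max a a') (Num.min b b') (Num.max c c') (Num.min e e').
Proof.
apply/seteqP; split=> -[x y]; rewrite /rect /= !in_itv/= !gt_max !le_min.
  by move=> [[/andP[-> ->] /andP[-> ->]] [/andP[-> ->] /andP[-> ->]]].
by move=> [/andP[/andP[-> ->] /andP[-> ->]] /andP[/andP[-> ->] /andP[-> ->]]].
Qed.

Definition box (n : nat) := rect (- n%:R) n%:R (- n%:R) n%:R.

Lemma box_exhaust (x : R * R) : \forall n \near \oo, box n x.
Proof.
have [N hN] : exists N : nat, `|x.1| + `|x.2| < N%:R.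
  by exists (Num.truncn (`|x.1| + `|x.2|)).+1; rewrite truncnS_gt.
exists N => // n /= Nn.
have : `|x.1| + `|x.2| < n%:R by rewrite (lt_le_trans hN)// ler_nat.
rewrite /box /rect /= !in_itv/= => h.
have h1 : `|x.1| < n%:R by apply: le_lt_trans h; rewrite lerDl.
have h2 : `|x.2| < n%:R by apply: le_lt_trans h; rewrite lerDr.
move: h1 h2; rewrite !ltr_norml => /andP[-> h1] /andP[-> h2].
by rewrite !ltW.
Qed.

(** Given by generators, so that identities which are linear or bilinear in step functions follow by
    induction from the case of rectangles. *)
Inductive step : (R * R -> R) -> Prop :=
| step_rect a b c e : step (\1_(rect a b c e))
| step_add f g : step f -> step g -> step (fun x => f x + g x)
| step_scale k f : step f -> step (fun x => k * f x).

Lemma Lsq_indic (A : set (plane R)) : measurable A -> (mu A < +oo)%E -> Lsq mu (\1_A).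
Proof.
move=> mA Aoo; split; first exact: measurable_indic.
rewrite /sqint; under eq_integral => x _.
  have -> : (\1_A x : R) ^+ 2 = \1_A x by rewrite indicE expr2 -natrM mulnb andbb.
  over.
by rewrite integral_indic// setIT.
Qed.

Lemma Lsq_step f : step f -> Lsq mu f.
Proof.
elim=> [a b c e|{}f g _ Lf _ Lg|k {}f _ Lf]; last 2 first.
- exact: LsqD.
- exact: LsqZ.
by apply: Lsq_indic; [exact: measurable_rect|exact: lebesgue_rect].
Qed.

Lemma step0 : step (fun=> 0).
Proof.
have := step_scale 0 (step_rect 0 0 0 0); congr step.
by apply/funext => x; rewrite mul0r.
Qed.

Lemma step_box n f : step f -> step (f \_ (box n)).
Proof.
elim=> [a b c e|{}f g _ Lf _ Lg|k {}f _ Lf].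
- have -> : (\1_(rect a b c e) : plane R -> R) \_ (box n) = \1_(rect a b c e `&` box n).
    apply/funext => x; rewrite patchE !indicE in_setI.
    by case: (x \in box n); rewrite ?andbT ?andbF.
  by rewrite rectI; exact: step_rect.
- have := step_add Lf Lg; congr step; apply/funext => x; rewrite !patchE.
  by case: ifP => //; rewrite addr0.
- have := step_scale k Lf; congr step; apply/funext => x; rewrite !patchE.
  by case: ifP => //; rewrite mulr0.
Qed.

Definition step_closure f := Lsq mu f /\ forall e, 0 < e -> exists2 g, step g &
  ip mu (fun x => f x - g x) (fun x => f x - g x) <= e.

Lemma step_closure_step f : step f -> step_closure f.
Proof.
move=> sf; split; first exact: Lsq_step.
move=> e e0; exists f => //; rewrite /ip.
have -> : (fun x => (f x - f x) * (f x - f x)) = cst 0.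
  by apply/funext => x /=; rewrite subrr mulr0.
by rewrite Rintegral_cst// mul0r ltW.
Qed.

Lemma step_closureD f g : step_closure f -> step_closure g ->
  step_closure (fun x => f x + g x).
Proof.
move=> [Lf cf] [Lg cg]; split; first exact: LsqD.
move=> e e0; have e4 : 0 < e / 4 by rewrite divr_gt0.
have [u su hu] := cf _ e4; have [v sv hv] := cg _ e4.
have [Lu Lv] := (Lsq_step su, Lsq_step sv).
exists (fun x => u x + v x); first exact: step_add.
have -> : (fun x => f x + g x - (u x + v x)) = (fun x => (f x - u x) + (g x - v x)).
  by apply/funext => x; ring.
have := ip_sq_add_le (LsqB Lf Lu) (LsqB Lg Lv).
move: hu hv; set A := ip _ _ _; set B := ip _ _ _; set C := ip _ _ _ => hA hB hC.
lra.
Qed.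

Lemma step_closureZ k f : step_closure f -> step_closure (fun x => k * f x).
Proof.
move=> [Lf cf]; split; first exact: LsqZ.
move=> e e0; have k1 : 0 < k ^+ 2 + 1 by rewrite ltr_wpDl// sqr_ge0.
have [u su hu] := cf _ (divr_gt0 e0 k1); have Lu := Lsq_step su.
exists (fun x => k * u x); first exact: step_scale.
have Lb := LsqB Lf Lu.
have -> : (fun x => k * f x - k * u x) = (fun x => k * (f x - u x)).
  by apply/funext => x; ring.
rewrite ipZl ?ipZr//; last exact: LsqZ.
have h0 := ip_ge0 mu (fun x => f x - u x).
rewrite mulrA -expr2; apply: (@le_trans _ _ ((k ^+ 2 + 1) * (e / (k ^+ 2 + 1)))).
  by apply: ler_pM => //; rewrite ?sqr_ge0// lerDl.
by rewrite mulrCA mulfV ?mulr1// gt_eqF.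
Qed.

Lemma step_closure_lim (f_ : nat -> R * R -> R) f : Lsq mu f ->
  (forall n, step_closure (f_ n)) -> cvgL2 mu f_ f -> step_closure f.
Proof.
move=> Lf cf ff; split => // e e0; have e4 : 0 < e / 4 by rewrite divr_gt0.
have /cvgrPdist_le/(_ _ e4)[N _ /(_ N (leqnn N))] := ff.
rewrite sub0r normrN ger0_norm ?ip_ge0// => hN.
have [LN /(_ _ e4)[u su hu]] := cf N; have Lu := Lsq_step su.
exists u => //.
have -> : (fun x => f x - u x) = (fun x => -1 * (f_ N x - f x) + (f_ N x - u x)).
  by apply/funext => x; ring.
have L1 := LsqB LN Lf.
have := ip_sq_add_le (LsqZ (-1) L1) (LsqB LN Lu).
rewrite (@ipZl _ _ _ mu) ?(@ipZr _ _ _ mu)//; last exact: LsqZ.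
move: hN hu; set A := ip _ _ _; set B := ip _ _ _; set C := ip _ _ _ => hA hB hC.
lra.
Qed.

(** Rectangles are stable under intersection, so Dynkin's induction is available once they generate.
    Both projections are measurable for the generated sigma-algebra, because the preimage of an
    interval is a strip, a countable union of bounded rectangles. *)
Lemma measurable_g_rect : @measurable _ (plane R) =
  <<s [set A : set (plane R) | exists a b c e, A = rect a b c e] >>.
Proof.
set G := [set A | _].
apply/seteqP; split; last first.
  apply: smallest_sub; first exact: sigma_algebra_measurable.
  by move=> A [a [b [c [e ->]]]]; exact: measurable_rect.
rewrite measurable_prod_measurableType; apply: smallest_sub.
  exact: smallest_sigma_algebra.
pose X := g_sigma_algebraType G.
have mfst : measurable_fun setT (fst : X -> line R).
  apply: (@measurability _ _ _ _ _ _ R.-ocitv.-measurable) => // A [_ [[y z] _ <-] <-].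
  rewrite setTI /=.
  have -> : fst @^-1` `]y, z]%classic = \bigcup_n rect y z (- n%:R) n%:R :> set X.
    apply/seteqP; split => [[u v]|[u v] [n _]]; rewrite /rect/= !in_itv/=; last by move=> [].
    move=> yu; have [N _ /(_ N (leqnn N))] := box_exhaust (u, v).
    rewrite /box /rect /= !in_itv/= => -[h1 h2].
    by exists N => //=; rewrite !in_itv/= yu h2.
  apply: bigcupT_measurable => n; apply: sub_sigma_algebra.
  by exists y, z, (- n%:R), n%:R.
have msnd : measurable_fun setT (snd : X -> line R).
  apply: (@measurability _ _ _ _ _ _ R.-ocitv.-measurable) => // A [_ [[y z] _ <-] <-].
  rewrite setTI /=.
  have -> : snd @^-1` `]y, z]%classic = \bigcup_n rect (- n%:R) n%:R y z :> set X.
    apply/seteqP; split => [[u v]|[u v] [n _]]; rewrite /rect/= !in_itv/=; last by move=> [].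
    move=> yu; have [N _ /(_ N (leqnn N))] := box_exhaust (u, v).
    rewrite /box /rect /= !in_itv/= => -[h1 h2].
    by exists N => //=; rewrite !in_itv/= yu h1.
  apply: bigcupT_measurable => n; apply: sub_sigma_algebra.
  by exists (- n%:R), n%:R, y, z.
move=> _ [A mA] [B mB] <-.
have -> : A `*` B = (setT `&` fst @^-1` A) `&` (setT `&` snd @^-1` B) :> set X.
  by apply/seteqP; split => [[u v]|[u v]] /=; [move=> []|move=> [[_ ?] [_ ?]]].
change (@measurable _ X ((setT `&` fst @^-1` A) `&` (setT `&` snd @^-1` B))).
by apply: measurableI; [exact: mfst|exact: msnd].
Qed.

Lemma indic_bigcup_cvg (F : (set (plane R))^nat) x : trivIset setT F ->
  (fun n => \1_(\big[setU/set0]_(i < n) F i) x : R) @ \oo --> (\1_(\bigcup_k F k) x : R).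
Proof.
move=> _; have [[k _ Fkx]|nF] := pselect ((\bigcup_k F k) x).
  apply: cvg_near_cst; exists k.+1 => // n /= kn.
  rewrite !indicE !mem_set//; first by exists k.
  by rewrite -bigcup_mkord; exists k.
apply: cvg_near_cst; apply: nearW => n; rewrite !indicE !memNset//.
by rewrite -bigcup_mkord => -[k _ Fk]; apply: nF; exists k.
Qed.

Lemma indicU_disj (T : Type) (A B C : set T) (x : T) : ~ (A x /\ B x) ->
  \1_(A `&` C) x + \1_(B `&` C) x = \1_((A `|` B) `&` C) x :> R.
Proof.
move=> h; rewrite !indicE !in_setI in_setU.
have : ~ (x \in A /\ x \in B) by rewrite !inE.
by move: (x \in A) (x \in B) (x \in C) => [] [] [] //= k; rewrite ?addr0 ?add0r//; case: k.
Qed.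

(** Dynkin's induction needs complements, whose measure may be infinite. Inside a fixed box they are
    differences of square integrable indicators, and disjoint unions converge under the domination
    of the box. *)
Lemma step_closure_indic_box n (A : set (plane R)) : measurable A ->
  step_closure (\1_(A `&` box n)).
Proof.
rewrite measurable_g_rect; move: A.
have mbox : measurable (box n) by exact: measurable_rect.
have Lbox : Lsq mu (\1_(box n)) by exact: Lsq_step (step_rect _ _ _ _).
apply: (dynkin_induction (P := fun A => step_closure (\1_(A `&` box n)))).
- exact: measurable_g_rect.
- move=> A B [a [b [c [e ->]]]] [a' [b' [c' [e' ->]]]].
  by rewrite rectI; do 4 eexists.
- by rewrite setTI; exact/step_closure_step/step_rect.
- move=> A [a [b [c [e ->]]]]; rewrite rectI.
  exact/step_closure_step/step_rect.
- move=> A mA cA.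
  have := step_closureD (step_closure_step (step_rect _ _ _ _ : step (\1_(box n))))
            (step_closureZ (-1) cA).
  congr step_closure; apply/funext => x; rewrite !indicE !in_setI in_setC.
  by case: (x \in A); case: (x \in box n); rewrite /=; ring.
- move=> F mF tF cF.
  pose G m := \big[setU/set0]_(i < m) F i.
  have mG m : measurable (G m) by exact: bigsetU_measurable.
  have cG m : step_closure (\1_(G m `&` box n)).
    elim: m => [|m IH]; rewrite /G.
      rewrite big_ord0 set0I; have := step_closure_step step0.
      by congr step_closure; apply/funext => x; rewrite indic0.
    have := step_closureD IH (cF m); congr step_closure; apply/funext => x.
    rewrite big_ord_recr -/(G m) -indicU_disj//.
    rewrite /G -bigcup_mkord => -[[k /= km Fk] Fm].
    have h : F k `&` F m !=set0 by exists x.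
    by have kE := tF k m I I h; rewrite kE ltnn in km.
  have mU : mfun2 R (\1_(\bigcup_k F k `&` box n) : plane R -> R).
    by apply/measurable_indic/measurableI => //; exact: bigcupT_measurable.
  apply: (step_closure_lim _ cG).
    apply: (Lsq_le _ Lbox); first exact: mU.
    move=> x; rewrite !indicE in_setI.
    by case: (x \in box n); rewrite ?andbF ?andbT ?normr0 ?normr1//; case: (x \in _); rewrite ?normr0 ?normr1.
  apply: (dominated_cvgL2 _ _ Lbox).
  + by move=> m; apply/measurable_indic/measurableI.
  + exact: mU.
  + move=> m x; rewrite !indicE in_setI.
    by case: (x \in box n); rewrite ?andbF ?andbT ?normr0 ?normr1//; case: (x \in _); rewrite ?normr0 ?normr1.
  + move=> x; rewrite !indicE in_setI.
    by case: (x \in box n); rewrite ?andbF ?andbT ?normr0 ?normr1//; case: (x \in _); rewrite ?normr0 ?normr1.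
  + apply: aeW => x.
    have -> : (fun m => \1_(G m `&` box n) x : R) = (fun m => \1_(G m) x * \1_(box n) x).
      by apply/funext => m; rewrite indicI.
    rewrite indicI; apply: cvgM; last exact: cvg_cst.
    exact: indic_bigcup_cvg.
Qed.

Lemma step_closure_sum (I : Type) (r : seq I) (F : I -> plane R -> R) :
  (forall i, step_closure (F i)) -> step_closure (fun x => \sum_(i <- r) F i x).
Proof.
move=> cF; elim: r => [|i r IH].
  have := step_closure_step step0; congr step_closure.
  by apply/funext => x; rewrite big_nil.
have := step_closureD (cF i) IH; congr step_closure.
by apply/funext => x; rewrite big_cons.
Qed.

Import HBNNSimple.

(** The simple functions increasing to [f], cut down to growing boxes, converge to [f] pointwise and
    are dominated by it. *)
Lemma step_closure_ge0 f : Lsq mu f -> (forall x, 0 <= f x) -> step_closure f.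
Proof.
move=> Lf f0.
have mf : mfun2 R (EFin \o f) by apply/measurable_EFinP; exact: Lsq_meas Lf.
have mbox n : measurable (box n) by exact: measurable_rect.
pose g n := nnsfun_approx measurableT mf n.
have gf n x : g n x <= f x.
  have := nd_nnsfun_approx measurableT mf.
  have := cvg_nnsfun_approx measurableT mf (fun x _ => f0 x : (0 <= (f x)%:E)%E) (I : setT x).
  move=> c nd.
  have ndx : nondecreasing_seq (EFin \o (fun n => g n x)).
    by move=> i j ij; rewrite lee_fin; exact: (lefP _ _ (nd _ _ ij)).
  rewrite -lee_fin (_ : (f x)%:E = limn (EFin \o (fun n => g n x))); last first.
    by apply/esym; exact: cvg_lim c.
  apply: lime_ge; first exact: ereal_nondecreasing_is_cvgn.
  by exists n => // m /= nm; exact: ndx.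
have gcv x : (fun n => g n x) @ \oo --> f x.
  have /fine_cvg := cvg_nnsfun_approx measurableT mf
    (fun x _ => f0 x : (0 <= (f x)%:E)%E) (I : setT x).
  exact.
have cg n : step_closure (g n \_ (box n)).
  have := step_closure_sum (finmap.enum_fset (fset_set (range (g n)))) (fun y => step_closureZ y
    (step_closure_indic_box n (measurable_sfunP (g n) (measurable_set1 y)))).
  congr step_closure; apply/funext => x; rewrite patchE.
  case: ifPn => xb; last first.
    by rewrite big1// => y _; rewrite indicI /= [X in _ * (_ * X)]indicE (negbTE xb) !mulr0.
  rewrite [RHS]fimfunE fsbig_finite//; apply: eq_bigr => y _.
  by rewrite indicI /= [X in _ * (_ * X)]indicE xb mulr1.
apply: (step_closure_lim Lf cg).
apply: (dominated_cvgL2 _ _ Lf).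
- by move=> n; apply/(measurable_restrictT _ _).1 => //; exact: measurable_funTS.
- exact: Lsq_meas Lf.
- move=> n x; rewrite patchE; case: ifP => _; last by rewrite normr0.
  by rewrite !ger0_norm.
- by [].
- apply: aeW => x; apply: cvg_trans (gcv x); apply: near_eq_cvg.
  near=> n; rewrite patchE mem_set//.
  near: n; exact: box_exhaust.
Unshelve. all: by end_near. Qed.

Lemma step_dense f : Lsq mu f -> step_closure f.
Proof.
move=> Lf.
have Lp : Lsq mu f^\+.
  by apply: (Lsq_le _ Lf); [apply: measurable_funrpos; exact: Lsq_meas Lf|
    move=> x; rewrite /funrpos ger0_norm ?le_max ?lexx ?orbT// ge_max ler_norm normr_ge0].
have Ln : Lsq mu f^\-.
  by apply: (Lsq_le _ Lf); [apply: measurable_funrneg; exact: Lsq_meas Lf|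
    move=> x; rewrite /funrneg ger0_norm ?le_max ?lexx ?orbT// ge_max -normrN ler_norm normr_ge0].
have := step_closureD (step_closure_ge0 Lp (@funrpos_ge0 _ _ f))
  (step_closureZ (-1) (step_closure_ge0 Ln (@funrneg_ge0 _ _ f))).
congr step_closure; apply/funext => x; rewrite [RHS](_ : f x = f^\+ x - f^\- x).
  by rewrite mulN1r.
by rewrite -[in LHS](funrposBneg f).
Qed.

End Density.

(** * Integrals in one variable *)

Section OneVariable.
Context (R : realType).
Implicit Types (f g F : R -> R) (x t c : R).

(** This rule and the ones after it are phrased for functions given pointwise, so that the
    derivative of an explicit primitive is assembled by plain application. *)
Lemma is_derive_add f g x df dg : is_derive x 1 f df -> is_derive x 1 g dg ->
  is_derive x 1 (fun t => f t + g t) (df + dg).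
Proof. exact: is_deriveD. Qed.

Lemma is_derive_opp f x df : is_derive x 1 f df -> is_derive x 1 (fun t => - f t) (- df).
Proof. exact: is_deriveN. Qed.

Lemma is_derive_mul f g x df dg : is_derive x 1 f df -> is_derive x 1 g dg ->
  is_derive x 1 (fun t => f t * g t) (f x * dg + g x * df).
Proof. exact: is_deriveM. Qed.

Lemma is_derive_const c x : is_derive x 1 (fun=> c) 0.
Proof. exact: is_derive_cst. Qed.

Lemma is_derive_var x : is_derive x 1 (fun t : R => t) 1.
Proof. exact: is_derive_id. Qed.

Lemma is_derive_exp f x df : is_derive x 1 f df ->
  is_derive x 1 (fun t => expR (f t)) (expR (f x) * df).
Proof. by move=> df_; apply: is_derive1_comp. Qed.

Lemma is_derive_cosc f x df : is_derive x 1 f df ->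
  is_derive x 1 (fun t => cos (f t)) (- sin (f x) * df).
Proof. by move=> df_; apply: is_derive1_comp. Qed.

Lemma is_derive_sinc f x df : is_derive x 1 f df ->
  is_derive x 1 (fun t => sin (f t)) (cos (f x) * df).
Proof. by move=> df_; apply: is_derive1_comp. Qed.

Lemma is_derive_atanc f x df : is_derive x 1 f df ->
  is_derive x 1 (fun t => atan (f t)) ((1 + f x ^+ 2)^-1 * df).
Proof. by move=> df_; apply: is_derive1_comp. Qed.

Lemma is_derive_continuous f x df : is_derive x 1 f df -> {for x, continuous f}.
Proof. by move=> [h _]; apply/differentiable_continuous/derivable1_diffP. Qed.

Lemma FTC_half_line f F (l : R) : (forall x, 0 <= x -> 0 <= f x) -> continuous f ->
  (forall x, is_derive x 1 F (f x)) -> F x @[x --> +oo] --> l ->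
  (\int[leb1 R]_(x in `[0%R, +oo[) (f x)%:E = (l - F 0)%:E)%E.
Proof.
move=> f0 cf dF Fl; rewrite (@ge0_continuous_FTC2y _ f F 0 l)//.
- exact: continuous_subspaceT.
- apply: cvg_at_right_filter; exact: is_derive_continuous (dF 0).
- by move=> x _; rewrite derive1E; case: (dF x).
Qed.

Lemma cvg_exp_decay t : 0 < t -> expR (- (t * x)) @[x --> +oo] --> (0 : R).
Proof.
move=> t0; apply: (@cvg_comp _ _ _ (fun x => t * x) (fun y => expR (- y))); last exact: cvgr_expR.
by apply: gt0_cvgMry => //; exact: cvg_id.
Qed.

Lemma decay_bounded f g (M : R) : (forall x, 0 <= x -> `|f x| <= M * g x) ->
  g x @[x --> +oo] --> (0 : R) -> f x @[x --> +oo] --> (0 : R).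
Proof.
move=> fg g0; apply: norm_cvg0.
have h : M * g x @[x --> +oo] --> (0 : R) by rewrite -(mulr0 M); apply: cvgMr.
apply: (squeeze_cvgr _ (cvg_cst 0) h).
near=> x; rewrite normr_ge0/=; apply: fg.
near: x; exact: nbhs_pinfty_ge.
Unshelve. all: by end_near. Qed.

Lemma laplace_id x : 0 < x ->
  (\int[leb1 R]_(t in `[0%R, +oo[) (t * expR (- (x * t)))%:E = (x ^- 2)%:E)%E.
Proof.
move=> x0.
have dE t : is_derive t 1 (fun t => expR (- (x * t))) (- x * expR (- (x * t))).
  apply: (is_derive_eq (is_derive_exp (is_derive_opp (is_derive_mul (is_derive_const x t) (is_derive_var t))))).
  by ring.
pose F t := - ((t * x^-1 + x ^- 2) * expR (- (x * t))).
have dF t : is_derive t 1 F (t * expR (- (x * t))).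
  apply: (is_derive_eq (is_derive_opp (is_derive_mul (is_derive_add (is_derive_mul (is_derive_var t) (is_derive_const (x^-1) t)) (is_derive_const (x^-2) t)) (dE t)))).
  by field; rewrite gt_eqF.
apply: (etrans (@FTC_half_line _ F 0 _ _ dF _)).
- by move=> t t0; rewrite mulr_ge0// expR_ge0.
- by move=> t; apply: is_derive_continuous.
- have hx : 0 < x / 2 by rewrite divr_gt0.
  (* Half of the exponential absorbs the linear factor: 1 + x t <= 2 exp (x t / 2). *)
  apply: (@decay_bounded _ (fun t => expR (- ((x / 2) * t))) (2 * x ^- 2)); last exact: cvg_exp_decay.
  move=> t t0; rewrite /F normrN ger0_norm; last first.
    by rewrite mulr_ge0 ?expR_ge0// addr_ge0// ?mulr_ge0// ?invr_ge0 ?exprn_ge0// ltW.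
  have -> : t * x^-1 + x ^- 2 = x ^- 2 * (1 + x * t).
    by field; rewrite gt_eqF.
  have -> : 2 * x ^- 2 * expR (- (x / 2 * t)) = x ^- 2 * (2 * expR (x / 2 * t)) * expR (- (x * t)).
    rewrite (_ : - (x / 2 * t) = x / 2 * t - x * t); last by field.
    by rewrite expRD; ring.
  rewrite ler_wpM2r ?expR_ge0// ler_wpM2l ?invr_ge0 ?exprn_ge0 ?ltW//.
  have := expR_ge1Dx (x / 2 * t); move: (expR _) => E hE.
  have h0 : 0 <= x * t by rewrite mulr_ge0// ltW.
  by rewrite (_ : x / 2 * t = x * t / 2) in hE; [lra|field].
- by rewrite /F mulr0 oppr0 expR0; congr EFin; ring.
Qed.

Lemma laplace_1cos c t : 0 < t ->
  (\int[leb1 R]_(x in `[0%R, +oo[) ((1 - cos (c * x)) * (t * expR (- (t * x))))%:E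
   = (c ^+ 2 / (t ^+ 2 + c ^+ 2))%:E)%E.
Proof.
move=> t0.
have q0 : 0 < t ^+ 2 + c ^+ 2 by rewrite ltr_pwDl ?exprn_gt0 ?sqr_ge0.
have dcx x : is_derive x 1 (fun x => c * x) (c * 1 + x * 0).
  exact: is_derive_mul (is_derive_const c x) (is_derive_var x).
have dE x : is_derive x 1 (fun x => expR (- (t * x))) (- t * expR (- (t * x))).
  apply: (is_derive_eq (is_derive_exp (is_derive_opp (is_derive_mul (is_derive_const t x) (is_derive_var x))))).
  by ring.
have d1c x := is_derive_add (is_derive_const 1 x) (is_derive_opp (is_derive_cosc (dcx x))).
pose k := t / (t ^+ 2 + c ^+ 2).
(* The primitive that vanishes at infinity: the 1 comes from t exp (- t x), the multiple of k from t
   exp (- t x) cos (c x). *)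
pose F x := - ((1 + k * (c * sin (c * x) + - (t * cos (c * x)))) * expR (- (t * x))).
have dF x := is_derive_opp (is_derive_mul (is_derive_add (is_derive_const 1 x)
   (is_derive_mul (is_derive_const k x) (is_derive_add (is_derive_mul (is_derive_const c x) (is_derive_sinc (dcx x)))
     (is_derive_opp (is_derive_mul (is_derive_const t x) (is_derive_cosc (dcx x))))))) (dE x)).
have dF' x : is_derive x 1 F ((1 - cos (c * x)) * (t * expR (- (t * x)))).
  apply: (is_derive_eq (dF x)).
  rewrite /k; move: (cos _) (sin _) (expR _) => C S E.
  by field; rewrite gt_eqF.
apply: (etrans (@FTC_half_line _ F 0 _ _ dF' _)).
- move=> x x0; rewrite !mulr_ge0 ?expR_ge0// ?subr_ge0 ?cos_le1// ltW//.
- by move=> x; apply: is_derive_continuous.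
- apply: (@decay_bounded _ (fun x => expR (- (t * x))) (1 + `|k| * (`|c| + t))); last exact: cvg_exp_decay.
  move=> x x0; rewrite /F normrN normrM (ger0_norm (expR_ge0 _)).
  rewrite ler_wpM2r ?expR_ge0// (le_trans (ler_normD _ _))// normr1 lerD2l normrM.
  rewrite ler_wpM2l// (le_trans (ler_normB _ _))// !normrM lerD//.
    by rewrite ler_piMr// ler_norml sin_geN1 sin_le1.
  by rewrite (gtr0_norm t0) ler_piMr//; [exact: ltW|rewrite ler_norml cos_geN1 cos_le1].
- rewrite /F !mulr0 sin0 cos0 oppr0 expR0 /k; congr EFin.
  by field; rewrite gt_eqF.
Qed.

Lemma integral_atan c : 0 < c ->
  (\int[leb1 R]_(t in `[0%R, +oo[) (c ^+ 2 / (t ^+ 2 + c ^+ 2))%:E = (c * (pi / 2))%:E)%E.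
Proof.
move=> c0.
have q0 t : 0 < t ^+ 2 + c ^+ 2 by rewrite ltr_pwDr ?exprn_gt0 ?sqr_ge0.
pose F t := c * atan (t * c^-1).
have dF t : is_derive t 1 F (c ^+ 2 / (t ^+ 2 + c ^+ 2)).
  apply: (is_derive_eq (is_derive_mul (is_derive_const c t) (is_derive_atanc (is_derive_mul (is_derive_var t) (is_derive_const (c^-1) t))))).
  have qt := q0 t.
  have h : 1 + (t * c^-1) ^+ 2 != 0 by rewrite gt_eqF// ltr_pwDl// sqr_ge0.
  by field; rewrite ?(gt_eqF c0) ?(gt_eqF qt) ?andbT/= 1?addrC ?(gt_eqF qt).
apply: (etrans (@FTC_half_line _ F (c * (pi / 2)) _ _ dF _)).
- by move=> t _; rewrite divr_ge0 ?sqr_ge0// ltW.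
- move=> t; apply: cvgM; first exact: cvg_cst.
  apply: cvgV; first by rewrite gt_eqF.
  apply: cvgD; last exact: cvg_cst.
  exact: exprn_continuous.
- apply: cvgMr; apply: (@cvg_comp _ _ _ (fun t => t * c^-1) atan); last exact: cvgy_atan.
  by apply: gt0_cvgMly; [rewrite invr_gt0|exact: cvg_id].
- by rewrite /F mul0r atan0 mulr0 subr0.
Qed.

(* The kernel whose integral, pi |c|, gives the L^2 products of transforms of indicators of
   intervals; it is evaluated by Tonelli's theorem from 1 / x^2 = \int_0^oo t exp(- t x) dt. *)
Definition cosk c x : R := (1 - cos (c * x)) / x ^+ 2.

Lemma cosk_ge0 c x : 0 <= cosk c x.
Proof. by rewrite divr_ge0 ?sqr_ge0// subr_ge0 cos_le1. Qed.

Lemma measurable_inv : measurable_fun [set: R] (@GRing.inv R).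
Proof.
have -> : [set: R] = [set 0] `|` ~` [set 0] by rewrite setUv.
apply/measurable_funU => //; first exact: measurableC.
split; first exact: measurable_fun_set1.
apply: open_continuous_measurable_fun.
  by apply: closed_openC; exact/accessible_closed_set1/hausdorff_accessible/Rhausdorff.
by move=> x; rewrite inE /= => /eqP x0; exact: inv_continuous.
Qed.

Lemma measurable_cosk c : measurable_fun [set: line R] (cosk c).
Proof.
apply: measurable_funM.
  apply: measurable_funB => //; apply: continuous_measurable_fun => x.
  apply: (is_derive_continuous (is_derive_cosc (is_derive_mul (is_derive_const c x) (is_derive_var x)))).
apply: measurableT_comp; last exact: measurable_funX.
exact: measurable_inv.
Qed.

Lemma integral_cosk c : (\int[leb1 R]_x (cosk c x)%:E = (pi * `|c|)%:E)%E.
Proof.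
wlog c0 : c / 0 < c => [hw|].
  have [/hw//|c0|c0] := ltgtP 0 c; last first.
    rewrite -c0 normr0 mulr0; under eq_integral do rewrite /cosk mul0r cos0 subrr mul0r.
    by rewrite integral0.
  rewrite -normrN -hw ?oppr_gt0//; apply: eq_integral => x _.
  by rewrite /cosk mulNr cosN.
(* The absolute value makes [f] even in its first variable, so the Laplace formulas on the half-line
   suffice for both integrations. *)
pose f (z : line R * line R) : R :=
  (1 - cos (c * z.1)) * (z.2 * expR (- (z.2 * `|z.1|))) * \1_`]0%R, +oo[ z.2.
have f0 z : 0 <= f z.
  rewrite /f indicE; case: (boolP (z.2 \in `]0%R, +oo[%classic)) => [|_]; last by rewrite mulr0.
  rewrite inE/= in_itv/= andbT => z0.
  by rewrite mulr1 !mulr_ge0 ?expR_ge0// ?subr_ge0 ?cos_le1// ltW.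
have mf : measurable_fun setT (EFin \o f).
  apply/measurable_EFinP; apply: measurable_funM; first apply: measurable_funM.
  - apply: measurable_funB => //; apply: (measurableT_comp (continuous_measurable_fun (@continuous_cos R))).
    by apply: measurable_funM => //; exact: measurable_fst.
  - apply: measurable_funM; first exact: measurable_snd.
    apply: (measurableT_comp (@measurable_expR R)); apply: measurable_funN.
    apply: measurable_funM; first exact: measurable_snd.
    by apply: measurableT_comp => //; exact: measurable_fst.
  - apply: measurableT_comp; last exact: measurable_snd.
    exact: measurable_indic.
have e1 (x : R) : (\int[leb1 R]_t (f (x, t))%:E = (cosk c x)%:E)%E.
  have [->|x0] := eqVneq x 0.
    rewrite /cosk /f /=; under eq_integral do rewrite mulr0 cos0 subrr !mul0r.
    by rewrite integral0 mulr0 cos0 subrr mul0r.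
  transitivity (\int[leb1 R]_(t in `]0%R, +oo[) ((1 - cos (c * x)) * (t * expR (- (`|x| * t))))%:E)%E.
    rewrite [RHS]integral_mkcond; apply: eq_integral => t _.
    rewrite patchE /f /= indicE [t * `|x|]mulrC.
    by case: ifPn; rewrite ?mulr1 ?mulr0.
  rewrite integral_itv_obnd_cbnd; last first.
    apply/measurable_EFinP/measurable_funTS; apply: measurable_funM => //; apply: measurable_funM => //.
    by apply: (measurableT_comp (@measurable_expR R)); apply: measurable_funN; apply: measurable_funM.
  under eq_integral do rewrite EFinM.
  rewrite ge0_integralZl//; last first.
  - move=> t /=; rewrite in_itv/= andbT => t0; by rewrite lee_fin mulr_ge0 ?expR_ge0.
  - apply/measurable_EFinP/measurable_funTS; apply: measurable_funM => //.
    by apply: (measurableT_comp (@measurable_expR R)); apply: measurable_funN; apply: measurable_funM.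
  rewrite laplace_id ?normr_gt0// -EFinM /cosk -normrX ger0_norm ?sqr_ge0//.
have e2 (t : R) : 0 < t -> (\int[leb1 R]_x (f (x, t))%:E = (2 * (c ^+ 2 / (t ^+ 2 + c ^+ 2)))%:E)%E.
  move=> t0.
  transitivity (\int[leb1 R]_x ((1 - cos (c * x)) * (t * expR (- (t * `|x|))))%:E)%E.
    by apply: eq_integral => x _; rewrite /f /= indicE mem_set ?mulr1//= in_itv/= t0.
  rewrite ge0_symfun_integralT.
  - rewrite EFinM -(laplace_1cos c t0); congr (_ * _)%E.
    by rewrite set_itvcy; apply: eq_integral => x; rewrite inE/= => x0; rewrite ger0_norm.
  - by move=> x; rewrite !mulr_ge0 ?expR_ge0// ?subr_ge0 ?cos_le1// ltW.
  - move=> x; apply: cvgM; first apply: cvgB; first exact: cvg_cst.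
    + exact: (is_derive_continuous (is_derive_cosc (is_derive_mul (is_derive_const c x) (is_derive_var x)))).
    + apply: cvgM; first exact: cvg_cst.
      apply: (@cvg_comp _ _ _ (fun x : R => - (t * `|x|)) expR); last exact: continuous_expR.
      by apply: cvgN; apply: cvgM; [exact: cvg_cst|exact: norm_continuous].
  - by move=> x /=; rewrite mulrN cosN normrN.
transitivity (\int[leb1 R]_x \int[leb1 R]_t (f (x, t))%:E)%E.
  by apply: eq_integral => x _; rewrite e1.
rewrite (@fubini_tonelli _ _ _ _ _ (leb1 R) (leb1 R) (EFin \o f))//.
transitivity (\int[leb1 R]_(t in `]0%R, +oo[) (2 * (c ^+ 2 / (t ^+ 2 + c ^+ 2)))%:E)%E.
  rewrite [RHS]integral_mkcond; apply: eq_integral => t _; rewrite patchE.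
  case: ifPn => [|tn]; first by rewrite inE/= in_itv/= andbT => t0; rewrite -e2.
  rewrite /f /=; under eq_integral do rewrite indicE (negbTE tn) mulr0.
  by rewrite integral0.
have mq : measurable_fun [set: line R] (fun t : R => c ^+ 2 / (t ^+ 2 + c ^+ 2)).
  apply: measurable_funM => //; apply: measurableT_comp; first exact: measurable_inv.
  by apply: measurable_funD => //; exact: measurable_funX.
rewrite integral_itv_obnd_cbnd; last first.
  by apply/measurable_EFinP/measurable_funTS; apply: measurable_funM.
under eq_integral do rewrite EFinM.
rewrite ge0_integralZl//; last first.
- by move=> t _; rewrite lee_fin divr_ge0 ?sqr_ge0// addr_ge0 ?sqr_ge0.
- exact/measurable_EFinP/measurable_funTS.
by rewrite integral_atan// -EFinM gtr0_norm//; congr EFin; field.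
Qed.

End OneVariable.

(** * Products of functions of separate variables *)

Section Tensor.
Context d1 d2 (T1 : measurableType d1) (T2 : measurableType d2) (R : realType).
Context (m1 : {sigma_finite_measure set T1 -> \bar R})
  (m2 : {sigma_finite_measure set T2 -> \bar R}).
Implicit Types (u : T1 -> R) (v : T2 -> R).

Definition tensor u v (x : T1 * T2) : R := u x.1 * v x.2.

Lemma measurable_tensor u v : measurable_fun setT u -> measurable_fun setT v ->
  measurable_fun setT (tensor u v).
Proof.
move=> mu mv; apply: measurable_funM.
- exact: measurableT_comp mu measurable_fst.
- exact: measurableT_comp mv measurable_snd.
Qed.

Lemma integrable_tensor u v : m1.-integrable setT (EFin \o u) ->
  m2.-integrable setT (EFin \o v) -> (m1 \x m2)%E.-integrable setT (EFin \o tensor u v).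
Proof.
move=> /integrableP[/measurable_EFinP mu iu] /integrableP[/measurable_EFinP mv iv].
have mt := measurable_tensor mu mv.
apply/integrable12ltyP; first exact/measurable_EFinP.
have -> : (\int[m1]_x \int[m2]_y `|(EFin \o tensor u v) (x, y)| =
  (\int[m1]_x `|(u x)%:E|) * (\int[m2]_y `|(v y)%:E|))%E.
  rewrite muleC -ge0_integralZl//.
  - apply: eq_integral => x _; rewrite muleC -ge0_integralZl//.
    + by apply: eq_integral => y _ /=; rewrite /tensor/= normrM EFinM.
    + by apply: measurableT_comp => //; exact/measurable_EFinP.
  - by apply: measurableT_comp => //; exact/measurable_EFinP.
  - exact: integral_ge0.
by rewrite lte_mul_pinfty// ?integral_ge0// ge0_fin_numE// integral_ge0.
Qed.

Lemma Rintegral_tensor u v : m1.-integrable setT (EFin \o u) ->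
  m2.-integrable setT (EFin \o v) ->
  \int[(m1 \x m2)%E]_x tensor u v x = (\int[m1]_x u x) * (\int[m2]_x v x).
Proof.
move=> iu iv; have it := integrable_tensor iu iv.
have fv : (\int[m2]_x (v x)%:E)%E \is a fin_num by exact: integrable_fin_num.
have fu : (\int[m1]_x (u x)%:E)%E \is a fin_num by exact: integrable_fin_num.
rewrite /Rintegral -fineM//; congr fine.
rewrite -(integral12_prod_meas1 it) /fubini_F muleC -(fineK fv) -integralZl//.
apply: eq_integral => x _ /=; rewrite /tensor /=.
under eq_integral do rewrite EFinM.
by rewrite integralZl// muleC -(fineK fv).
Qed.

Lemma Lsq_tensor u v : Lsq m1 u -> Lsq m2 v -> Lsq (m1 \x m2)%E (tensor u v).
Proof.
move=> Lu Lv; apply: integrable_Lsq.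
  exact: measurable_tensor (Lsq_meas Lu) (Lsq_meas Lv).
have := integrable_tensor (Lsq_mul Lu Lu) (Lsq_mul Lv Lv).
apply: eq_integrable => // x _; rewrite /tensor /=; congr EFin; ring.
Qed.

Lemma ip_tensor u u' v v' : Lsq m1 u -> Lsq m1 u' -> Lsq m2 v -> Lsq m2 v' ->
  ip (m1 \x m2)%E (tensor u v) (tensor u' v') = ip m1 u u' * ip m2 v v'.
Proof.
move=> Lu Lu' Lv Lv'; rewrite /ip -(Rintegral_tensor (Lsq_mul Lu Lu') (Lsq_mul Lv Lv')).
by apply: eq_Rintegral => x _; rewrite /tensor; ring.
Qed.

End Tensor.

(** * Cosine and sine transforms of intervals *)

Section IntervalTransform.
Context (R : realType).
Implicit Types (a b c x y t : R).
Notation mu1 := (leb1 R).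

(* The integrals of cos (t x) and sin (t x) over x in [a, b]; both are 0 at t = 0 by the
   convention 1 / 0 = 0, which affects only a null set. *)
Definition cosI a b t : R := (sin (b * t) - sin (a * t)) / t.
Definition sinI a b t : R := (cos (a * t) - cos (b * t)) / t.

(** The left side is the real part of one exponential transform times the conjugate of the other,
    four cosines over t^2 with signs adding up to 0. The constants 1 can therefore be inserted, and
    each cosine becomes an integrable kernel [cosk]. *)
Lemma cosI_sinI a b a' b' t : cosI a b t * cosI a' b' t + sinI a b t * sinI a' b' t =
  - cosk (b - b') t + cosk (b - a') t + cosk (a - b') t - cosk (a - a') t.
Proof.
rewrite /cosI /sinI /cosk !mulrBl !cosB.
have [->|t0] := eqVneq t 0; first by rewrite expr0n/= invr0; ring.
by field.
Qed.

Lemma integrable_cosk c : mu1.-integrable setT (EFin \o cosk c).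
Proof.
apply/integrableP; split; first by apply/measurable_EFinP; exact: measurable_cosk.
under eq_integral => x _ do rewrite /= ger0_norm ?cosk_ge0//.
by rewrite integral_cosk ltry.
Qed.

Lemma measurable_cosI a b : measurable_fun [set: line R] (cosI a b).
Proof.
apply: measurable_funM; last exact: measurable_inv.
apply: measurable_funB; apply: (measurableT_comp (continuous_measurable_fun (@continuous_sin R)));
  exact: measurable_funM.
Qed.

Lemma measurable_sinI a b : measurable_fun [set: line R] (sinI a b).
Proof.
apply: measurable_funM; last exact: measurable_inv.
apply: measurable_funB; apply: (measurableT_comp (continuous_measurable_fun (@continuous_cos R)));
  exact: measurable_funM.
Qed.

Lemma Lsq_cosk_le (u : R -> R) c : measurable_fun [set: line R] u ->
  (forall t, u t * u t <= 2 * cosk c t) -> Lsq mu1 u.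
Proof.
move=> mu uc; apply: integrable_Lsq => //.
apply: (le_integrable _ _ _ (integrableZl measurableT 2 (integrable_cosk c))) => //.
  by apply/measurable_EFinP; exact: measurable_funM.
move=> t _ /=; rewrite lee_fin -expr2 ger0_norm ?sqr_ge0// expr2.
by apply: le_trans (uc t) _; exact: ler_norm.
Qed.

Lemma cosI_sinI_sq a b t : cosI a b t * cosI a b t + sinI a b t * sinI a b t = 2 * cosk (b - a) t.
Proof.
rewrite cosI_sinI !subrr /cosk -(opprB b a) mulNr cosN mul0r cos0 subrr mul0r; ring.
Qed.

Lemma Lsq_cosI a b : Lsq mu1 (cosI a b).
Proof.
apply: (@Lsq_cosk_le _ (b - a)); first exact: measurable_cosI.
by move=> t; rewrite -cosI_sinI_sq lerDl -expr2 sqr_ge0.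
Qed.

Lemma Lsq_sinI a b : Lsq mu1 (sinI a b).
Proof.
apply: (@Lsq_cosk_le _ (b - a)); first exact: measurable_sinI.
by move=> t; rewrite -cosI_sinI_sq lerDr -expr2 sqr_ge0.
Qed.

Lemma Rintegral_cosk c : \int[mu1]_x cosk c x = pi * `|c|.
Proof. by rewrite /Rintegral integral_cosk. Qed.

(** The four values pi |c| produced by [integral_cosk] combine into this second difference of the
    absolute value. Recognising the length of the intersection in it gives the scalar product of the
    two indicators. *)
Lemma overlap_length a b a' b' : a <= b -> a' <= b' ->
  `|b - a'| + `|a - b'| - `|b - b'| - `|a - a'| =
  2 * Num.max 0 (Num.min b b' - Num.max a a').
Proof.
move=> ab ab'; have [h|h] := leP b a'.
  rewrite (max_idPl _); last by rewrite subr_le0 ge_min !le_max h !orbT.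
  rewrite !ler0_norm ?subr_le0 ?(le_trans ab)// ?(le_trans h)//; lra.
have [h'|h'] := leP b' a.
  rewrite (max_idPl _); last by rewrite subr_le0 ge_min !le_max h' !orbT.
  rewrite (ger0_norm (_ : 0 <= b - a')) ?subr_ge0 ?ltW//.
  rewrite (ger0_norm (_ : 0 <= a - b')) ?subr_ge0// (ger0_norm (_ : 0 <= b - b')) ?subr_ge0 ?(le_trans h')//.
  rewrite (ger0_norm (_ : 0 <= a - a')) ?subr_ge0 ?(le_trans ab')//; lra.
rewrite (max_idPr _); last by rewrite subr_ge0 le_min !ge_max ab ab' (ltW h) (ltW h').
rewrite (gtr0_norm (_ : 0 < b - a')) ?subr_gt0// (ltr0_norm (_ : a - b' < 0)) ?subr_lt0//.
by case: (leP b b') => hb; case: (leP a a') => hc; case: (ger0P (b - b')) => h1;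
  case: (ger0P (a - a')) => h2; lra.
Qed.

Lemma ip_cosI_sinI a b a' b' : a <= b -> a' <= b' ->
  ip mu1 (cosI a b) (cosI a' b') + ip mu1 (sinI a b) (sinI a' b') =
  2 * pi * Num.max 0 (Num.min b b' - Num.max a a').
Proof.
move=> ab ab'.
rewrite /ip -RintegralD//; last 2 first.
- exact: Lsq_mul (Lsq_cosI _ _) (Lsq_cosI _ _).
- exact: Lsq_mul (Lsq_sinI _ _) (Lsq_sinI _ _).
transitivity (\int[mu1]_x ((-1 * cosk (b - b') x + cosk (b - a') x) + (cosk (a - b') x + -1 * cosk (a - a') x))).
  by apply: eq_Rintegral => x _; rewrite cosI_sinI; ring.
have ik := integrable_cosk.
have iN c : mu1.-integrable setT (EFin \o (fun x => -1 * cosk c x)).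
  exact: (integrableZl measurableT (-1) (ik c)).
rewrite RintegralD//; last 2 first.
- exact: (integrableD measurableT (iN _) (ik _)).
- exact: (integrableD measurableT (ik _) (iN _)).
rewrite (RintegralD measurableT (iN _) (ik _)) (RintegralD measurableT (ik _) (iN _)).
rewrite !(RintegralZl _ measurableT (ik _)) !Rintegral_cosk.
have -> : forall p q r s : R, -1 * (pi * p) + pi * q + (pi * r + -1 * (pi * s)) = pi * (q + r - p - s).
  by move=> p q r s; ring.
rewrite -[2 * pi]mulrC -mulrA; congr (_ * _).
exact: overlap_length.
Qed.

Lemma Rintegral_reflect1 (f : R -> R) : measurable_fun [set: line R] f ->
  \int[mu1]_x f (- x) = \int[mu1]_x f x.
Proof.
move=> mf; have mfE : measurable_fun [set: line R] (EFin \o f) by exact/measurable_EFinP.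
have key (g : R -> \bar R) : measurable_fun [set: line R] g -> (forall x, 0 <= g x)%E ->
    (\int[mu1]_x g (- x)%R = \int[mu1]_x g x)%E.
  move=> mg g0.
  have := ge0_integral_pushforward (measurable_reflect1 0) mu1 measurableT mg (fun x _ => g0 x).
  rewrite preimage_setT /= => h.
  transitivity (\int[mu1]_x (g \o (fun x : R => (0 - x)%R)) x)%E.
    by apply: eq_integral => x _ /=; rewrite sub0r.
  rewrite -h; apply: eq_measure_integral => [|mp A mA _]; first exact: measurable_reflect1.
  exact: (lebesgue_reflect1 0 mA).
rewrite /Rintegral integralE [in RHS]integralE; congr (fine (_ - _)%E).
- rewrite -(key (EFin \o f)^\+%E)//; last exact: measurable_funepos.
  by apply: eq_integral => x _; rewrite !funeposE.
- rewrite -(key (EFin \o f)^\-%E)//; last exact: measurable_funeneg.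
  by apply: eq_integral => x _; rewrite !funenegE.
Qed.

(** [cosI] is even and [sinI] is odd, so the integral equals its own opposite. *)
Lemma ip_cosI_sinI0 a b a' b' : ip mu1 (cosI a b) (sinI a' b') = 0.
Proof.
have mf : measurable_fun [set: line R] (fun x => cosI a b x * sinI a' b' x).
  by apply: measurable_funM; [exact: measurable_cosI|exact: measurable_sinI].
have h := Rintegral_reflect1 mf.
have e : \int[mu1]_x (cosI a b (- x) * sinI a' b' (- x)) = - ip mu1 (cosI a b) (sinI a' b').
  rewrite -mulN1r -RintegralZl//; last exact: Lsq_mul (Lsq_cosI _ _) (Lsq_sinI _ _).
  apply: eq_Rintegral => x _; rewrite /cosI /sinI !mulrN !sinN !cosN invrN; ring.
move: h; rewrite e -/(ip _ _ _); move: (ip _ _ _) => z; lra.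
Qed.

Lemma integral_indic_itv a b (f F : R -> R) : a <= b -> continuous f ->
  (forall x, is_derive x 1 F (f x)) ->
  \int[mu1]_x (\1_`]a, b] x * f x) = F b - F a.
Proof.
rewrite le_eqVlt => /predU1P[<-|ab] cf dF.
  rewrite subrr set_itvoc0; under eq_Rintegral do rewrite indic0 mul0r.
  by rewrite Rintegral_cst// mul0r.
transitivity (\int[mu1]_(x in `]a, b]) f x).
  rewrite [RHS]Rintegral_mkcond; apply: eq_Rintegral => x _.
  by rewrite patchE indicE; case: ifP; rewrite ?mul1r ?mul0r.
have mf : measurable_fun [set: line R] f by exact: continuous_measurable_fun.
rewrite /Rintegral integral_itv_obnd_cbnd; last exact/measurable_EFinP/measurable_funTS.
rewrite (@continuous_FTC2 _ f F a b ab)//.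
- exact: continuous_subspaceT.
- split.
  + by move=> x _; case: (dF x).
  + apply: cvg_at_right_filter; exact: is_derive_continuous (dF a).
  + apply: cvg_at_left_filter; exact: is_derive_continuous (dF b).
- by move=> x _; rewrite derive1E; case: (dF x).
Qed.

Lemma integral_cos_itv a b t : a <= b -> t != 0 ->
  \int[mu1]_x (\1_`]a, b] x * cos (x * t)) = cosI a b t.
Proof.
move=> ab t0.
have dF x : is_derive x 1 (fun x => sin (x * t) * t^-1) (cos (x * t)).
  by apply: (is_derive_eq (is_derive_mul (is_derive_sinc (is_derive_mul (is_derive_var x) (is_derive_const t x))) (is_derive_const t^-1 x))); field.
apply: (etrans (@integral_indic_itv a b _ _ ab _ dF)); last by rewrite /cosI mulrBl.
move=> x; exact: (is_derive_continuous (is_derive_cosc (is_derive_mul (is_derive_var x) (is_derive_const t x)))).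
Qed.

Lemma integral_sin_itv a b t : a <= b -> t != 0 ->
  \int[mu1]_x (\1_`]a, b] x * sin (x * t)) = sinI a b t.
Proof.
move=> ab t0.
have dF x : is_derive x 1 (fun x => - (cos (x * t) * t^-1)) (sin (x * t)).
  by apply: (is_derive_eq (is_derive_opp (is_derive_mul (is_derive_cosc (is_derive_mul (is_derive_var x) (is_derive_const t x))) (is_derive_const t^-1 x)))); field.
apply: (etrans (@integral_indic_itv a b _ _ ab _ dF)); last by rewrite /sinI; ring.
move=> x; exact: (is_derive_continuous (is_derive_sinc (is_derive_mul (is_derive_var x) (is_derive_const t x)))).
Qed.

Lemma Lsq_indic_itv a b : Lsq mu1 (\1_`]a, b]).
Proof.
split; first exact: measurable_indic.
rewrite /sqint; under eq_integral => x _.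
  have -> : (\1_`]a, b] x : R) ^+ 2 = \1_`]a, b] x by rewrite indicE expr2 -natrM mulnb andbb.
  over.
rewrite integral_indic// setIT [X in (X < _)%E]lebesgue_measure_itv/=.
by case: ifP => // _; rewrite -EFinB ltry.
Qed.

Lemma ip_indic_itv a b a' b' :
  ip mu1 (\1_`]a, b]) (\1_`]a', b']) = Num.max 0 (Num.min b b' - Num.max a a').
Proof.
transitivity (\int[mu1]_x (\1_`]Num.max a a', Num.min b b'] x)).
  apply: eq_Rintegral => x _; rewrite !indicE -natrM mulnb; congr ((nat_of_bool _)%:R).
  by rewrite !mem_setE !in_itv/= gt_max le_min; case: (a < x); case: (a' < x); rewrite ?andbF.
rewrite /Rintegral integral_indic// setIT [X in fine X]lebesgue_measure_itv/= lte_fin.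
case: ltP => h /=; last by rewrite max_l// subr_le0.
have h2 : 0 <= Num.min b b' - Num.max a a' by rewrite subr_ge0 ltW.
by rewrite [RHS](max_r h2).
Qed.

End IntervalTransform.

(** * Plancherel's theorem *)

Section ParametricIntegral.
Context d1 d2 (T1 : measurableType d1) (T2 : measurableType d2) (R : realType).
Context (m2 : {sigma_finite_measure set T2 -> \bar R}).

(** Treating the positive and negative parts separately covers sections whose integral is infinite
    or undefined; the real integral is [fine] of the difference. *)
Lemma measurable_Rintegral_param (f : T1 * T2 -> R) : measurable_fun setT f ->
  measurable_fun setT (fun x => \int[m2]_y f (x, y)).
Proof.
move=> mf; have mfE : measurable_fun setT (EFin \o f) by exact/measurable_EFinP.
rewrite /Rintegral; apply: (measurableT_comp (@fine_measurable R _ measurableT)) => //=.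
have -> : (fun x => \int[m2]_y (f (x, y))%:E)%E = (fun x => \int[m2]_y (EFin \o f)^\+ (x, y) - \int[m2]_y (EFin \o f)^\- (x, y))%E.
  apply/funext => x; rewrite integralE; congr (_ - _)%E.
  - by apply: eq_integral => y _; rewrite !funeposE.
  - by apply: eq_integral => y _; rewrite !funenegE.
apply: emeasurable_funB.
- apply: (measurable_fun_fubini_tonelli_F (m2 := m2) (EFin \o f)^\+%E) => //.
  exact: measurable_funepos.
- apply: (measurable_fun_fubini_tonelli_F (m2 := m2) (EFin \o f)^\-%E) => //.
  exact: measurable_funeneg.
Qed.

End ParametricIntegral.

Section PlaneMeasure.
Context (R : realType).

Lemma sigma_finite_leb2 : sigma_finite setT (leb2 R).
Proof.
exists (fun n => @box R n).
  apply/esym/seteqP; split => // x _; have [N _ /(_ N (leqnn N))] := box_exhaust x.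
  by exists N.
by move=> n; split; [exact: measurable_rect|exact: lebesgue_rect].
Qed.

(** Packages the planar measure so that it can itself be a factor in Tonelli's and Fubini's
    theorems. *)
Definition leb2_sigma_finite : {sigma_finite_measure set (plane R) -> \bar R} :=
  HB.pack (leb2 R) (@Measure_isSigmaFinite.Build _ (plane R) R (leb2 R) sigma_finite_leb2).

End PlaneMeasure.

(** * The Hartley transform of step functions and of functions with bounded support *)

Section Hartley.
Context (R : realType).
Notation mu := (leb2 R).
Implicit Types (f g : R * R -> R) (x xi : R * R).

Definition cas (t : R) : R := cos t + sin t.

Lemma cas_le2 t : `|cas t| <= 2.
Proof.
rewrite (le_trans (ler_normD _ _))// (_ : 2 = 1 + 1); last by ring.
by rewrite lerD// ler_norml ?cos_geN1 ?cos_le1 ?sin_geN1 ?sin_le1.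
Qed.

Lemma measurable_cas : measurable_fun [set: R] cas.
Proof.
by apply: measurable_funD; apply: continuous_measurable_fun;
  [exact: continuous_cos|exact: continuous_sin].
Qed.

Lemma measurable_dot2 : measurable_fun [set: plane R * plane R] (fun z : plane R * plane R => dot2 z.1 z.2 : R).
Proof.
have m1 := @measurable_fst _ _ (plane R) (plane R).
have m2 := @measurable_snd _ _ (plane R) (plane R).
apply: measurable_funD; apply: measurable_funM.
- exact: (measurableT_comp (@measurable_fst _ _ (line R) (line R)) m1).
- exact: (measurableT_comp (@measurable_fst _ _ (line R) (line R)) m2).
- exact: (measurableT_comp (@measurable_snd _ _ (line R) (line R)) m1).
- exact: (measurableT_comp (@measurable_snd _ _ (line R) (line R)) m2).
Qed.

Lemma measurable_dot2l xi : mfun2 R (fun x => dot2 x xi).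
Proof.
by apply: measurable_funD; apply: measurable_funM.
Qed.

Lemma dot2C x xi : dot2 x xi = dot2 xi x.
Proof. by rewrite /dot2 mulrC [x.2 * _]mulrC. Qed.

(* For a real function the Hartley transform carries the same information as the Fourier
   transform and is real, symmetric and an involution up to the factor (2 pi)^2, so that
   Plancherel's theorem and surjectivity follow from its isometry property alone.
   Locked so that comparing two transforms never unfolds the integrals. *)
Definition hart1 : (R * R -> R) -> R * R -> R :=
  locked (fun f xi => \int[mu]_x (f x * cas (dot2 x xi))).

Lemma hart1E f : hart1 f = fun xi => \int[mu]_x (f x * cas (dot2 x xi)).
Proof. by rewrite /hart1 -lock. Qed.

Lemma measurable_hart1 f : mfun2 R f -> mfun2 R (hart1 f).
Proof.
move=> mf.
have mF : measurable_fun [set: plane R * plane R]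
    (fun z : plane R * plane R => f z.2 * cas (dot2 z.2 z.1)).
  apply: measurable_funM; first exact: measurableT_comp mf measurable_snd.
  apply: measurableT_comp; first exact: measurable_cas.
  have -> : (fun z : plane R * plane R => dot2 z.2 z.1) = (fun z => dot2 z.1 z.2).
    by apply/funext => z; rewrite dot2C.
  exact: measurable_dot2.
rewrite hart1E; exact: (measurable_Rintegral_param (leb2_sigma_finite R) mF).
Qed.

Lemma integrable_mul_bounded f (g : R * R -> R) (M : R) : mfun2 R g ->
  (forall x, `|g x| <= M) -> mu.-integrable setT (EFin \o f) ->
  mu.-integrable setT (fun x => (f x * g x)%:E).
Proof.
move=> mg gM fi; have /integrableP[mf _] := fi.
apply: (le_integrable measurableT _ _ (integrableZl measurableT M (integrable_abse fi))).
  by apply/measurable_EFinP; apply: measurable_funM => //; exact/measurable_EFinP.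
move=> x _ /=; rewrite lee_fin normrM mulrC.
have M0 : 0 <= M := le_trans (normr_ge0 _) (gM x).
by rewrite (ger0_norm (mulr_ge0 M0 (normr_ge0 _))) ler_wpM2r.
Qed.

Lemma integrable_cas f xi : mu.-integrable setT (EFin \o f) ->
  mu.-integrable setT (fun x => (f x * cas (dot2 x xi))%:E).
Proof.
apply: (integrable_mul_bounded (M := 2)); last by move=> x; exact: cas_le2.
exact: (measurableT_comp measurable_cas (measurable_dot2l xi)).
Qed.

Lemma hart1D f g : mu.-integrable setT (EFin \o f) -> mu.-integrable setT (EFin \o g) ->
  hart1 (fun x => f x + g x) = (fun xi => hart1 f xi + hart1 g xi).
Proof.
move=> fi gi; apply/funext => xi; rewrite !hart1E -RintegralD//; try exact: integrable_cas.
by apply: eq_Rintegral => x _; rewrite mulrDl.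
Qed.

Lemma hart1Z k f : mu.-integrable setT (EFin \o f) ->
  hart1 (fun x => k * f x) = (fun xi => k * hart1 f xi).
Proof.
move=> fi; apply/funext => xi; rewrite !hart1E -RintegralZl//; last exact: integrable_cas.
by apply: eq_Rintegral => x _; rewrite mulrA.
Qed.

Lemma hart1B f g : mu.-integrable setT (EFin \o f) -> mu.-integrable setT (EFin \o g) ->
  hart1 (fun x => f x - g x) = (fun xi => hart1 f xi - hart1 g xi).
Proof.
move=> fi gi; apply/funext => xi; rewrite !hart1E -RintegralB//; try exact: integrable_cas.
by apply: eq_Rintegral => x _; rewrite mulrBl.
Qed.

Lemma hart1_bound f xi : mu.-integrable setT (EFin \o f) ->
  `|hart1 f xi| <= 2 * \int[mu]_x `|f x|.
Proof.
move=> fi; have fci := integrable_cas xi fi.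
rewrite hart1E; apply: (le_trans (le_normr_Rintegral measurableT fci)).
rewrite -RintegralZl//; last exact: integrable_norm.
apply: le_Rintegral => //.
- exact: integrable_norm.
- exact: (integrableZl measurableT 2 (integrable_norm fi)).
- by move=> x _; rewrite normrM mulrC ler_wpM2r// cas_le2.
Qed.

(** The closed form of the transform of a rectangle, from cas (u + v) = cos u (cos v + sin v) + sin
    u (cos v - sin v). *)
Definition hrect (a b c e : R) xi : R :=
  tensor (cosI a b) (fun t => cosI c e t + sinI c e t) xi +
  tensor (sinI a b) (fun t => cosI c e t - sinI c e t) xi.

Lemma Lsq_hrect a b c e : Lsq mu (hrect a b c e).
Proof.
apply: LsqD; apply: Lsq_tensor; [exact: Lsq_cosI| |exact: Lsq_sinI|].
- by apply: LsqD; [exact: Lsq_cosI|exact: Lsq_sinI].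
- by apply: LsqB; [exact: Lsq_cosI|exact: Lsq_sinI].
Qed.

Lemma indic_rectE a b c e : \1_(rect a b c e) = tensor \1_`]a, b] \1_`]c, e] :> (R * R -> R).
Proof.
apply/funext => -[u v]; rewrite /tensor /rect !indicE -natrM mulnb; congr ((nat_of_bool _)%:R).
by apply/idP/andP; rewrite !in_setE /=; [move=> []|move=> [? ?]; split].
Qed.

Lemma rect_wlog (a b c e : R) : rect a b c e = rect a (Num.max a b) c (Num.max c e).
Proof.
have h (p q : R) : `]p, q]%classic = `]p, Num.max p q]%classic.
  by apply/seteqP; split => t /=; rewrite !in_itv/= le_max; case: ltP => //= _ /orP[].
by rewrite /rect -!h.
Qed.

Definition c2pi : R := (2 * pi) ^+ 2.

Lemma c2pi_gt0 : 0 < c2pi.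
Proof. by rewrite exprn_gt0// mulr_gt0// pi_gt0. Qed.

(** Parity kills the cross terms. The two remaining terms have the same factor in the second
    variable, so the cosine and sine products in the first add up to an overlap length as well. *)
Lemma ip_hrect a b c e a' b' c' e' : a <= b -> c <= e -> a' <= b' -> c' <= e' ->
  ip mu (hrect a b c e) (hrect a' b' c' e') =
  c2pi * ip mu \1_(rect a b c e) \1_(rect a' b' c' e').
Proof.
move=> ab ce ab' ce'.
have LC p q := @Lsq_cosI R p q; have LS p q := @Lsq_sinI R p q.
have LK p q := LsqD (LC p q) (LS p q); have LK' p q := LsqB (LC p q) (LS p q).
have SC p q p' q' : ip (leb1 R) (sinI p q) (cosI p' q') = 0 by rewrite ipC ip_cosI_sinI0.
have iK : ip (leb1 R) (fun t => cosI c e t + sinI c e t) (fun t => cosI c' e' t + sinI c' e' t)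
   = 2 * pi * Num.max 0 (Num.min e e' - Num.max c c').
  rewrite ipDl// !ipDr// ip_cosI_sinI0 SC addr0 add0r; exact: ip_cosI_sinI.
have iK' : ip (leb1 R) (fun t => cosI c e t - sinI c e t) (fun t => cosI c' e' t - sinI c' e' t)
   = 2 * pi * Num.max 0 (Num.min e e' - Num.max c c').
  by rewrite ipBl// !ipBr// ip_cosI_sinI0 SC subr0 sub0r opprK; exact: ip_cosI_sinI.
have LT1 p q r s := Lsq_tensor (LC p q) (LK r s).
have LT2 p q r s := Lsq_tensor (LS p q) (LK' r s).
rewrite /hrect (ipDl (LT1 _ _ _ _) (LT2 _ _ _ _) (LsqD (LT1 _ _ _ _) (LT2 _ _ _ _))).
rewrite (ipDr (LT1 _ _ _ _) (LT2 _ _ _ _) (LT1 _ _ _ _)) (ipDr (LT1 _ _ _ _) (LT2 _ _ _ _) (LT2 _ _ _ _)).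
rewrite !ip_tensor// ip_cosI_sinI0 SC !mul0r addr0 add0r iK iK'.
rewrite !indic_rectE ip_tensor; try exact: Lsq_indic_itv.
rewrite !ip_indic_itv -mulrDl ip_cosI_sinI// /c2pi; ring.
Qed.

(** The closed forms divide by the coordinates of [xi], so they represent the integrals only off the
    axes, a null set. *)
Lemma hart1_rect a b c e xi : a <= b -> c <= e -> xi.1 != 0 -> xi.2 != 0 ->
  hart1 (\1_(rect a b c e)) xi = hrect a b c e xi.
Proof.
move=> ab ce x10 x20.
have i1 (p q : R) (f : R -> R) : continuous f -> (forall t, `|f t| <= 1) ->
    (leb1 R).-integrable setT (EFin \o (fun t => \1_`]p, q] t * f t)).
  move=> cf f1.
  have L1 := Lsq_indic_itv p q.
  have L2 : Lsq (leb1 R) (fun t => \1_`]p, q] t * f t).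
    apply: (Lsq_le _ L1).
      by apply: measurable_funM; [exact: measurable_indic|exact: continuous_measurable_fun].
    by move=> t; rewrite normrM ler_piMr.
  have := Lsq_mul L1 L2; apply: eq_integrable => // t _ /=; congr EFin.
  by rewrite indicE mulrA -natrM mulnb andbb.
have c1 (t x : R) : `|cos (x * t)| <= 1 by rewrite ler_norml cos_geN1 cos_le1.
have s1 (t x : R) : `|sin (x * t)| <= 1 by rewrite ler_norml sin_geN1 sin_le1.
have ic p q t := i1 p q (fun x : R => cos (x * t))
  (fun x : R => is_derive_continuous (is_derive_cosc (is_derive_mul (is_derive_var x) (is_derive_const t x))))
  (c1 t).
have is1 p q t := i1 p q (fun x : R => sin (x * t))
  (fun x : R => is_derive_continuous (is_derive_sinc (is_derive_mul (is_derive_var x) (is_derive_const t x))))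
  (s1 t).
have icD := integrableD measurableT (ic c e xi.2) (is1 c e xi.2).
have icB := integrableB measurableT (ic c e xi.2) (is1 c e xi.2).
rewrite hart1E indic_rectE.
transitivity (\int[mu]_x (
   tensor (fun t => \1_`]a, b] t * cos (t * xi.1))
     (fun t => \1_`]c, e] t * cos (t * xi.2) + \1_`]c, e] t * sin (t * xi.2)) x +
   tensor (fun t => \1_`]a, b] t * sin (t * xi.1))
     (fun t => \1_`]c, e] t * cos (t * xi.2) - \1_`]c, e] t * sin (t * xi.2)) x)).
  by apply: eq_Rintegral => x _; rewrite /tensor /cas /dot2 cosD sinD; ring.
rewrite RintegralD//; last 2 first.
- exact: integrable_tensor (ic a b xi.1) icD.
- exact: integrable_tensor (is1 a b xi.1) icB.
rewrite (Rintegral_tensor (ic a b xi.1) icD) (Rintegral_tensor (is1 a b xi.1) icB).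
rewrite (RintegralD measurableT (ic c e xi.2) (is1 c e xi.2)).
rewrite (RintegralB measurableT (ic c e xi.2) (is1 c e xi.2)).
by rewrite !integral_cos_itv// !integral_sin_itv.
Qed.

Lemma ae_coord_neq0 : {ae mu, forall xi : R * R, xi.1 != 0 /\ xi.2 != 0}.
Proof.
exists (([set 0] `*` setT) `|` (setT `*` [set 0])); split.
- by apply: measurableU; apply: measurableX.
- have h (A : set (line R)) : (leb1 R [set 0%R] * leb1 R A = 0)%E.
    by rewrite [X in (X * _)%E]lebesgue_measure_set1 mul0e.
  have m0 : measurable ([set 0%R] : set (line R)) by exact: measurable_set1.
  rewrite null_set_setU//; [exact: measurableX|exact: measurableX| |].
  + by rewrite /= product_measure1E//; exact: h.
  + by rewrite /= product_measure1E// muleC; exact: h.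
- move=> [u v] /= nP; apply: contrapT => h; apply: nP; split; apply/eqP => z; apply: h.
    by left.
  by right.
Qed.

Lemma step_integrable f : step f -> mu.-integrable setT (EFin \o f).
Proof.
elim=> [a b c e|{}f g _ fi _ gi|k {}f _ fi].
- rewrite indic_rectE; apply: integrable_tensor.
  + have := Lsq_mul (Lsq_indic_itv a b) (Lsq_indic_itv a b); apply: eq_integrable => // t _ /=.
    by congr EFin; rewrite indicE -natrM mulnb andbb.
  + have := Lsq_mul (Lsq_indic_itv c e) (Lsq_indic_itv c e); apply: eq_integrable => // t _ /=.
    by congr EFin; rewrite indicE -natrM mulnb andbb.
- exact: (integrableD measurableT fi gi).
- exact: (integrableZl measurableT k fi).
Qed.

Lemma hart1_rect_ae a b c e : {ae mu, forall xi, hrect a (Num.max a b) c (Num.max c e) xi =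
  hart1 (\1_(rect a b c e)) xi}.
Proof.
rewrite rect_wlog; apply: ae2_imp ae_coord_neq0 => xi [h1 h2].
by rewrite hart1_rect// le_max lexx.
Qed.

Lemma Lsq_hart1_rect a b c e : Lsq mu (hart1 (\1_(rect a b c e))).
Proof.
apply: (eq_ae_Lsq _ (Lsq_hrect _ _ _ _) (@hart1_rect_ae a b c e)).
apply: measurable_hart1; exact: Lsq_meas (Lsq_step (step_rect _ _ _ _)).
Qed.

Lemma Lsq_hart1_step f : step f -> Lsq mu (hart1 f).
Proof.
elim=> [a b c e|{}f g sf Lf sg Lg|k {}f sf Lf].
- exact: Lsq_hart1_rect.
- by rewrite hart1D; [exact: LsqD|exact: step_integrable|exact: step_integrable].
- by rewrite hart1Z; [exact: LsqZ|exact: step_integrable].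
Qed.

Lemma ip_hart1_step f g : step f -> step g ->
  ip mu (hart1 f) (hart1 g) = c2pi * ip mu f g.
Proof.
move=> sf sg; elim: sf => [a b c e|{}f f' sf IH sf' IH'|k {}f sf IH]; last 2 first.
- rewrite hart1D; try exact: step_integrable.
  by rewrite ipDl ?IH ?IH' ?(ipDl (Lsq_step sf)) ?mulrDr//; try exact: Lsq_hart1_step; exact: Lsq_step.
- rewrite hart1Z; last exact: step_integrable.
  rewrite ipZl ?IH ?(ipZl _ (Lsq_step sf)); try exact: Lsq_hart1_step; try exact: Lsq_step.
  by ring.
have sr := step_rect a b c e.
elim: sg => [a' b' c' e'|{}g g' sg IH sg' IH'|k {}g sg IH]; last 2 first.
- rewrite hart1D; try exact: step_integrable.
  by rewrite ipDr ?IH ?IH' ?(ipDr (Lsq_step sg)) ?mulrDr//; try exact: Lsq_hart1_step; exact: Lsq_step.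
- rewrite hart1Z; last exact: step_integrable.
  rewrite ipZr ?IH ?(ipZr _ (Lsq_step sr)); try exact: Lsq_hart1_step; try exact: Lsq_step.
  by ring.
rewrite -(eq_ae_ip (Lsq_hrect _ _ _ _) (Lsq_hart1_rect _ _ _ _) (Lsq_hart1_rect _ _ _ _) (hart1_rect_ae a b c e)).
rewrite ipC -(eq_ae_ip (Lsq_hrect _ _ _ _) (Lsq_hart1_rect _ _ _ _) (Lsq_hrect _ _ _ _) (hart1_rect_ae a' b' c' e')).
by rewrite ipC ip_hrect ?le_max ?lexx// -!rect_wlog.
Qed.

(** Bounded support makes a square integrable function integrable, so that [hart1] is an absolutely
    convergent integral on this class. *)
Definition boxed n f := forall x, ~ (@box R n) x -> f x = 0.

Lemma boxed_integrable n f : Lsq mu f -> boxed n f -> mu.-integrable setT (EFin \o f).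
Proof.
move=> Lf bf.
have := Lsq_mul (Lsq_step (step_rect _ _ _ _ : step (\1_(@box R n)))) Lf.
apply: eq_integrable => // x _ /=; congr EFin; rewrite indicE.
by case: (boolP (x \in _)) => [_|]; rewrite ?mul1r// mul0r notin_setE => /bf ->.
Qed.

Lemma boxed_hart1_le n f xi : Lsq mu f -> boxed n f ->
  `|hart1 f xi| <= 2 * (Num.sqrt (ip mu \1_(@box R n) \1_(@box R n)) * Num.sqrt (ip mu f f)).
Proof.
move=> Lf bf; apply: (le_trans (hart1_bound xi (boxed_integrable Lf bf))).
rewrite ler_wpM2l//.
have Lb : Lsq mu \1_(@box R n) := Lsq_step (step_rect _ _ _ _).
have -> : \int[mu]_x `|f x| = ip mu \1_(@box R n) (fun x => `|f x|).
  apply: eq_Rintegral => x _; rewrite indicE.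
  by case: (boolP (x \in _)) => [_|]; rewrite ?mul1r// mul0r notin_setE => /bf ->; rewrite normr0.
apply: (le_trans (ler_norm _)); apply: (le_trans (ip_cauchy_norm Lb (Lsq_norm Lf))).
rewrite ler_wpM2l ?sqrtr_ge0// ler_wsqrtr// /ip.
rewrite le_eqVlt; apply/orP; left; apply/eqP.
by apply: eq_Rintegral => x _; rewrite -normrM ger0_norm// -expr2 sqr_ge0.
Qed.

(** Cutting an approximating step function down to the box only brings it closer to [f], which
    vanishes outside. The common box keeps the bound of [boxed_hart1_le] uniform along the
    sequence. *)
Lemma boxed_approx n f : Lsq mu f -> boxed n f ->
  exists g_ : nat -> R * R -> R, [/\ forall k, step (g_ k), forall k, boxed n (g_ k) &
    cvgL2 mu g_ f].
Proof.
move=> Lf bf; have [_ cf] := step_dense Lf.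
have /choice[g hg] : forall k : nat, exists g, [/\ step g, boxed n g &
    ip mu (fun x => g x - f x) (fun x => g x - f x) <= k.+1%:R^-1].
  move=> k; have k0 : 0 < k.+1%:R^-1 :> R by rewrite invr_gt0.
  have [g sg hg] := cf _ k0.
  exists (g \_ (@box R n)); split; first exact: step_box.
    by move=> x nx; rewrite patchE memNset.
  apply: le_trans hg; have Lg := Lsq_step sg.
  have Lgb := Lsq_step (step_box n sg).
  have L1 := LsqB Lgb Lf; have L2 := LsqB Lf Lg.
  rewrite -lee_fin -!Lsq_ip//.
  apply: ge0_le_integral => //.
  - by move=> x _; rewrite lee_fin sqr_ge0.
  - by apply/measurable_EFinP/measurable_funX; exact: Lsq_meas L1.
  - by apply/measurable_EFinP/measurable_funX; exact: Lsq_meas L2.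
  - move=> x _; rewrite lee_fin patchE; case: ifPn => [_|].
      by rewrite -sqrrN opprB.
    by rewrite notin_setE => /bf ->; rewrite subr0 expr0n sqr_ge0.
exists g; split; [by move=> k; case: (hg k)|by move=> k; case: (hg k)|].
apply: (squeeze_cvgr _ (cvg_cst 0) (@cvg_harmonic R)).
by apply: nearW => k; rewrite ip_ge0/=; case: (hg k).
Qed.

Lemma boxed_hart1_cvg n f (g_ : nat -> R * R -> R) xi : Lsq mu f -> boxed n f ->
  (forall k, Lsq mu (g_ k)) -> (forall k, boxed n (g_ k)) -> cvgL2 mu g_ f ->
  (fun k => hart1 (g_ k) xi) @ \oo --> hart1 f xi.
Proof.
move=> Lf bf Lg bg gf; apply/subr_cvg0; apply: norm_cvg0.
set M := 2 * Num.sqrt (ip mu \1_(@box R n) \1_(@box R n)).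
have s0 : (fun k => M * Num.sqrt (ip mu (fun x => g_ k x - f x) (fun x => g_ k x - f x))) @ \oo --> (0 : R).
  rewrite -(mulr0 M) -[X in _ * X](sqrtr0 R); apply: cvgMr.
  by have := cvg_comp _ _ gf (@sqrt_continuous R 0); apply.
apply: (squeeze_cvgr _ (cvg_cst 0) s0).
apply: nearW => k; rewrite normr_ge0/=.
have -> : hart1 (g_ k) xi - hart1 f xi = hart1 (fun x => g_ k x - f x) xi.
  by rewrite hart1B//; apply: (@boxed_integrable n).
rewrite /M -mulrA; apply: (@boxed_hart1_le n); first exact: LsqB.
by move=> x nx; rewrite bg// bf// subrr.
Qed.

(** Fatou's lemma along step approximations, whose transforms converge at every frequency. The
    resulting inequality, applied to differences, is what upgrades that convergence to L^2 in
    [boxed_hart1_isometry]. *)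
Lemma boxed_hart1_bessel n f : Lsq mu f -> boxed n f ->
  Lsq mu (hart1 f) /\ ip mu (hart1 f) (hart1 f) <= c2pi * ip mu f f.
Proof.
move=> Lf bf; have [g [sg bg gf]] := boxed_approx Lf bf.
have Lg k := Lsq_step (sg k).
have mh := measurable_hart1 (Lsq_meas Lf).
have key e : 0 < e -> (sqint mu (hart1 f) <= (c2pi * ip mu f f + e)%:E)%E.
  move=> e0; apply: (@fatou_sqint _ (plane R) R mu (fun k => hart1 (g k))).
  - by move=> k; exact: Lsq_meas (Lsq_hart1_step (sg k)).
  - by move=> xi; exact: (boxed_hart1_cvg Lf bf Lg bg gf).
  - have h2 : (fun k => c2pi * ip mu (g k) (g k)) @ \oo --> c2pi * ip mu f f.
      by apply: cvgMr; exact: cvgL2_nsq.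
    move: h2 => /cvgrPdist_le/(_ _ e0); apply: filterS => k.
    rewrite Lsq_ip; last exact: Lsq_hart1_step.
    rewrite lee_fin ip_hart1_step// ler_norml => /andP[h _].
    by rewrite -lerBlDl -lerN2 opprB.
have Lh : Lsq mu (hart1 f).
  by split => //; apply: (le_lt_trans (key 1 ltr01)); exact: ltry.
split => //; apply/ler_addgt0Pr => e e0.
by rewrite -lee_fin -Lsq_ip//; exact: key.
Qed.

Lemma boxed_hart1_isometry n f : Lsq mu f -> boxed n f ->
  ip mu (hart1 f) (hart1 f) = c2pi * ip mu f f.
Proof.
move=> Lf bf; have [g [sg bg gf]] := boxed_approx Lf bf.
have Lg k := Lsq_step (sg k).
have [Lh _] := boxed_hart1_bessel Lf bf.
have Lhg k := Lsq_hart1_step (sg k).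
have hgf : cvgL2 mu (fun k => hart1 (g k)) (hart1 f).
  have s0 : (fun k => c2pi * ip mu (fun x => g k x - f x) (fun x => g k x - f x)) @ \oo --> (0 : R).
    by rewrite -(mulr0 c2pi); apply: cvgMr.
  apply: (squeeze_cvgr _ (cvg_cst 0) s0).
  apply: nearW => k; rewrite ip_ge0/=.
  have := hart1B (boxed_integrable (Lg k) (bg k)) (boxed_integrable Lf bf).
  have bgf : boxed n (fun x => g k x - f x) by move=> x nx; rewrite bg// bf// subrr.
  by have [_] := boxed_hart1_bessel (LsqB (Lg k) Lf) bgf => + <-.
have h1 := cvgL2_nsq Lhg Lh hgf.
have h2 : (fun k => c2pi * ip mu (g k) (g k)) @ \oo --> c2pi * ip mu f f.
  by apply: cvgMr; exact: cvgL2_nsq.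
have e : (fun k => ip mu (hart1 (g k)) (hart1 (g k))) = (fun k => c2pi * ip mu (g k) (g k)).
  by apply/funext => k; exact: ip_hart1_step.
by rewrite e in h1; exact: (cvg_unique _ h1 h2).
Qed.

End Hartley.

(** * The Hartley transform on L^2 *)

Section HartleyL2.
Context (R : realType).
Notation mu := (leb2 R).
Implicit Types (f g h : R * R -> R) (x xi : R * R).

Definition trunc (n : nat) f : R * R -> R := f \_ [set x | norm2 x <= n%:R].

Lemma measurable_norm2 : mfun2 R (@norm2 R).
Proof.
apply: (measurableT_comp (continuous_measurable_fun (@sqrt_continuous R))).
by apply: measurable_funD; apply: measurable_funX;
  [exact: (@measurable_fst _ _ (line R) (line R))|exact: (@measurable_snd _ _ (line R) (line R))].
Qed.

Lemma norm2_ge0 x : 0 <= norm2 x. Proof. exact: sqrtr_ge0. Qed.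

Lemma norm2_sqr x : norm2 x ^+ 2 = x.1 ^+ 2 + x.2 ^+ 2.
Proof. by rewrite sqr_sqrtr// addr_ge0 ?sqr_ge0. Qed.

Lemma le_norm2_1 x : `|x.1| <= norm2 x.
Proof. by rewrite -sqrtr_sqr ler_wsqrtr// lerDl sqr_ge0. Qed.

Lemma le_norm2_2 x : `|x.2| <= norm2 x.
Proof. by rewrite -sqrtr_sqr ler_wsqrtr// lerDr sqr_ge0. Qed.

Lemma measurable_ball2 (r : R) : measurable ([set x | norm2 x <= r] : set (plane R)).
Proof.
have := measurable_norm2 measurableT (measurable_itv `]-oo, r]); rewrite setTI.
by congr measurable; apply/seteqP; split => x /=; rewrite in_itv.
Qed.

Lemma Lsq_trunc n f : Lsq mu f -> Lsq mu (trunc n f).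
Proof. by apply: Lsq_patch; exact: measurable_ball2. Qed.

(** The box is open on its lower sides and misses points such as (- n, 0) of the closed ball of
    radius n, hence [n.+1]. *)
Lemma trunc_boxed n f : boxed n.+1 (trunc n f).
Proof.
move=> x nx; rewrite /trunc patchE; case: ifPn => //; rewrite inE /= => xn.
exfalso; apply: nx; rewrite /box /rect /= !in_itv/=.
have h1 := le_trans (le_norm2_1 x) xn; have h2 := le_trans (le_norm2_2 x) xn.
have h3 : (n%:R : R) < n.+1%:R by rewrite ltr_nat.
have := le_lt_trans h1 h3; have := le_lt_trans h2 h3.
by rewrite !ltr_norml => /andP[-> /ltW ->] /andP[-> /ltW ->].
Qed.

Lemma trunc_cvg f : Lsq mu f -> cvgL2 mu (fun n => trunc n f) f.
Proof.
move=> Lf; apply: (@dominated_cvgL2 _ (plane R) R mu _ _ f _ _ Lf).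
- by move=> n; exact: Lsq_meas (Lsq_trunc n Lf).
- exact: Lsq_meas Lf.
- by move=> n x; rewrite /trunc patchE; case: ifP => // _; rewrite normr0.
- by [].
- apply: aeW => x; apply: cvg_near_cst.
  exists (Num.truncn (norm2 x)).+1 => // n /= xn.
  rewrite /trunc patchE mem_set//= ltW// (lt_le_trans (truncnS_gt _))// ler_nat //.
Qed.

Lemma trunc_integrable n f : Lsq mu f -> mu.-integrable setT (EFin \o trunc n f).
Proof. by move=> Lf; exact: boxed_integrable (Lsq_trunc n Lf) (@trunc_boxed n f). Qed.

Lemma Lsq_hart1_trunc n f : Lsq mu f -> Lsq mu (hart1 (trunc n f)).
Proof. by move=> Lf; have [] := boxed_hart1_bessel (Lsq_trunc n Lf) (@trunc_boxed n f). Qed.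

Lemma boxed_le (m n : nat) f : (m <= n)%N -> boxed m f -> boxed n f.
Proof.
move=> mn bf x nx; apply: bf => bx; apply: nx; move: bx.
have h : (m%:R : R) <= n%:R by rewrite ler_nat.
rewrite /box /rect /= !in_itv/= => -[/andP[h1 h2] /andP[h3 h4]].
have hN : - (n%:R : R) <= - m%:R by rewrite lerN2.
by rewrite (le_lt_trans hN h1) (le_lt_trans hN h3) (le_trans h2 h) (le_trans h4 h).
Qed.

(* The limit in L^2 of the transforms of the truncations, locked for the same reason as hart1. *)
Definition hart : (R * R -> R) -> R * R -> R := locked (fun f =>
  xget (fun=> 0) [set h | Lsq mu h /\ cvgL2 mu (fun n => hart1 (trunc n f)) h]).

Lemma hartP f : Lsq mu f -> Lsq mu (hart f) /\ cvgL2 mu (fun n => hart1 (trunc n f)) (hart f).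
Proof.
move=> Lf; have Lt n := Lsq_trunc n Lf.
have [h Lh ch] : exists2 h, Lsq mu h & cvgL2 mu (fun n => hart1 (trunc n f)) h.
  apply: Lsq_complete => [n|e e0]; first exact: Lsq_hart1_trunc.
  (* Two truncations within this squared distance of [f] are within 4 times it of each other, and
     the isometry multiplies by [c2pi]. *)
  have e4 : 0 < e / (4 * c2pi R) by rewrite divr_gt0// mulr_gt0// c2pi_gt0.
  have /cvgrPdist_le/(_ _ e4)[N _ hN] := trunc_cvg Lf.
  exists N => m n Nm Nn.
  have := hart1B (trunc_integrable m Lf) (trunc_integrable n Lf) => <-.
  have bmn : boxed (maxn m.+1 n.+1) (fun x => trunc m f x - trunc n f x).
    move=> x nx; rewrite (boxed_le (leq_maxl _ n.+1) (@trunc_boxed m f) nx).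
    by rewrite (boxed_le (leq_maxr m.+1 _) (@trunc_boxed n f) nx) subrr.
  rewrite (boxed_hart1_isometry (LsqB (Lt m) (Lt n)) bmn).
  have := hN m Nm; have := hN n Nn.
  rewrite !sub0r !normrN !ger0_norm ?ip_ge0// => h1 h2.
  have := ip_sq_add_le (LsqB (Lt m) Lf) (LsqZ (-1) (LsqB (Lt n) Lf)).
  have L1 := LsqB (Lt n) Lf.
  rewrite (@ipZl _ _ _ mu) ?(@ipZr _ _ _ mu)//; last exact: LsqZ.
  have -> : (fun x => trunc m f x - f x + -1 * (trunc n f x - f x)) = (fun x => trunc m f x - trunc n f x).
    by apply/funext => x; ring.
  move: (ip _ _ _) (ip _ _ _) (ip _ _ _) h1 h2 => A B C h1 h2 h3.
  have c0 := c2pi_gt0 R.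
  have : A <= 4 * (e / (4 * c2pi R)) by lra.
  move=> h4; apply: (le_trans (ler_wpM2l (ltW c0) h4)).
  by rewrite le_eqVlt; apply/orP; left; apply/eqP; field; rewrite gt_eqF.
by rewrite /hart -lock; case: xgetP => [h' -> []|/(_ h)] //; case.
Qed.

Lemma Lsq_hart f : Lsq mu f -> Lsq mu (hart f).
Proof. by move=> /hartP[]. Qed.

Lemma hart_uniq f h : Lsq mu f -> Lsq mu h -> cvgL2 mu (fun n => hart1 (trunc n f)) h ->
  {ae mu, forall xi, hart f xi = h xi}.
Proof.
move=> Lf Lh ch; have [L1 c1] := hartP Lf.
exact: (cvgL2_unique (fun n => Lsq_hart1_trunc n Lf) L1 Lh c1 ch).
Qed.

(** Fubini's theorem for a kernel that is symmetric in its two variables. *)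
Lemma boxed_hart1_sym n f g : Lsq mu f -> Lsq mu g -> boxed n f -> boxed n g ->
  ip mu (hart1 f) g = ip mu f (hart1 g).
Proof.
move=> Lf Lg bf bg; have fi := boxed_integrable Lf bf; have gi := boxed_integrable Lg bg.
pose m := leb2_sigma_finite R.
pose G (z : plane R * plane R) : R := tensor f g z * cas (dot2 z.1 z.2).
have Gi : (m \x m)%E.-integrable setT (EFin \o G).
  have ti := @integrable_tensor _ _ _ _ R m m f g fi gi.
  have mt := measurable_int _ ti.
  apply: (le_integrable measurableT _ _ (integrableZl measurableT 2 (integrable_abse ti))).
    apply/measurable_EFinP; apply: measurable_funM; first exact/measurable_EFinP.
    exact: measurableT_comp (@measurable_cas R) (@measurable_dot2 R).
  move=> z _ /=; rewrite lee_fin /G normrM mulrC.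
  rewrite (ger0_norm (mulr_ge0 (ler0n R 2) (normr_ge0 _))) ler_wpM2r//.
  exact: cas_le2.
have h := Fubini Gi.
rewrite /ip /Rintegral; congr fine.
transitivity (\int[m]_y \int[m]_x (EFin \o G) (x, y))%E.
  apply: eq_integral => y _ /=.
  transitivity (\int[mu]_x ((g y)%:E * (f x * cas (dot2 x y))%:E))%E; last first.
    by apply: eq_integral => x _; rewrite /G /tensor/= -EFinM; congr EFin; ring.
  have ci := integrable_cas y fi.
  apply: (etrans _ (esym (integralZl measurableT ci (g y)))).
  rewrite mulrC EFinM; congr (_ * _)%E.
  by rewrite hart1E; exact: (fineK (integrable_fin_num measurableT ci)).
rewrite -h; apply: eq_integral => x _ /=.
transitivity (\int[mu]_y ((f x)%:E * (g y * cas (dot2 y x))%:E))%E.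
  by apply: eq_integral => y _; rewrite /G /tensor/= -EFinM dot2C; congr EFin; ring.
have ci := integrable_cas x gi.
apply: (etrans (integralZl measurableT ci (f x))); rewrite EFinM; congr (_ * _)%E.
by rewrite hart1E; exact: (esym (fineK (integrable_fin_num measurableT ci))).
Qed.

Lemma truncD n f g : trunc n (fun x => f x + g x) = (fun x => trunc n f x + trunc n g x).
Proof. by apply/funext => x; rewrite /trunc !patchE; case: ifP => //; rewrite addr0. Qed.

Lemma truncZ n k f : trunc n (fun x => k * f x) = (fun x => k * trunc n f x).
Proof. by apply/funext => x; rewrite /trunc !patchE; case: ifP => //; rewrite mulr0. Qed.

Lemma hartD f g : Lsq mu f -> Lsq mu g ->
  {ae mu, forall xi, hart (fun x => f x + g x) xi = hart f xi + hart g xi}.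
Proof.
move=> Lf Lg; have [L1 c1] := hartP Lf; have [L2 c2] := hartP Lg.
apply: (hart_uniq (LsqD Lf Lg) (LsqD L1 L2)).
have -> : (fun n => hart1 (trunc n (fun x => f x + g x))) =
  (fun n xi => hart1 (trunc n f) xi + hart1 (trunc n g) xi).
  by apply/funext => n; rewrite truncD (hart1D (trunc_integrable n Lf) (trunc_integrable n Lg)).
exact: (cvgL2D (fun n => Lsq_hart1_trunc n Lf) L1 (fun n => Lsq_hart1_trunc n Lg) L2 c1 c2).
Qed.

Lemma hartZ k f : Lsq mu f -> {ae mu, forall xi, hart (fun x => k * f x) xi = k * hart f xi}.
Proof.
move=> Lf; have [L1 c1] := hartP Lf.
apply: (hart_uniq (LsqZ k Lf) (LsqZ k L1)).
have -> : (fun n => hart1 (trunc n (fun x => k * f x))) = (fun n xi => k * hart1 (trunc n f) xi).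
  by apply/funext => n; rewrite truncZ (hart1Z k (trunc_integrable n Lf)).
exact: (@cvgL2Z _ _ _ mu k _ _ (fun n => Lsq_hart1_trunc n Lf) L1 c1).
Qed.

Lemma hart_isometry f : Lsq mu f -> ip mu (hart f) (hart f) = c2pi R * ip mu f f.
Proof.
move=> Lf; have [L1 c1] := hartP Lf.
have h1 := cvgL2_nsq (fun n => Lsq_hart1_trunc n Lf) L1 c1.
have h2 : (fun n => c2pi R * ip mu (trunc n f) (trunc n f)) @ \oo --> c2pi R * ip mu f f.
  by apply: cvgMr; exact: (cvgL2_nsq (fun n => Lsq_trunc n Lf) Lf (trunc_cvg Lf)).
have e : (fun n => ip mu (hart1 (trunc n f)) (hart1 (trunc n f))) =
  (fun n => c2pi R * ip mu (trunc n f) (trunc n f)).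
  by apply/funext => n; exact: boxed_hart1_isometry (Lsq_trunc n Lf) (@trunc_boxed n f).
by rewrite e in h1; exact: (cvg_unique _ h1 h2).
Qed.

(** Polarisation: the isometry is applied to [f + g]. *)
Lemma hart_parseval f g : Lsq mu f -> Lsq mu g ->
  ip mu (hart f) (hart g) = c2pi R * ip mu f g.
Proof.
move=> Lf Lg; have [L1 L2] := (Lsq_hart Lf, Lsq_hart Lg).
have h := hart_isometry (LsqD Lf Lg); have Ls := LsqD L1 L2; have Lh := Lsq_hart (LsqD Lf Lg).
rewrite (eq_ae_ip Lh Ls Lh (hartD Lf Lg)) ipC (eq_ae_ip Lh Ls Ls (hartD Lf Lg)) in h.
move: h; rewrite (ip_sq_add L1 L2) (ip_sq_add Lf Lg) (hart_isometry Lf) (hart_isometry Lg).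
move: (ip mu (hart f) (hart g)) (ip mu f g) (ip mu f f) (ip mu g g) => A B C D.
move: (c2pi R) => c h; have : 2 * A = 2 * (c * B) by lra.
by move=> /mulfI; apply; rewrite pnatr_eq0.
Qed.

(** The two truncations are removed one after the other, since the convergence of a scalar product
    is controlled here with one factor fixed. *)
Lemma hart_sym f g : Lsq mu f -> Lsq mu g -> ip mu (hart f) g = ip mu f (hart g).
Proof.
move=> Lf Lg; have [L1 c1] := hartP Lf; have [L2 c2] := hartP Lg.
have key m : ip mu (hart f) (trunc m g) = ip mu f (hart1 (trunc m g)).
  have Lgm := Lsq_trunc m Lg; have Lhm := Lsq_hart1_trunc m Lg.
  have h1 := cvgL2_ip (fun n => Lsq_hart1_trunc n Lf) L1 Lgm c1.
  have h2 := cvgL2_ip (fun n => Lsq_trunc n Lf) Lf Lhm (trunc_cvg Lf).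
  have e : (fun n => ip mu (hart1 (trunc n f)) (trunc m g)) = (fun n => ip mu (trunc n f) (hart1 (trunc m g))).
    apply/funext => n; apply: (@boxed_hart1_sym (maxn n.+1 m.+1)) => //.
    - exact: Lsq_trunc.
    - exact: boxed_le (leq_maxl _ _) (@trunc_boxed n f).
    - exact: boxed_le (leq_maxr _ _) (@trunc_boxed m g).
  by rewrite e in h1; exact: (cvg_unique _ h1 h2).
have h1 := cvgL2_ip (fun n => Lsq_trunc n Lg) Lg L1 (trunc_cvg Lg).
have h2 := cvgL2_ip (fun n => Lsq_hart1_trunc n Lg) L2 Lf c2.
have e : (fun n => ip mu (trunc n g) (hart f)) = (fun n => ip mu (hart1 (trunc n g)) f).
  by apply/funext => n; rewrite ipC key ipC.
by rewrite e in h1; rewrite ipC [RHS]ipC; exact: (cvg_unique _ h1 h2).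
Qed.

(** Expand the square of H H f - c f, where H is the transform and c is [c2pi]. The isometry and the
    symmetry give c^2 - 2 c^2 + c^2 = 0 times the square of f. *)
Lemma hart_involution f : Lsq mu f ->
  {ae mu, forall xi, hart (hart f) xi = c2pi R * f xi}.
Proof.
move=> Lf; have L1 := Lsq_hart Lf; have L2 := Lsq_hart L1; have L3 := LsqZ (c2pi R) Lf.
have : ip mu (fun x => hart (hart f) x - c2pi R * f x) (fun x => hart (hart f) x - c2pi R * f x) = 0.
  rewrite (ip_sq_sub L2 L3) (ipZr _ L2 Lf) (ipZl _ Lf L3) (ipZr _ Lf Lf) (hart_isometry L1) (hart_sym L1 Lf).
  by rewrite (hart_isometry Lf); ring.
move=> /(ip_eq0_ae (LsqB L2 L3)); apply: ae2_imp => x /eqP.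
by rewrite subr_eq0 => /eqP.
Qed.

End HartleyL2.

(** * The Fourier transform on L^2 *)

Section FourierL2.
Context (R : realType).
Notation mu := (leb2 R).
Implicit Types (f g h : R * R -> R) (x xi : R * R) (F G : R * R -> R[i]).
Notation normc := Normc.normc.

Definition opp2 xi : R * R := reflect (0, 0) xi.

Lemma opp2E xi : opp2 xi = (- xi.1, - xi.2).
Proof. by rewrite /opp2 /reflect /= !sub0r. Qed.

Lemma opp2K : involutive opp2. Proof. exact: reflectK. Qed.

(* If h is the Hartley transform of a real function f, then herm h is its Fourier transform. *)
Definition herm h xi : R[i] :=
  ((h xi + h (opp2 xi)) / 2 +i* - ((h xi - h (opp2 xi)) / 2))%C.

Lemma normc_sqr (z : R[i]) : normc z ^+ 2 = complex.Re z ^+ 2 + complex.Im z ^+ 2.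
Proof. by case: z => a b /=; rewrite sqr_sqrtr// addr_ge0 ?sqr_ge0. Qed.

Lemma normc_ge0 (z : R[i]) : 0 <= normc z.
Proof. by case: z => a b /=; exact: sqrtr_ge0. Qed.

Lemma le_normc (z : R[i]) : normc z <= `|complex.Re z| + `|complex.Im z|.
Proof.
rewrite -(@ler_pXn2r _ 2)// ?nnegrE ?normc_ge0 ?addr_ge0// normc_sqr sqrrD.
rewrite !real_normK ?num_real//.
by have := mulr_ge0 (normr_ge0 (complex.Re z)) (normr_ge0 (complex.Im z)); lra.
Qed.

Lemma ReB (z w : R[i]) : complex.Re (z - w) = complex.Re z - complex.Re w.
Proof. by case: z => a b; case: w. Qed.

Lemma ImB (z w : R[i]) : complex.Im (z - w) = complex.Im z - complex.Im w.
Proof. by case: z => a b; case: w. Qed.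

Lemma normc_herm_sqr h xi : normc (herm h xi) ^+ 2 = (h xi ^+ 2 + h (opp2 xi) ^+ 2) / 2.
Proof. by rewrite normc_sqr /=; field. Qed.

Lemma hermB h k xi : herm h xi - herm k xi = herm (fun x => h x - k x) xi.
Proof. by apply/eqP; rewrite eq_complex ReB ImB /=; apply/andP; split; apply/eqP; field. Qed.

Lemma Lsq_opp2 h : Lsq mu h -> Lsq mu (fun xi => h (opp2 xi)).
Proof. exact: Lsq_reflect. Qed.

Lemma measurable_opp2 h : mfun2 R h -> mfun2 R (fun xi => h (opp2 xi)).
Proof. by move=> mh; exact: measurableT_comp mh (measurable_reflect (0, 0)). Qed.

Lemma measurable_normc F : mfun2 R (fun xi => complex.Re (F xi)) ->
  mfun2 R (fun xi => complex.Im (F xi)) -> mfun2 R (fun xi => normc (F xi)).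
Proof.
move=> m1 m2.
have -> : (fun xi => normc (F xi)) = (fun xi => Num.sqrt (complex.Re (F xi) ^+ 2 + complex.Im (F xi) ^+ 2)).
  by apply/funext => xi; case: (F xi).
apply: (measurableT_comp (continuous_measurable_fun (@sqrt_continuous R))).
by apply: measurable_funD; apply: measurable_funX.
Qed.

Lemma L2P f : L2 f <-> Lsq mu f.
Proof. by split => [/LsqP|/LsqP]. Qed.

Lemma L2C_measurable F : L2C F -> mfun2 R (fun xi => normc (F xi)).
Proof.
by move=> [/L2P L1 /L2P L2]; apply: measurable_normc; [exact: Lsq_meas L1|exact: Lsq_meas L2].
Qed.

Lemma Lsq_Re_herm h : Lsq mu h -> Lsq mu (fun xi => complex.Re (herm h xi)).
Proof.
move=> Lh; have := LsqZ 2^-1 (LsqD Lh (Lsq_opp2 Lh)); congr Lsq.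
by apply/funext => xi /=; rewrite mulrC.
Qed.

Lemma Lsq_Im_herm h : Lsq mu h -> Lsq mu (fun xi => complex.Im (herm h xi)).
Proof.
move=> Lh; have := LsqZ (- 2^-1) (LsqB Lh (Lsq_opp2 Lh)); congr Lsq.
by apply/funext => xi /=; rewrite mulNr mulrC.
Qed.

Lemma L2C_herm h : Lsq mu h -> L2C (herm h).
Proof. by move=> Lh; split; apply/L2P; [exact: Lsq_Re_herm|exact: Lsq_Im_herm]. Qed.

Lemma measurable_herm h : mfun2 R h -> mfun2 R (fun xi => normc (herm h xi)).
Proof.
move=> mh; have mo := measurable_opp2 mh; apply: measurable_normc => /=.
- by apply: measurable_funM => //; exact: measurable_funD.
- by apply: measurable_funN; apply: measurable_funM => //; exact: measurable_funB.
Qed.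

(** The squared modulus of [herm h] is the average of h^2 at [xi] and at [opp2 xi]; an even weight
    does not distinguish the two. *)
Lemma integral_herm_weight (W : R * R -> R) h : mfun2 R W -> (forall xi, 0 <= W xi) ->
  (forall xi, W (opp2 xi) = W xi) -> mfun2 R h ->
  (\int[mu]_xi (W xi * normc (herm h xi) ^+ 2)%:E = \int[mu]_xi (W xi * h xi ^+ 2)%:E)%E.
Proof.
move=> mW W0 We mh; have mo := measurable_opp2 mh.
have mg : mfun2 R (fun xi => (W xi * h xi ^+ 2)%:E).
  by apply/measurable_EFinP/measurable_funM => //; exact: measurable_funX.
have mg' : mfun2 R (fun xi => (W xi * h (opp2 xi) ^+ 2)%:E).
  by apply/measurable_EFinP/measurable_funM => //; exact: measurable_funX.
have g0 k xi : (0 <= (W xi * k ^+ 2)%:E)%E by rewrite lee_fin mulr_ge0 ?sqr_ge0.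
transitivity (\int[mu]_xi ((2^-1)%:E * ((W xi * h xi ^+ 2)%:E + (W xi * h (opp2 xi) ^+ 2)%:E)))%E.
  by apply: eq_integral => xi _; rewrite normc_herm_sqr -EFinD -EFinM; congr EFin; ring.
rewrite ge0_integralZl//; last 2 first.
- exact: emeasurable_funD.
- by move=> xi _; rewrite adde_ge0.
rewrite ge0_integralD//.
have -> : (\int[mu]_xi (W xi * h (opp2 xi) ^+ 2)%:E = \int[mu]_xi (W xi * h xi ^+ 2)%:E)%E.
  rewrite -(@ge0_integral_reflect R (0, 0) (fun xi => (W xi * h xi ^+ 2)%:E))//.
  by apply: eq_integral => xi _; rewrite -/(opp2 xi) We.
set I := (\int[mu]_xi (W xi * h xi ^+ 2)%:E)%E.
rewrite -mule2n -mule_natl muleA -EFinM mulVf ?mul1e// pnatr_eq0//.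
Qed.

Lemma fourier1_herm f xi : mu.-integrable setT (EFin \o f) ->
  fourier1 f xi = herm (hart1 f) xi.
Proof.
move=> fi; rewrite /fourier1 /Cintegral /herm hart1E.
have mc : mfun2 R (fun x => cos (dot2 x xi)).
  exact: (measurableT_comp (continuous_measurable_fun (@continuous_cos R)) (measurable_dot2l xi)).
have ms : mfun2 R (fun x => sin (dot2 x xi)).
  exact: (measurableT_comp (continuous_measurable_fun (@continuous_sin R)) (measurable_dot2l xi)).
have c1 x : `|cos (dot2 x xi)| <= 1 by rewrite ler_norml cos_geN1 cos_le1.
have s1 x : `|sin (dot2 x xi)| <= 1 by rewrite ler_norml sin_geN1 sin_le1.
have ic := integrable_mul_bounded mc c1 fi; have is1 := integrable_mul_bounded ms s1 fi.
have eD : \int[mu]_x (f x * cas (dot2 x xi)) =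
    \int[mu]_x (f x * cos (dot2 x xi)) + \int[mu]_x (f x * sin (dot2 x xi)).
  by rewrite -RintegralD//; apply: eq_Rintegral => x _; rewrite /cas; ring.
have eB : \int[mu]_x (f x * cas (dot2 x (opp2 xi))) =
    \int[mu]_x (f x * cos (dot2 x xi)) - \int[mu]_x (f x * sin (dot2 x xi)).
  rewrite -RintegralB//; apply: eq_Rintegral => x _.
  have -> : dot2 x (opp2 xi) = - dot2 x xi by rewrite opp2E /dot2 /=; ring.
  by rewrite /cas cosN sinN; ring.
rewrite eD eB; apply/eqP; rewrite eq_complex /=; apply/andP; split; apply/eqP.
- transitivity (\int[mu]_x (f x * cos (dot2 x xi))); last by field.
  by apply: eq_Rintegral => x _ /=; rewrite cosN; ring.
- transitivity (-1 * \int[mu]_x (f x * sin (dot2 x xi))); last by field.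
  rewrite -RintegralZl//; apply: eq_Rintegral => x _ /=.
  by rewrite sinN; ring.
Qed.

Lemma sqint_herm h : mfun2 R h ->
  (\int[mu]_xi (normc (herm h xi) ^+ 2)%:E = sqint mu h)%E.
Proof.
move=> mh; have := @integral_herm_weight (fun=> 1) h (measurable_cst _) (fun=> ler01) (fun=> erefl) mh.
under eq_integral do rewrite mul1r.
by move=> ->; apply: eq_integral => xi _; rewrite mul1r.
Qed.

Lemma is_fourier_hart f : Lsq mu f -> is_fourier f (herm (hart f)).
Proof.
move=> Lf; have [Lh ch] := hartP Lf; split; first exact: L2C_herm.
have -> : (fun n => \int[mu]_xi (normc (herm (hart f) xi - fourier1 (f \_ [set x | norm2 x <= n%:R]) xi) ^+ 2)%:E)%E
  = (fun n => (ip mu (fun x => hart1 (trunc n f) x - hart f x) (fun x => hart1 (trunc n f) x - hart f x))%:E).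
  apply/funext => n; have Ln := Lsq_hart1_trunc n Lf.
  rewrite -(Lsq_ip (LsqB Ln Lh)).
  transitivity (sqint mu (fun x => hart f x - hart1 (trunc n f) x)).
    rewrite -sqint_herm; last exact: Lsq_meas (LsqB Lh Ln).
    apply: eq_integral => xi _; rewrite -hermB (fourier1_herm xi (trunc_integrable n Lf)) //.
  by apply: eq_integral => xi _; rewrite -sqrrN opprB.
by apply: cvg_EFin; [exact: nearW|exact: ch].
Qed.

Lemma fourierP f : Lsq mu f -> is_fourier f (fourier f).
Proof.
move=> Lf; rewrite /fourier; case: xgetP => [F -> //|/(_ (herm (hart f)))].
by move=> h; exfalso; exact/h/is_fourier_hart.
Qed.

(** The definition controls a complex modulus. It dominates the real and imaginary parts, so
    uniqueness of real L^2 limits applies to each part. *)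
Lemma is_fourier_uniq f F : Lsq mu f -> is_fourier f F ->
  {ae mu, forall xi, F xi = herm (hart f) xi}.
Proof.
move=> Lf [[/L2P LR /L2P LI] cF]; have [Lh ch] := hartP Lf.
have Ln n := Lsq_hart1_trunc n Lf.
have LR' := Lsq_Re_herm Lh; have LI' := Lsq_Im_herm Lh.
have LRn n := Lsq_Re_herm (Ln n); have LIn n := Lsq_Im_herm (Ln n).
have key G : L2C G -> (fun n => \int[mu]_xi (normc (G xi - fourier1 (f \_ [set x | norm2 x <= n%:R]) xi) ^+ 2)%:E)%E
     @ \oo --> 0%E ->
   cvgL2 mu (fun n xi => complex.Re (herm (hart1 (trunc n f)) xi)) (fun xi => complex.Re (G xi)) /\
   cvgL2 mu (fun n xi => complex.Im (herm (hart1 (trunc n f)) xi)) (fun xi => complex.Im (G xi)).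
  move=> [/L2P GR /L2P GI] cG.
  have bound (u : nat -> R * R -> R) (v : R * R -> R) : (forall n, Lsq mu (u n)) -> Lsq mu v ->
      (forall n xi, (u n xi - v xi) ^+ 2 <= normc (G xi - fourier1 (trunc n f) xi) ^+ 2) -> cvgL2 mu u v.
    move=> Lu Lv uv.
    have mD n : mfun2 R (fun xi => (normc (G xi - fourier1 (trunc n f) xi) ^+ 2)%:E).
      apply/measurable_EFinP/measurable_funX; apply: measurable_normc.
      - have := Lsq_meas (LsqB GR (LRn n)); congr measurable_fun.
        by apply/funext => xi; rewrite ReB (fourier1_herm xi (trunc_integrable n Lf)).
      - have := Lsq_meas (LsqB GI (LIn n)); congr measurable_fun.
        by apply/funext => xi; rewrite ImB (fourier1_herm xi (trunc_integrable n Lf)).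
    have : (fun n => (ip mu (fun x => u n x - v x) (fun x => u n x - v x))%:E) @ \oo --> 0%E.
      apply: (squeeze_cvge _ (cvg_cst 0%E) cG); apply: nearW => n.
      rewrite lee_fin ip_ge0 -Lsq_ip; last exact: LsqB.
      apply: ge0_le_integral => //.
      - by move=> xi _; rewrite lee_fin sqr_ge0.
      - by apply/measurable_EFinP/measurable_funX; exact: Lsq_meas (LsqB (Lu n) Lv).
      - exact: mD.
      - by move=> xi _; rewrite lee_fin; exact: uv.
    by move=> /fine_cvg.
  split; apply: bound => //.
  - move=> n xi; rewrite (fourier1_herm xi (trunc_integrable n Lf)) normc_sqr ReB.
    by rewrite -sqrrN opprB lerDl sqr_ge0.
  - move=> n xi; rewrite (fourier1_herm xi (trunc_integrable n Lf)) normc_sqr ImB.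
    by rewrite -sqrrN opprB lerDr sqr_ge0.
have [||c1 c2] := key F; [by split; apply/L2P|by []|].
have [F' c'] := is_fourier_hart Lf; have [c3 c4] := key _ F' c'.
have e1 := cvgL2_unique LRn LR LR' c1 c3; have e2 := cvgL2_unique LIn LI LI' c2 c4.
apply: ae2_imp (ae2_and e1 e2) => xi [h1 h2].
by apply/eqP; rewrite eq_complex h1 h2 !eqxx.
Qed.

Lemma fourier_hart f : Lsq mu f -> {ae mu, forall xi, fourier f xi = herm (hart f) xi}.
Proof. by move=> Lf; apply: is_fourier_uniq => //; exact: fourierP. Qed.

Definition ampl f xi : R := normc (fourier f xi).

Lemma ampl_ge0 f xi : 0 <= ampl f xi. Proof. exact: normc_ge0. Qed.

Lemma measurable_ampl f : Lsq mu f -> mfun2 R (ampl f).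
Proof. by move=> Lf; apply: L2C_measurable; have [] := fourierP Lf. Qed.

Lemma ampl_even f : Lsq mu f -> {ae mu, forall xi, ampl f (opp2 xi) = ampl f xi}.
Proof.
move=> Lf; have h := fourier_hart Lf; have h' := ae_reflect (0, 0) h.
apply: ae2_imp (ae2_and h h') => xi [h1 h2].
rewrite /ampl h1 [X in normc X]h2.
apply: (@pexpIrn _ 2) => //; rewrite ?nnegrE ?normc_ge0// !normc_herm_sqr.
by rewrite -/(opp2 xi) opp2K [X in X / 2]addrC.
Qed.

Lemma hart_le_ampl f : Lsq mu f -> {ae mu, forall xi, `|hart f xi| <= 2 * ampl f xi}.
Proof.
move=> Lf; apply: ae2_imp (fourier_hart Lf) => xi h.
rewrite -(@ler_pXn2r _ 2)// ?nnegrE ?mulr_ge0 ?ampl_ge0// exprMn /ampl h normc_herm_sqr.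
rewrite real_normK ?num_real//.
have := sqr_ge0 (hart f (opp2 xi)); have := sqr_ge0 (hart f xi); lra.
Qed.

Lemma ampl_weight (W : R * R -> R) f : mfun2 R W -> (forall xi, 0 <= W xi) ->
  (forall xi, W (opp2 xi) = W xi) -> Lsq mu f ->
  (\int[mu]_xi (W xi * ampl f xi ^+ 2)%:E = \int[mu]_xi (W xi * hart f xi ^+ 2)%:E)%E.
Proof.
move=> mW W0 We Lf; have mh := Lsq_meas (Lsq_hart Lf).
rewrite -(integral_herm_weight mW W0 We mh).
apply: ae_eq_integral => //.
- by apply/measurable_EFinP/measurable_funM => //; apply: measurable_funX; exact: measurable_ampl.
- by apply/measurable_EFinP/measurable_funM => //; apply: measurable_funX; exact: measurable_herm.
- by apply: ae2_imp (fourier_hart Lf) => xi h _; rewrite /ampl h.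
Qed.

Lemma sqint_ampl f : Lsq mu f -> sqint mu (ampl f) = sqint mu (hart f).
Proof.
move=> Lf.
have h := @ampl_weight (fun=> 1) f (measurable_cst _) (fun=> ler01) (fun=> erefl) Lf.
transitivity (\int[mu]_xi (1 * ampl f xi ^+ 2)%:E)%E.
  by apply: eq_integral => xi _; rewrite mul1r.
by rewrite h; apply: eq_integral => xi _; rewrite mul1r.
Qed.

Lemma Lsq_ampl f : Lsq mu f -> Lsq mu (ampl f).
Proof.
move=> Lf; split; first exact: measurable_ampl.
by rewrite sqint_ampl//; have [] := Lsq_hart Lf.
Qed.

Lemma ip_ampl f : Lsq mu f -> ip mu (ampl f) (ampl f) = c2pi R * ip mu f f.
Proof.
move=> Lf; rewrite -(hart_isometry Lf); apply: EFin_inj.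
by rewrite -!Lsq_ip; [exact: sqint_ampl|exact: Lsq_hart|exact: Lsq_ampl].
Qed.

Lemma fourierB f g : Lsq mu f -> Lsq mu g ->
  {ae mu, forall xi, fourier (fun x => f x - g x) xi = fourier f xi - fourier g xi}.
Proof.
move=> Lf Lg; have h1 := fourier_hart Lf; have h2 := fourier_hart Lg.
have h3 := fourier_hart (LsqB Lf Lg).
(* [herm] reads its argument at [xi] and at [opp2 xi], so the almost everywhere identities are
   needed at reflected points too. *)
have h4 := hartD Lf (LsqZ (-1) Lg); have h5 := @hartZ _ (-1) _ Lg.
have h6 := ae2_and h4 h5; have h7 := ae_reflect (0, 0) h6.
apply: ae2_imp (ae2_and (ae2_and h1 h2) (ae2_and h3 (ae2_and h6 h7))).
move=> xi [[e1 e2] [e3 [[e4 e5] [e6 e7]]]].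
rewrite e1 e2 e3 hermB.
have -> : (fun x => f x - g x) = (fun x => f x + -1 * g x) by apply/funext => x; ring.
by rewrite /herm /opp2 e4 e5 e6 e7; congr (_ +i* _)%C; ring.
Qed.

(** The Hartley transform is its own inverse up to [c2pi], so a preimage is obtained by transforming
    [h] once more. *)
Lemma fourier_onto h : Lsq mu h ->
  exists2 g, Lsq mu g & {ae mu, forall xi, fourier g xi = herm h xi}.
Proof.
move=> Lh; have Lg := LsqZ (c2pi R)^-1 (Lsq_hart Lh).
exists (fun x => (c2pi R)^-1 * hart h x) => //.
have e1 := fourier_hart Lg; have e2 := @hartZ _ (c2pi R)^-1 _ (Lsq_hart Lh).
have e3 := hart_involution Lh; have e4 := ae2_and e2 e3; have e5 := ae_reflect (0, 0) e4.
have c0 : c2pi R != 0 by rewrite gt_eqF// c2pi_gt0.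
apply: ae2_imp (ae2_and e1 (ae2_and e4 e5)) => xi [-> [[k1 k2] [k3 k4]]].
by rewrite /herm /opp2 k1 k2 k3 k4; congr (_ +i* _)%C; field.
Qed.

(** A Hermitian [F] is [herm h] for h = Re F - Im F: the even part of h is Re F and its odd part is
    - Im F. *)
Lemma fourier_onto_hermitian F : L2C F ->
  {ae mu, forall xi, complex.Re (F (opp2 xi)) = complex.Re (F xi) /\
                     complex.Im (F (opp2 xi)) = - complex.Im (F xi)} ->
  exists2 g, Lsq mu g & {ae mu, forall xi, fourier g xi = F xi}.
Proof.
move=> [/L2P LR /L2P LI] hF.
have [g Lg eg] := fourier_onto (LsqB LR LI).
exists g => //; apply: ae2_imp (ae2_and eg hF) => xi [-> [h1 h2]].
by apply/eqP; rewrite eq_complex /= h1 h2; apply/andP; split; apply/eqP; field.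
Qed.

End FourierL2.

(** * Products and Fourier multipliers *)

Section Products.
Context (R : realType).
Notation mu := (leb2 R).
Implicit Types (f g h u v : R * R -> R) (x xi eta : R * R) (m F G : R * R -> R[i]).
Notation normc := Normc.normc.

Lemma ip_le_ae u v u' v' : Lsq mu u -> Lsq mu v -> Lsq mu u' -> Lsq mu v' ->
  {ae mu, forall x, `|u x| <= u' x} -> {ae mu, forall x, `|v x| <= v' x} ->
  `|ip mu u v| <= ip mu u' v'.
Proof.
move=> Lu Lv Lu' Lv' uu vv.
have i1 := Lsq_mul Lu Lv; have i2 := Lsq_mul Lu' Lv'.
have [Lau Lav] := (Lsq_norm Lu, Lsq_norm Lv).
have [Lau' Lav'] := (Lsq_norm Lu', Lsq_norm Lv').
have h1 : `|ip mu u v| <= ip mu (fun x => `|u x|) (fun x => `|v x|).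
  apply: (le_trans (le_normr_Rintegral measurableT i1)).
  by rewrite le_eqVlt; apply/orP; left; apply/eqP; apply: eq_Rintegral => x _; rewrite normrM.
apply: (le_trans h1).
have -> : ip mu u' v' = ip mu (fun x => `|u' x|) (fun x => `|v' x|).
  transitivity (ip mu (fun x => `|u' x|) v').
    apply: (@eq_ae_ip _ (plane R) R mu u' (fun x => `|u' x|) v' Lu' Lau' Lv').
    by apply: ae2_imp uu => x h; rewrite ger0_norm// (le_trans _ h).
  rewrite ipC [RHS]ipC; apply: (@eq_ae_ip _ (plane R) R mu v' (fun x => `|v' x|) _ Lv' Lav' Lau').
  by apply: ae2_imp vv => x h; rewrite ger0_norm// (le_trans _ h).
rewrite -lee_fin /ip /Rintegral !fineK; [|exact/integrable_fin_num/Lsq_mul|exact/integrable_fin_num/Lsq_mul].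
apply: ae_ge0_le_integral => //.
- exact: (measurable_int _ (Lsq_mul Lau Lav)).
- exact: (measurable_int _ (Lsq_mul Lau' Lav')).
- apply: ae2_imp (ae2_and uu vv) => x [h1' h2'] _; rewrite lee_fin ler_pM//.
  + by rewrite (le_trans h1')// ler_norm.
  + by rewrite (le_trans h2')// ler_norm.
Qed.

Lemma cvgL2_ip2 (u_ v_ : nat -> R * R -> R) u v : (forall n, Lsq mu (u_ n)) ->
  (forall n, Lsq mu (v_ n)) -> Lsq mu u -> Lsq mu v ->
  cvgL2 mu u_ u -> cvgL2 mu v_ v -> (fun n => ip mu (u_ n) (v_ n)) @ \oo --> ip mu u v.
Proof.
move=> Lun Lvn Lu Lv cu cv.
have h1 := cvgL2_nsq (fun n => LsqD (Lun n) (Lvn n)) (LsqD Lu Lv) (cvgL2D Lun Lu Lvn Lv cu cv).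
have h2 := cvgL2_nsq Lun Lu cu; have h3 := cvgL2_nsq Lvn Lv cv.
have e n : ip mu (u_ n) (v_ n) = 2^-1 * (ip mu (fun x => u_ n x + v_ n x) (fun x => u_ n x + v_ n x)
   - ip mu (u_ n) (u_ n) - ip mu (v_ n) (v_ n)).
  by rewrite (ip_sq_add (Lun n) (Lvn n)); field.
have -> : ip mu u v = 2^-1 * (ip mu (fun x => u x + v x) (fun x => u x + v x)
   - ip mu u u - ip mu v v).
  by rewrite (ip_sq_add Lu Lv); field.
rewrite (_ : (fun n => ip mu (u_ n) (v_ n)) = (fun n => 2^-1 * (ip mu (fun x => u_ n x + v_ n x) (fun x => u_ n x + v_ n x)
   - ip mu (u_ n) (u_ n) - ip mu (v_ n) (v_ n)))); last by apply/funext => n; exact: e.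
by apply: cvgMr; apply: cvgB => //; apply: cvgB.
Qed.

Definition modc xi g x : R := g x * cos (dot2 x xi).
Definition mods xi g x : R := g x * sin (dot2 x xi).

Lemma measurable_cos_dot xi : mfun2 R (fun x => cos (dot2 x xi)).
Proof. exact: (measurableT_comp (continuous_measurable_fun (@continuous_cos R)) (measurable_dot2l xi)). Qed.

Lemma measurable_sin_dot xi : mfun2 R (fun x => sin (dot2 x xi)).
Proof. exact: (measurableT_comp (continuous_measurable_fun (@continuous_sin R)) (measurable_dot2l xi)). Qed.

Lemma Lsq_mul_bounded1 g (b : R * R -> R) : mfun2 R b -> (forall x, `|b x| <= 1) ->
  Lsq mu g -> Lsq mu (fun x => g x * b x).
Proof.
move=> mb b1 Lg; apply: (Lsq_le _ Lg).
  by apply: measurable_funM => //; exact: Lsq_meas Lg.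
by move=> x; rewrite normrM ler_piMr.
Qed.

Lemma cos_le1_norm (t : R) : `|cos t| <= 1. Proof. by rewrite ler_norml cos_geN1 cos_le1. Qed.
Lemma sin_le1_norm (t : R) : `|sin t| <= 1. Proof. by rewrite ler_norml sin_geN1 sin_le1. Qed.

Lemma Lsq_modc xi g : Lsq mu g -> Lsq mu (modc xi g).
Proof. by apply: Lsq_mul_bounded1 => [|x]; [exact: measurable_cos_dot|exact: cos_le1_norm]. Qed.

Lemma Lsq_mods xi g : Lsq mu g -> Lsq mu (mods xi g).
Proof. by apply: Lsq_mul_bounded1 => [|x]; [exact: measurable_sin_dot|exact: sin_le1_norm]. Qed.

Lemma cvgL2_reflect a (u_ : nat -> R * R -> R) u : (forall n, Lsq mu (u_ n)) -> Lsq mu u ->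
  cvgL2 mu u_ u -> cvgL2 mu (fun n => u_ n \o reflect a) (u \o reflect a).
Proof.
move=> Lun Lu; rewrite /cvgL2.
have -> // : (fun n => ip mu (fun x => (u_ n \o reflect a) x - (u \o reflect a) x)
     (fun x => (u_ n \o reflect a) x - (u \o reflect a) x)) =
  (fun n => ip mu (fun x => u_ n x - u x) (fun x => u_ n x - u x)).
apply/funext => n; have md := Lsq_meas (LsqB (Lun n) Lu).
exact: (ip_reflect a md md).
Qed.

Lemma cvgL2_opp2 (u_ : nat -> R * R -> R) u : (forall n, Lsq mu (u_ n)) -> Lsq mu u ->
  cvgL2 mu u_ u -> cvgL2 mu (fun n xi => u_ n (opp2 xi)) (fun xi => u (opp2 xi)).
Proof. exact: cvgL2_reflect. Qed.

(* Multiplying g by cos (x . xi) shifts its transform; with Parseval's identity this turns the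
   Fourier integral of a product into a convolution without any integrability of the transforms. *)
Lemma hart_modc xi g : Lsq mu g -> {ae mu, forall eta, hart (modc xi g) eta =
  2^-1 * (hart g (reflect xi (opp2 eta)) + hart g (opp2 (reflect xi eta)))}.
Proof.
move=> Lg; have [Lh ch] := hartP Lg; have Ln n := Lsq_hart1_trunc n Lg.
have L1 a k : Lsq mu k -> Lsq mu (fun eta => k (reflect a (opp2 eta))).
  by move=> Lk; exact: (@Lsq_opp2 R (fun x => k (reflect a x)) (Lsq_reflect a Lk)).
have L2 a k : Lsq mu k -> Lsq mu (fun eta => k (opp2 (reflect a eta))).
  by move=> Lk; exact: (@Lsq_reflect R a (fun x => k (opp2 x)) (Lsq_opp2 Lk)).
apply: (hart_uniq (Lsq_modc xi Lg)); first exact: LsqZ (LsqD (L1 _ _ Lh) (L2 _ _ Lh)).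
have -> : (fun n => hart1 (trunc n (modc xi g))) =
  (fun n eta => 2^-1 * (hart1 (trunc n g) (reflect xi (opp2 eta)) + hart1 (trunc n g) (opp2 (reflect xi eta)))).
  apply/funext => n; apply/funext => eta; rewrite !hart1E.
  have ti := trunc_integrable n Lg.
  rewrite -RintegralD//; try exact: integrable_cas.
  rewrite -RintegralZl//; last exact: (integrableD measurableT (integrable_cas _ ti) (integrable_cas _ ti)).
  apply: eq_Rintegral => x _.
  have -> : trunc n (modc xi g) x = trunc n g x * cos (dot2 x xi).
    by rewrite /trunc /modc !patchE; case: ifP => //; rewrite mul0r.
  have -> : dot2 x (reflect xi (opp2 eta)) = dot2 x eta + dot2 x xi.
    by rewrite opp2E /reflect /dot2 /=; ring.
  have -> : dot2 x (opp2 (reflect xi eta)) = dot2 x eta - dot2 x xi.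
    by rewrite opp2E /reflect /dot2 /=; ring.
  set a := dot2 x xi; set b := dot2 x eta.
  rewrite /cas cosB sinB cosD sinD.
  by move: (cos a) (sin a) (cos b) (sin b) => c1 c2 c3 c4; field.
apply: cvgL2Z.
- by move=> n; exact: LsqD (L1 _ _ (Ln n)) (L2 _ _ (Ln n)).
- exact: LsqD (L1 _ _ Lh) (L2 _ _ Lh).
apply: (cvgL2D (fun n => L1 _ _ (Ln n)) (L1 _ _ Lh) (fun n => L2 _ _ (Ln n)) (L2 _ _ Lh)).
- exact: (cvgL2_opp2 (fun n => Lsq_reflect xi (Ln n)) (Lsq_reflect xi Lh) (cvgL2_reflect xi Ln Lh ch)).
- exact: (cvgL2_reflect xi (fun n => Lsq_opp2 (Ln n)) (Lsq_opp2 Lh) (cvgL2_opp2 Ln Lh ch)).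
Qed.

(** The sine counterpart, from 2 sin a cas b = cas (a - b) - cas (- a - b). *)
Lemma hart_mods xi g : Lsq mu g -> {ae mu, forall eta, hart (mods xi g) eta =
  2^-1 * (hart g (reflect xi eta) + -1 * hart g (opp2 (reflect xi (opp2 eta))))}.
Proof.
move=> Lg; have [Lh ch] := hartP Lg; have Ln n := Lsq_hart1_trunc n Lg.
have L1 k : Lsq mu k -> Lsq mu (fun eta => -1 * k (opp2 (reflect xi (opp2 eta)))).
  by move=> Lk; exact: (LsqZ (-1) (Lsq_opp2 (Lsq_reflect xi (Lsq_opp2 Lk)))).
have L2 k : Lsq mu k -> Lsq mu (fun eta => k (reflect xi eta)) by exact: Lsq_reflect.
apply: (hart_uniq (Lsq_mods xi Lg)); first exact: LsqZ (LsqD (L2 _ Lh) (L1 _ Lh)).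
have -> : (fun n => hart1 (trunc n (mods xi g))) =
  (fun n eta => 2^-1 * (hart1 (trunc n g) (reflect xi eta) + -1 * hart1 (trunc n g) (opp2 (reflect xi (opp2 eta))))).
  apply/funext => n; apply/funext => eta; rewrite !hart1E.
  have ti := trunc_integrable n Lg.
  rewrite -RintegralZl//; last exact: integrable_cas.
  have iN := integrableZl measurableT (-1) (integrable_cas (opp2 (reflect xi (opp2 eta))) ti).
  rewrite -RintegralD//; last exact: integrable_cas.
  rewrite -RintegralZl//; last exact: (integrableD measurableT (integrable_cas _ ti) iN).
  apply: eq_Rintegral => x _.
  have -> : trunc n (mods xi g) x = trunc n g x * sin (dot2 x xi).
    by rewrite /trunc /mods !patchE; case: ifP => //; rewrite mul0r.
  have -> : dot2 x (reflect xi eta) = dot2 x xi - dot2 x eta.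
    by rewrite /reflect /dot2 /=; ring.
  have -> : dot2 x (opp2 (reflect xi (opp2 eta))) = - dot2 x xi - dot2 x eta.
    by rewrite !opp2E /reflect /dot2 /=; ring.
  set a := dot2 x xi; set b := dot2 x eta.
  have -> : - a - b = - (a + b) by ring.
  rewrite /cas cosN sinN cosB sinB cosD sinD.
  by move: (cos a) (sin a) (cos b) (sin b) => c1 c2 c3 c4; field.
apply: cvgL2Z.
- by move=> n; exact: LsqD (L2 _ (Ln n)) (L1 _ (Ln n)).
- exact: LsqD (L2 _ Lh) (L1 _ Lh).
apply: (cvgL2D (fun n => L2 _ (Ln n)) (L2 _ Lh) (fun n => L1 _ (Ln n)) (L1 _ Lh)).
- exact: (cvgL2_reflect xi Ln Lh ch).
- have Lo n := Lsq_opp2 (Lsq_reflect xi (Lsq_opp2 (Ln n))).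
  have Loh := Lsq_opp2 (Lsq_reflect xi (Lsq_opp2 Lh)).
  apply: (cvgL2Z (-1) Lo Loh).
  apply: (cvgL2_opp2 (fun n => Lsq_reflect xi (Lsq_opp2 (Ln n))) (Lsq_reflect xi (Lsq_opp2 Lh))).
  exact: (cvgL2_reflect xi (fun n => Lsq_opp2 (Ln n)) (Lsq_opp2 Lh) (cvgL2_opp2 Ln Lh ch)).
Qed.

Definition conv u v xi : R := ip mu (u \o reflect xi) v.

(** The alternatives in the hypothesis match the shifts caused by a cosine and by a sine. One factor
    2 comes from [hart_le_ampl] for [f]; the other because the two shifted amplitudes of [g] have
    the same integral against the even amplitude of [f]. *)
Lemma ip_hart_le_conv xi f g k : Lsq mu f -> Lsq mu g -> Lsq mu k ->
  {ae mu, forall eta, `|k eta| <= 2^-1 * (`|hart g (reflect xi (opp2 eta))| + `|hart g (opp2 (reflect xi eta))|)} \/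
  {ae mu, forall eta, `|k eta| <= 2^-1 * (`|hart g (reflect xi eta)| + `|hart g (opp2 (reflect xi (opp2 eta)))|)} ->
  `|ip mu (hart f) k| <= 4 * conv (ampl g) (ampl f) xi.
Proof.
move=> Lf Lg Lk hk.
have Laf := Lsq_ampl Lf; have Lag := Lsq_ampl Lg.
have Lr := Lsq_reflect xi Lag; have Lro := Lsq_opp2 Lr.
have hg : {ae mu, forall eta, `|hart g eta| <= 2 * ampl g eta /\ `|hart g (opp2 eta)| <= 2 * ampl g eta}.
  have h1 := hart_le_ampl Lg.
  apply: ae2_imp (ae2_and (ae2_and h1 (ae_reflect (0, 0) h1)) (ampl_even Lg)) => eta [[e1 e2] e3].
  by split => //; rewrite -e3.
have hg1 := ae_reflect xi hg; have hg2 := ae_reflect (0, 0) hg1.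
have kb : {ae mu, forall eta, `|k eta| <= (ampl g \o reflect xi) eta + (ampl g \o reflect xi) (opp2 eta)}.
  case: hk => hk; apply: ae2_imp (ae2_and hk (ae2_and hg1 hg2)) => eta [h [[a1 a2] [b1 b2]]];
    rewrite /= /opp2 in h *; lra.
have L2f := LsqZ 2 Laf; have Ls := LsqD Lr Lro.
apply: (le_trans (ip_le_ae (Lsq_hart Lf) Lk L2f Ls (hart_le_ampl Lf) kb)).
rewrite (ipZl _ Laf Ls) (ipDr Lr Lro Laf).
have -> : ip mu (ampl f) (fun x => (ampl g \o reflect xi) (opp2 x)) = ip mu (ampl f) (ampl g \o reflect xi).
  transitivity (ip mu (fun x => ampl f (opp2 x)) (fun x => (ampl g \o reflect xi) (opp2 x))).
    apply: (@eq_ae_ip _ (plane R) R mu _ _ _ Laf (Lsq_opp2 Laf) Lro).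
    by apply: ae2_imp (ampl_even Lf) => eta.
  exact: (@ip_reflect R (0, 0) _ _ (Lsq_meas Laf) (Lsq_meas Lr)).
by rewrite /conv ipC; lra.
Qed.

(** The real and imaginary parts are scalar products of [f] with [g] times a cosine or a sine.
    Parseval's identity moves them to the transform side, where each is at most 4 / [c2pi] times the
    convolution. *)
Lemma fourier1_mul_le f g xi : Lsq mu f -> Lsq mu g ->
  normc (fourier1 (f \* g) xi) <= 8 / c2pi R * conv (ampl g) (ampl f) xi.
Proof.
move=> Lf Lg; have c0 := c2pi_gt0 R.
apply: (le_trans (le_normc _)).
have eR : complex.Re (fourier1 (f \* g) xi) = ip mu f (modc xi g).
  by apply: eq_Rintegral => x _ /=; rewrite /modc cosN; ring.
have eI : complex.Im (fourier1 (f \* g) xi) = ip mu f (fun x => -1 * mods xi g x).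
  by apply: eq_Rintegral => x _ /=; rewrite /mods sinN; ring.
have Lc := Lsq_modc xi Lg; have Ls := Lsq_mods xi Lg.
rewrite eR eI (ipZr _ Lf Ls) mulN1r normrN.
have b1 : `|ip mu (hart f) (hart (modc xi g))| <= 4 * conv (ampl g) (ampl f) xi.
  apply: (ip_hart_le_conv Lf Lg (Lsq_hart Lc)); left.
  apply: ae2_imp (hart_modc xi Lg) => eta ->.
  by rewrite normrM ger0_norm ?invr_ge0// ler_wpM2l ?invr_ge0// ler_normD.
have b2 : `|ip mu (hart f) (hart (mods xi g))| <= 4 * conv (ampl g) (ampl f) xi.
  apply: (ip_hart_le_conv Lf Lg (Lsq_hart Ls)); right.
  apply: ae2_imp (hart_mods xi Lg) => eta ->.
  rewrite normrM ger0_norm ?invr_ge0// ler_wpM2l ?invr_ge0// mulN1r.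
  exact: ler_normB.
rewrite (hart_parseval Lf Lc) in b1; rewrite (hart_parseval Lf Ls) in b2.
rewrite normrM (gtr0_norm c0) in b1; rewrite normrM (gtr0_norm c0) in b2.
rewrite -(ler_pM2l c0) mulrA [_ * (8 / _)]mulrC divfK ?gt_eqF// mulrDr.
lra.
Qed.

Lemma conv_le u v u' v' xi : Lsq mu u -> Lsq mu v -> Lsq mu u' -> Lsq mu v' ->
  {ae mu, forall x, `|u x| <= u' x} -> {ae mu, forall x, `|v x| <= v' x} ->
  `|conv u v xi| <= conv u' v' xi.
Proof.
move=> Lu Lv Lu' Lv' uu vv.
by apply: ip_le_ae; [exact: Lsq_reflect|by []|exact: Lsq_reflect|by []|exact: (ae_reflect xi uu)|by []].
Qed.

Lemma L2C_normc F : mfun2 R (fun xi => complex.Re (F xi)) ->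
  mfun2 R (fun xi => complex.Im (F xi)) -> Lsq mu (fun xi => normc (F xi)) -> L2C F.
Proof.
move=> mr mi Ln; split; apply/L2P.
- apply: (Lsq_le mr Ln) => xi; rewrite (ger0_norm (normc_ge0 _)).
  by rewrite -(@ler_pXn2r _ 2)// ?nnegrE ?normc_ge0// normc_sqr real_normK ?num_real// lerDl sqr_ge0.
- apply: (Lsq_le mi Ln) => xi; rewrite (ger0_norm (normc_ge0 _)).
  by rewrite -(@ler_pXn2r _ 2)// ?nnegrE ?normc_ge0// normc_sqr real_normK ?num_real// lerDr sqr_ge0.
Qed.

(** The symmetry of the symbol keeps the product with a Hermitian transform Hermitian, so it comes
    from a real function. *)
Lemma multiplier_exists m f : Lsq mu f ->
  mfun2 R (fun xi => complex.Re (m xi)) -> mfun2 R (fun xi => complex.Im (m xi)) ->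
  (forall xi, complex.Re (m (opp2 xi)) = complex.Re (m xi)) ->
  (forall xi, complex.Im (m (opp2 xi)) = - complex.Im (m xi)) ->
  Lsq mu (fun xi => normc (m xi) * ampl f xi) ->
  exists g, is_multiplier m f g.
Proof.
move=> Lf mr mi er ei La.
have [[/L2P LR /L2P LI] _] := fourierP Lf.
pose F xi := m xi * fourier f xi.
have reF xi : complex.Re (F xi) = complex.Re (m xi) * complex.Re (fourier f xi) - complex.Im (m xi) * complex.Im (fourier f xi).
  by rewrite /F; case: (m xi) => a b; case: (fourier f xi).
have imF xi : complex.Im (F xi) = complex.Re (m xi) * complex.Im (fourier f xi) + complex.Im (m xi) * complex.Re (fourier f xi).
  by rewrite /F; case: (m xi) => a b; case: (fourier f xi).
have mRF : mfun2 R (fun xi => complex.Re (F xi)).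
  rewrite (funext reF); apply: measurable_funB; apply: measurable_funM => //.
    exact: Lsq_meas LR.
  exact: Lsq_meas LI.
have mIF : mfun2 R (fun xi => complex.Im (F xi)).
  rewrite (funext imF); apply: measurable_funD; apply: measurable_funM => //.
    exact: Lsq_meas LI.
  exact: Lsq_meas LR.
have LF : L2C F.
  apply: L2C_normc => //; move: La; congr Lsq; apply/funext => xi.
  by rewrite /F Normc.normcM.
have [|g Lg eg] := fourier_onto_hermitian LF.
  have h := fourier_hart Lf; have h' := ae_reflect (0, 0) h.
  apply: ae2_imp (ae2_and h h') => xi [h1 h2].
  rewrite !reF !imF er ei h1 [fourier f (opp2 xi)]h2 /= -/(opp2 xi) opp2K.
  by split; field.
by exists g; split; [exact/L2P|].
Qed.

Lemma is_multiplierP m f : (exists g, is_multiplier m f g) -> is_multiplier m f (multiplier m f).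
Proof. by move=> [g hg]; rewrite /multiplier; case: xgetP => [h -> //|/(_ g)]. Qed.

Lemma Lsq_multiplier m f g : is_multiplier m f g -> Lsq mu g.
Proof. by move=> [/L2P]. Qed.

Lemma ampl_multiplier m f g : is_multiplier m f g ->
  {ae mu, forall xi, ampl g xi = normc (m xi) * ampl f xi}.
Proof. by move=> [_ h]; apply: ae2_imp h => xi; rewrite /ampl => ->; rewrite Normc.normcM. Qed.

Definition symbol1 xi : R[i] := (0 -i* (xi.2 / norm2 xi))%C.
Definition symbol2 xi : R[i] := (0 +i* (xi.1 / norm2 xi))%C.

(** What both velocity symbols share: real output and the bound 1, which makes them contractions on
    amplitudes. *)
Definition riesz_like m := [/\ mfun2 R (fun xi => complex.Re (m xi)),
  mfun2 R (fun xi => complex.Im (m xi)),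
  forall xi, complex.Re (m (opp2 xi)) = complex.Re (m xi),
  forall xi, complex.Im (m (opp2 xi)) = - complex.Im (m xi) &
  forall xi, normc (m xi) <= 1].

Lemma norm2_opp2 xi : norm2 (opp2 xi) = norm2 xi.
Proof. by rewrite opp2E /norm2 /= !sqrrN. Qed.

Lemma ratio_le1 (a b : R) : `|a| <= b -> `|a / b| <= 1.
Proof.
move=> ab; have b0 : 0 <= b := le_trans (normr_ge0 a) ab.
(* At the zero frequency the convention 1 / 0 = 0 gives the symbol the value 0. *)
have [->|bn0] := eqVneq b 0; first by rewrite invr0 mulr0 normr0.
have bp : 0 < b by rewrite lt_neqAle eq_sym bn0.
by rewrite normrM normfV (gtr0_norm bp) ler_pdivrMr// mul1r.
Qed.

Lemma riesz_like_symbol1 : riesz_like symbol1.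
Proof.
split => [|||xi|xi] //=.
- apply: measurable_funN; apply: measurable_funM; first exact: (@measurable_snd _ _ (line R) (line R)).
  exact: (measurableT_comp (@measurable_inv R) (@measurable_norm2 R)).
- by rewrite norm2_opp2; ring.
- by rewrite expr0n/= add0r sqrtr_sqr normrN ratio_le1// le_norm2_2.
Qed.

Lemma riesz_like_symbol2 : riesz_like symbol2.
Proof.
split => [|||xi|xi] //=.
- apply: measurable_funM; first exact: (@measurable_fst _ _ (line R) (line R)).
  exact: (measurableT_comp (@measurable_inv R) (@measurable_norm2 R)).
- by rewrite norm2_opp2; ring.
- by rewrite expr0n/= add0r sqrtr_sqr ratio_le1// le_norm2_1.
Qed.

Lemma riesz_multiplier m f : riesz_like m -> Lsq mu f -> is_multiplier m f (multiplier m f).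
Proof.
move=> [mr mi er ei m1] Lf; apply/is_multiplierP/multiplier_exists => //.
apply: (Lsq_le _ (Lsq_ampl Lf)).
  by apply: measurable_funM; [exact: measurable_normc|exact: measurable_ampl].
by move=> xi; rewrite normrM (ger0_norm (normc_ge0 _)) ler_piMl.
Qed.

Lemma riesz_ampl_le m f : riesz_like m -> Lsq mu f ->
  {ae mu, forall xi, `|ampl (multiplier m f) xi| <= ampl f xi}.
Proof.
move=> rm Lf; have [_ _ _ _ m1] := rm.
apply: ae2_imp (ampl_multiplier (riesz_multiplier rm Lf)) => xi h.
by rewrite (ger0_norm (ampl_ge0 _ _)) h ler_piMl// ampl_ge0.
Qed.

(** [multiplier m] chooses a representative for each argument, so its linearity is recovered almost
    everywhere on the transform side. *)
Lemma riesz_dist_le m f g : riesz_like m -> Lsq mu f -> Lsq mu g ->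
  ip mu (fun x => multiplier m f x - multiplier m g x) (fun x => multiplier m f x - multiplier m g x)
  <= ip mu (fun x => f x - g x) (fun x => f x - g x).
Proof.
move=> rm Lf Lg; have [_ _ _ _ m1] := rm; have c0 := c2pi_gt0 R.
have mf := riesz_multiplier rm Lf; have mg := riesz_multiplier rm Lg.
have Lmf := Lsq_multiplier mf; have Lmg := Lsq_multiplier mg.
have Ld := LsqB Lf Lg; have Lmd := LsqB Lmf Lmg.
rewrite -(ler_pM2l c0) -(ip_ampl Ld) -(ip_ampl Lmd).
have h : {ae mu, forall xi, `|ampl (fun x => multiplier m f x - multiplier m g x) xi| <= ampl (fun x => f x - g x) xi}.
  have [_ e1] := mf; have [_ e2] := mg.
  apply: ae2_imp (ae2_and (ae2_and e1 e2) (ae2_and (fourierB Lf Lg) (fourierB Lmf Lmg))).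
  move=> xi [[a1 a2] [a3 a4]].
  have c1 : fourier (fun x => multiplier m f x - multiplier m g x) xi = m xi * fourier (fun x => f x - g x) xi.
    apply: (etrans a4); apply: (etrans (congr2 (fun p q => p - q) a1 a2)).
    exact: (etrans (esym (mulrBr _ _ _)) (congr1 (fun z => m xi * z) (esym a3))).
  have c2 : ampl (fun x => multiplier m f x - multiplier m g x) xi = normc (m xi) * ampl (fun x => f x - g x) xi.
    by rewrite /ampl c1 Normc.normcM.
  by rewrite c2 ger0_norm ?mulr_ge0 ?normc_ge0// ler_piMl// normc_ge0.
apply: (le_trans (ler_norm _)); apply: ip_le_ae => //; exact: Lsq_ampl.
Qed.

Lemma Lsq_velocity1 f : Lsq mu f -> Lsq mu (velocity1 f).
Proof. by move=> Lf; exact: Lsq_multiplier (riesz_multiplier riesz_like_symbol1 Lf). Qed.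

Lemma Lsq_velocity2 f : Lsq mu f -> Lsq mu (velocity2 f).
Proof. by move=> Lf; exact: Lsq_multiplier (riesz_multiplier riesz_like_symbol2 Lf). Qed.

Lemma normc_i (a : R) : normc (0 +i* a)%C = `|a|.
Proof. by rewrite /= expr0n/= add0r sqrtr_sqr. Qed.

(** Each of the two components contributes 8 / [c2pi] times |xi|; the velocities enter only through
    the domination of their amplitudes by that of [f]. *)
Lemma div_flux_le f xi : Lsq mu f ->
  normc (div_flux_hat f xi) <= 16 / c2pi R * norm2 xi * conv (ampl f) (ampl f) xi.
Proof.
move=> Lf; have Laf := Lsq_ampl Lf; have c0 := c2pi_gt0 R.
have key v : Lsq mu v -> {ae mu, forall xi, `|ampl v xi| <= ampl f xi} ->
    normc (fourier1 (f \* v) xi) <= 8 / c2pi R * conv (ampl f) (ampl f) xi.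
  move=> Lv hv; apply: (le_trans (fourier1_mul_le xi Lf Lv)).
  apply: ler_wpM2l; first by rewrite divr_ge0// ltW.
  have h : {ae mu, forall xi, `|ampl f xi| <= ampl f xi}.
    by apply: aeW => x; rewrite ger0_norm// ampl_ge0.
  have h2 := @conv_le _ _ _ _ xi (Lsq_ampl Lv) Laf Laf Laf hv h.
  by apply: le_trans h2; exact: ler_norm.
have k1 := key _ (Lsq_velocity1 Lf) (riesz_ampl_le riesz_like_symbol1 Lf).
have k2 := key _ (Lsq_velocity2 Lf) (riesz_ampl_le riesz_like_symbol2 Lf).
rewrite /div_flux_hat; clear key.
move: (fourier1 (f \* velocity1 f) xi) (fourier1 (f \* velocity2 f) xi) (conv (ampl f) (ampl f) xi) k1 k2 => F1 F2 cv k1 k2.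
apply: (le_trans (le_normcD _ _)).
rewrite !Normc.normcM !normc_i.
have -> : 16 / c2pi R * norm2 xi * cv = norm2 xi * (8 / c2pi R * cv) + norm2 xi * (8 / c2pi R * cv).
  by ring.
by apply: lerD; apply: ler_pM => //; [exact: normc_ge0|exact: le_norm2_1|exact: normc_ge0|exact: le_norm2_2].
Qed.

Lemma flux_part_cvg (u_ v_ : nat -> R * R -> R) u v xi : (forall n, Lsq mu (u_ n)) ->
  (forall n, Lsq mu (v_ n)) -> Lsq mu u -> Lsq mu v -> cvgL2 mu u_ u -> cvgL2 mu v_ v ->
  (fun n => complex.Re (fourier1 (u_ n \* v_ n) xi)) @ \oo --> complex.Re (fourier1 (u \* v) xi) /\
  (fun n => complex.Im (fourier1 (u_ n \* v_ n) xi)) @ \oo --> complex.Im (fourier1 (u \* v) xi).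
Proof.
move=> Lun Lvn Lu Lv cu cv.
have eR f g : complex.Re (fourier1 (f \* g) xi) = ip mu f (modc xi g).
  by apply: eq_Rintegral => x _ /=; rewrite /modc cosN; ring.
have eI f g : complex.Im (fourier1 (f \* g) xi) = ip mu f (fun x => -1 * mods xi g x).
  by apply: eq_Rintegral => x _ /=; rewrite /mods sinN; ring.
have bnd (b : R * R -> R) : mfun2 R b -> (forall x, `|b x| <= 1) ->
    cvgL2 mu (fun n x => v_ n x * b x) (fun x => v x * b x).
  move=> mb b1; apply: (squeeze_cvgr _ (cvg_cst 0) cv).
  apply: nearW => n; rewrite ip_ge0/=; have Ld := LsqB (Lvn n) Lv.
  apply: (le_trans (ler_norm _)).
  have -> : ip mu (fun x => v_ n x - v x) (fun x => v_ n x - v x) = ip mu (fun x => `|v_ n x - v x|) (fun x => `|v_ n x - v x|).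
    by apply: eq_Rintegral => x _; rewrite -!expr2 real_normK ?num_real.
  have Lb := LsqB (Lsq_mul_bounded1 mb b1 (Lvn n)) (Lsq_mul_bounded1 mb b1 Lv).
  have h : {ae mu, forall x, `|v_ n x * b x - v x * b x| <= `|v_ n x - v x|}.
    by apply: aeW => x; rewrite -mulrBl normrM ler_piMr.
  by apply: ip_le_ae => //; exact: Lsq_norm.
split.
- rewrite eR (_ : (fun n => _) = (fun n => ip mu (u_ n) (modc xi (v_ n)))); last by apply/funext => n; rewrite eR.
  apply: cvgL2_ip2 => //; [by move=> n; exact: Lsq_modc|exact: Lsq_modc|].
  by apply: bnd; [exact: measurable_cos_dot|move=> x; exact: cos_le1_norm].
- rewrite eI (_ : (fun n => _) = (fun n => ip mu (u_ n) (fun x => -1 * mods xi (v_ n) x))); last by apply/funext => n; rewrite eI.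
  apply: cvgL2_ip2 => //; [by move=> n; exact/LsqZ/Lsq_mods|exact/LsqZ/Lsq_mods|].
  apply: cvgL2Z; [by move=> n; exact: Lsq_mods|exact: Lsq_mods|].
  by apply: bnd; [exact: measurable_sin_dot|move=> x; exact: sin_le1_norm].
Qed.

Lemma riesz_cvg m (u_ : nat -> R * R -> R) u : riesz_like m -> (forall n, Lsq mu (u_ n)) -> Lsq mu u ->
  cvgL2 mu u_ u -> cvgL2 mu (fun n => multiplier m (u_ n)) (multiplier m u).
Proof.
move=> rm Lun Lu cu; apply: (squeeze_cvgr _ (cvg_cst 0) cu).
by apply: nearW => n; rewrite ip_ge0/= riesz_dist_le.
Qed.

Lemma div_fluxE f xi :
  complex.Re (div_flux_hat f xi) = - (xi.1 * complex.Im (fourier1 (f \* velocity1 f) xi))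
     - xi.2 * complex.Im (fourier1 (f \* velocity2 f) xi) /\
  complex.Im (div_flux_hat f xi) = xi.1 * complex.Re (fourier1 (f \* velocity1 f) xi)
     + xi.2 * complex.Re (fourier1 (f \* velocity2 f) xi).
Proof.
rewrite /div_flux_hat; case: (fourier1 _ _) => a b; case: (fourier1 _ _) => c e /=.
by split; ring.
Qed.

(** Convergence at every frequency, not just almost everywhere; the joint measurability of the flux
    is derived from it by sampling in time. *)
Lemma div_flux_cvg (u_ : nat -> R * R -> R) u xi : (forall n, Lsq mu (u_ n)) -> Lsq mu u ->
  cvgL2 mu u_ u ->
  (fun n => complex.Re (div_flux_hat (u_ n) xi)) @ \oo --> complex.Re (div_flux_hat u xi) /\
  (fun n => complex.Im (div_flux_hat (u_ n) xi)) @ \oo --> complex.Im (div_flux_hat u xi).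
Proof.
move=> Lun Lu cu.
have [a1 a2] := flux_part_cvg xi Lun (fun n => Lsq_velocity1 (Lun n)) Lu (Lsq_velocity1 Lu) cu
  (riesz_cvg riesz_like_symbol1 Lun Lu cu).
have [b1 b2] := flux_part_cvg xi Lun (fun n => Lsq_velocity2 (Lun n)) Lu (Lsq_velocity2 Lu) cu
  (riesz_cvg riesz_like_symbol2 Lun Lu cu).
split.
- rewrite (_ : (fun n => _) = (fun n => - (xi.1 * complex.Im (fourier1 (u_ n \* velocity1 (u_ n)) xi))
     - xi.2 * complex.Im (fourier1 (u_ n \* velocity2 (u_ n)) xi))); last first.
    by apply/funext => n; have [-> _] := div_fluxE (u_ n) xi.
  have [-> _] := div_fluxE u xi.
  exact: (cvgB (cvgN (cvgMl_tmp a2)) (cvgMl_tmp b2)).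
- rewrite (_ : (fun n => _) = (fun n => xi.1 * complex.Re (fourier1 (u_ n \* velocity1 (u_ n)) xi)
     + xi.2 * complex.Re (fourier1 (u_ n \* velocity2 (u_ n)) xi))); last first.
    by apply/funext => n; have [_ ->] := div_fluxE (u_ n) xi.
  have [_ ->] := div_fluxE u xi.
  exact: (cvgD (cvgMl_tmp a1) (cvgMl_tmp b1)).
Qed.

Lemma measurable_div_flux f : Lsq mu f ->
  mfun2 R (fun xi => complex.Re (div_flux_hat f xi)) /\ mfun2 R (fun xi => complex.Im (div_flux_hat f xi)).
Proof.
move=> Lf.
have mp v : Lsq mu v -> mfun2 R (fun xi => complex.Re (fourier1 (f \* v) xi)) /\
    mfun2 R (fun xi => complex.Im (fourier1 (f \* v) xi)).
  move=> Lv; have fi : mu.-integrable setT (EFin \o (f \* v)) by exact: Lsq_mul.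
  have mh : mfun2 R (hart1 (f \* v)).
    by apply: measurable_hart1; exact: (measurable_funM (Lsq_meas Lf) (Lsq_meas Lv)).
  have mo := measurable_opp2 mh.
  have e xi : fourier1 (f \* v) xi = herm (hart1 (f \* v)) xi by exact: fourier1_herm.
  split.
  - rewrite (_ : (fun xi => _) = (fun xi => complex.Re (herm (hart1 (f \* v)) xi))); last by apply/funext => xi; rewrite e.
    by apply: measurable_funM => //; exact: measurable_funD.
  - rewrite (_ : (fun xi => _) = (fun xi => complex.Im (herm (hart1 (f \* v)) xi))); last by apply/funext => xi; rewrite e.
    by apply: measurable_funN; apply: measurable_funM => //; exact: measurable_funB.
have [a1 a2] := mp _ (Lsq_velocity1 Lf); have [b1 b2] := mp _ (Lsq_velocity2 Lf).
have m1 := @measurable_fst _ _ (line R) (line R); have m2 := @measurable_snd _ _ (line R) (line R).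
split.
- rewrite (_ : (fun xi => _) = (fun xi => - (xi.1 * complex.Im (fourier1 (f \* velocity1 f) xi))
     - xi.2 * complex.Im (fourier1 (f \* velocity2 f) xi))); last first.
    by apply/funext => xi; have [-> _] := div_fluxE f xi.
  exact: (measurable_funB (measurable_funN (measurable_funM m1 a2)) (measurable_funM m2 b2)).
- rewrite (_ : (fun xi => _) = (fun xi => xi.1 * complex.Re (fourier1 (f \* velocity1 f) xi)
     + xi.2 * complex.Re (fourier1 (f \* velocity2 f) xi))); last first.
    by apply/funext => xi; have [_ ->] := div_fluxE f xi.
  exact: (measurable_funD (measurable_funM m1 a1) (measurable_funM m2 b1)).
Qed.

End Products.

(** * Weights *)

Section Weights.
Context (R : realType).
Implicit Types (x y a p r t z : R) (xi eta zeta : R * R).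

Lemma le_of_eq x y : x = y -> x <= y.
Proof. by move=> ->. Qed.

Lemma is_derive_powR (c : R) (f : R -> R) x (df : R) : is_derive x 1 f df -> 0 < f x ->
  is_derive x 1 (fun t => f t `^ c) (c * f x `^ (c - 1) * df).
Proof. by move=> df_ fx; have h := is_derive1_powR c fx; apply: is_derive1_comp. Qed.

Lemma powR_le1 (c x : R) : 0 <= c -> 0 <= x <= 1 -> x `^ c <= 1.
Proof.
move=> c0 /andP[x0 x1]; have e : 1 `^ c = 1 :> R by rewrite powR1.
by rewrite -[leRHS]e; apply: ge0_ler_powR; rewrite ?nnegrE.
Qed.

(** For 0 <= u <= x + y the ratio u / (x + y) is at most its own power a, since a <= 1. Adding this
    for u = x and u = y gives the claim. *)
Lemma powR_subadd a x y : 0 < a <= 1 -> 0 <= x -> 0 <= y -> (x + y) `^ a <= x `^ a + y `^ a.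
Proof.
move=> /andP[a0 a1] x0 y0; have [e|n0] := eqVneq (x + y) 0.
  by rewrite e powR0 ?gt_eqF// addr_ge0 ?powR_ge0.
have s0 : 0 < x + y by rewrite lt_neqAle eq_sym n0 addr_ge0.
have key u : 0 <= u -> u <= x + y -> u * (x + y) `^ a <= (x + y) * u `^ a.
  move=> u0 ux; have [->|un0] := eqVneq u 0; first by rewrite mul0r mulr_ge0 ?powR_ge0 ?ltW.
  have up : 0 < u by rewrite lt_neqAle eq_sym un0.
  have ru : 0 < u / (x + y) <= 1 by rewrite divr_gt0//= ler_pdivrMr// mul1r.
  have h := ger1_powR ru a1.
  have e : u `^ a = (u / (x + y)) `^ a * (x + y) `^ a by rewrite -powRM ?divr_ge0 ?ltW// divfK ?gt_eqF.
  rewrite e mulrA ler_wpM2r ?powR_ge0// -[leLHS](@divfK _ (x + y)) ?gt_eqF//.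
  by rewrite mulrC ler_wpM2l// ltW.
rewrite -(ler_pM2l s0) mulrDl mulrDr lerD//; [apply: key|apply: key] => //; by rewrite ?lerDl ?lerDr.
Qed.

(** The square of the usual bracket of xi; H^s thus corresponds to the weight [jb ^ (s / 2)] on the
    amplitude. *)
Definition jb xi := 1 + norm2 xi ^+ 2.

Lemma jbE xi : jb xi = 1 + (xi.1 ^+ 2 + xi.2 ^+ 2).
Proof. by rewrite /jb norm2_sqr. Qed.

Lemma jb_ge1 xi : 1 <= jb xi.
Proof. by rewrite /jb lerDl sqr_ge0. Qed.

Lemma jb_gt0 xi : 0 < jb xi.
Proof. exact: lt_le_trans ltr01 (jb_ge1 xi). Qed.

Lemma measurable_jb : mfun2 R jb.
Proof.
rewrite (funext jbE); apply: measurable_funD => //.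
apply: measurable_funD; apply: measurable_funX.
- exact: (@measurable_fst _ _ (line R) (line R)).
- exact: (@measurable_snd _ _ (line R) (line R)).
Qed.

Lemma measurable_jb_pow a : mfun2 R (fun xi => jb xi `^ a).
Proof. exact: (measurableT_comp (measurable_powR a) measurable_jb). Qed.

Lemma jb_add_le xi eta : jb xi <= 2 * (jb (reflect xi eta) + jb eta).
Proof.
rewrite !jbE /reflect /=; have := sqr_ge0 (xi.1 - eta.1 - eta.1); have := sqr_ge0 (xi.2 - eta.2 - eta.2); nra.
Qed.

(** Bounding the sum by twice the larger bracket before taking the power treats a <= 1 and a >= 1
    alike; this is the origin of 4 = 2 * 2. *)
Lemma jb_pow_add_le a xi eta : 0 <= a ->
  jb xi `^ a <= 4 `^ a * (jb (reflect xi eta) `^ a + jb eta `^ a).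
Proof.
move=> a0.
have h u v : 0 <= u -> 0 <= v -> u <= v -> (2 * (u + v)) `^ a <= 4 `^ a * (u `^ a + v `^ a).
  move=> u0 v0 uv; apply: (@le_trans _ _ ((4 * v) `^ a)).
    by apply: ge0_ler_powR; rewrite ?nnegrE ?mulr_ge0 ?addr_ge0//; lra.
  by rewrite powRM// ler_wpM2l ?powR_ge0// lerDr powR_ge0.
apply: (@le_trans _ _ ((2 * (jb (reflect xi eta) + jb eta)) `^ a)).
  apply: ge0_ler_powR; rewrite ?nnegrE ?mulr_ge0 ?addr_ge0 ?sqr_ge0// ?(ltW (jb_gt0 _))//.
  exact: jb_add_le.
have [le|le] := leP (jb (reflect xi eta)) (jb eta).
  exact: h (ltW (jb_gt0 _)) (ltW (jb_gt0 _)) le.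
by rewrite addrC [in leRHS]addrC; exact: h (ltW (jb_gt0 _)) (ltW (jb_gt0 _)) (ltW le).
Qed.

Lemma norm2_le_jb xi : norm2 xi <= jb xi `^ 2^-1.
Proof.
rewrite powR12_sqrt ?(ltW (jb_gt0 _))// -{1}(ger0_norm (norm2_ge0 xi)) -sqrtr_sqr ler_wsqrtr//.
by rewrite /jb lerDr.
Qed.

(** Since the exponents are negative, replacing the larger bracket by the smaller one increases the
    product. Mixed decay at two points is thus bounded by full decay at one of them. *)
Lemma jb_pow_mul_le (k s : R) xi eta : 0 <= k -> 0 <= s ->
  jb xi `^ (- k) * jb eta `^ (- s) <= jb xi `^ (- (k + s)) + jb eta `^ (- (k + s)).
Proof.
move=> k0 s0.
have nn u (v : R * R) : 0 <= jb v `^ u by exact: powR_ge0.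
have sp u v (w : R * R) : jb w `^ (- (u + v)) = jb w `^ (- u) * jb w `^ (- v).
  by rewrite opprD powRD// (gt_eqF (jb_gt0 _)) implybT.
have mon u (v w : R * R) : 0 <= u -> jb v <= jb w -> jb w `^ (- u) <= jb v `^ (- u).
  move=> u0 vw; rewrite !powRN lef_pV2 ?posrE ?powR_gt0 ?jb_gt0//.
  by apply: ge0_ler_powR; rewrite ?nnegrE ?(ltW (jb_gt0 _)).
have [le|le] := leP (jb xi) (jb eta).
  rewrite (sp k s xi); apply: (@le_trans _ _ (jb xi `^ (- k) * jb xi `^ (- s))).
    by rewrite ler_wpM2l// mon.
  by rewrite lerDl.
rewrite (sp k s eta); apply: (@le_trans _ _ (jb eta `^ (- k) * jb eta `^ (- s))).
  by rewrite ler_wpM2r// mon// ltW.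
by rewrite lerDr.
Qed.

Lemma measurable_aniso a b : mfun2 R (aniso a b).
Proof.
have h (c : R) (f : R * R -> R) : mfun2 R f -> mfun2 R (fun xi => `|f xi| `^ c).
  move=> mf; exact: (measurableT_comp (measurable_powR c) (measurableT_comp (@normr_measurable R setT) mf)).
apply: measurable_funD; apply: h.
- exact: (@measurable_fst _ _ (line R) (line R)).
- exact: (@measurable_snd _ _ (line R) (line R)).
Qed.

Lemma aniso_ge0 a b xi : 0 <= aniso a b xi.
Proof. by rewrite addr_ge0 ?powR_ge0. Qed.

Lemma aniso_opp2 a b xi : aniso a b (opp2 xi) = aniso a b xi.
Proof. by rewrite /aniso opp2E /= !normrN. Qed.

(** Each coordinate uses 2 x <= x^2 / 2 + 2, that is (x - 2)^2 >= 0. *)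
Lemma aniso_double a b xi : 2 * aniso a b xi <= aniso (2 * a) (2 * b) xi / 2 + 4.
Proof.
have e u x : 0 <= x -> x `^ (2 * u) = (x `^ u) ^+ 2.
  by move=> x0; rewrite mulrC powRrM powR_mulrn ?powR_ge0.
rewrite /aniso !e//.
have := sqr_ge0 (`|xi.1| `^ a - 2); have := sqr_ge0 (`|xi.2| `^ b - 2); nra.
Qed.

Lemma aniso_subadd a b xi eta : 0 < a <= 1 -> 0 < b <= 1 ->
  aniso a b xi <= aniso a b (reflect xi eta) + aniso a b eta.
Proof.
move=> ha hb.
have h c x y : 0 < c <= 1 -> `|x| `^ c <= `|x - y| `^ c + `|y| `^ c.
  move=> hc; apply: (le_trans _ (powR_subadd hc (normr_ge0 _) (normr_ge0 _))).
  case/andP: hc => c0 _.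
  apply: ge0_ler_powR; rewrite ?nnegrE ?addr_ge0 ?normr_ge0//; first exact: ltW.
  by apply: le_trans (ler_normD _ _); rewrite subrK.
have := h a xi.1 eta.1 ha; have := h b xi.2 eta.2 hb.
rewrite /aniso /reflect /=; lra.
Qed.

(** By subadditivity [jb ^ a] is at most 1 plus the two powers (xi_i^2)^a. Passing to the larger
    exponents alpha and beta costs another 1 per coordinate, for |xi_i| < 1; in total 3. *)
Lemma aniso_lower (a alpha beta : R) xi : 0 < a <= 1 -> a <= alpha -> a <= beta ->
  jb xi `^ a - 3 <= aniso (2 * alpha) (2 * beta) xi.
Proof.
move=> ha aa ab; have /andP[a0 a1] := ha.
have h c x : a <= c -> (x ^+ 2) `^ a - 1 <= `|x| `^ (2 * c).
  move=> ac; rewrite -real_normK ?num_real// -powR_mulrn// -powRrM.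
  have [x1|x1] := leP 1 `|x|.
    by apply: (@le_trans _ _ (`|x| `^ (2 * a))); [lra|rewrite ler_powR// ler_wpM2l].
  apply: (@le_trans _ _ 0); last exact: powR_ge0.
  by rewrite subr_le0; apply: powR_le1; [rewrite mulr_ge0// ltW|rewrite normr_ge0 ltW].
have h1 := h alpha xi.1 aa; have h2 := h beta xi.2 ab.
have h3 := powR_subadd ha ler01 (addr_ge0 (sqr_ge0 xi.1) (sqr_ge0 xi.2)).
have h4 := powR_subadd ha (sqr_ge0 xi.1) (sqr_ge0 xi.2).
rewrite powR1 in h3; rewrite jbE /aniso; lra.
Qed.

(** For p <= 1 one has z^p <= 1 + z <= 2 exp (z / 2). *)
Lemma exp_half_decay z p : 0 < p <= 1 -> 0 < z -> expR (- (z / 2)) <= 2 * z `^ (- p).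
Proof.
move=> /andP[p0 p1] z0; rewrite powRN expRN.
have h : z `^ p <= 2 * expR (z / 2).
  have e1 := expR_ge1Dx (z / 2).
  apply: (@le_trans _ _ (1 + z)); last lra.
  have [z1|z1] := leP 1 z; first by apply: le_trans (ler1_powR z1 p1) _; lra.
  apply: (@le_trans _ _ 1); last lra.
  by apply: powR_le1; [exact: ltW|rewrite !ltW].
rewrite -[leRHS]mulrC ler_pdivlMl ?powR_gt0// -ler_pdivlMr ?invr_gt0 ?expR_gt0// invrK.
exact: h.
Qed.

(* Half of the dissipation pays for the derivative in the flux, at the cost of the
   integrable singularity r^(-p), and leaves the decay needed in conv_weighted. *)
Lemma dissipation_decay (a alpha beta p r : R) xi : 0 < a <= 1 -> a <= alpha -> a <= beta ->
  0 < p <= 1 -> 0 < r <= 1 ->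
  r `^ p * (expR (- (r * (aniso (2 * alpha) (2 * beta) xi / 2))) * norm2 xi) <=
  2 * expR 2 * jb xi `^ (- ((2 * a * p - 1) / 2)).
Proof.
move=> ha aa ab hp /andP[r0 r1]; have /andP[p0 p1] := hp.
have j0 := jb_gt0 xi.
have z0 : 0 < r * jb xi `^ a by rewrite mulr_gt0// powR_gt0.
(* The loss 3 in [aniso_lower] costs exp (3 r / 2), which is at most exp 2 as r <= 1. *)
have h1 : expR (- (r * (aniso (2 * alpha) (2 * beta) xi / 2))) <= expR 2 * expR (- ((r * jb xi `^ a) / 2)).
  rewrite -expRD ler_expR; have h := aniso_lower xi ha aa ab.
  have : r * (jb xi `^ a - 3) <= r * aniso (2 * alpha) (2 * beta) xi by rewrite ler_wpM2l// ltW.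
  by move: (aniso _ _ _) (jb xi `^ a) => A J; nra.
have h2 := exp_half_decay hp z0.
have h3 : expR (- (r * (aniso (2 * alpha) (2 * beta) xi / 2))) <= 2 * expR 2 * (r `^ (- p) * jb xi `^ (- (a * p))).
  apply: (le_trans h1); apply: (@le_trans _ _ (expR 2 * (2 * (r * jb xi `^ a) `^ (- p)))).
    by rewrite ler_wpM2l// expR_ge0.
  rewrite (powRM _ (ltW r0) (powR_ge0 _ _)) -powRrM mulrN.
  by apply: le_of_eq; ring.
apply: (@le_trans _ _ (r `^ p * (2 * expR 2 * (r `^ (- p) * jb xi `^ (- (a * p))) * jb xi `^ 2^-1))).
  rewrite ler_wpM2l ?powR_ge0// ler_pM ?expR_ge0 ?norm2_ge0//; exact: norm2_le_jb.
(* The decay - a p comes from the dissipation, the 1/2 is the price of |xi| <= [jb ^ (1/2)]. *)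
have -> : - ((2 * a * p - 1) / 2) = - (a * p) + 2^-1 by field.
rewrite powRD ?(gt_eqF j0) ?implybT// powRN.
have rp : r `^ p != 0 by rewrite gt_eqF// powR_gt0.
move: (r `^ p) (jb xi `^ (- (a * p))) (jb xi `^ 2^-1) (expR 2) rp => P J K E0 P0.
by apply: le_of_eq; field.
Qed.

Section CappedWeight.
Context (a b : R).
Let Phi := aniso a b.

(* The Gevrey weight exp (2 t Phi), capped so that all norms are finite a priori; the cap
   preserves submultiplicativity, and doubling it at most doubles the weight. *)
Definition capw (N t : R) xi := Num.min (expR (2 * t * Phi xi)) N.

Lemma measurable_capw N t : mfun2 R (capw N t).
Proof.
apply: measurable_minr => //; apply: (measurableT_comp (@measurable_expR R)).
by apply: measurable_funM => //; exact: measurable_aniso.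
Qed.

Lemma capw_ge0 N t xi : 0 <= N -> 0 <= capw N t xi.
Proof. by move=> N0; rewrite le_min expR_ge0. Qed.

Lemma capw_le_exp N t xi : capw N t xi <= expR (2 * t * Phi xi).
Proof. by rewrite ge_min lexx. Qed.

Lemma capw_le_cap N t xi : capw N t xi <= N.
Proof. by rewrite ge_min lexx orbT. Qed.

(** If one factor on the right is capped, it already equals N and the other is at least 1; otherwise
    the subadditivity of [Phi] applies. *)
Lemma capw_submul N t xi eta : 0 < a <= 1 -> 0 < b <= 1 -> 1 <= N -> 0 <= t ->
  capw N t xi <= capw N t (reflect xi eta) * capw N t eta.
Proof.
move=> ha hb N1 t0.
have N0 : 0 <= N by exact: le_trans N1.
have e1 zeta : 1 <= expR (2 * t * Phi zeta).
  by rewrite -[leLHS]expR0 ler_expR !mulr_ge0// aniso_ge0.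
have c1 zeta : 1 <= capw N t zeta by rewrite le_min e1.
have [le|lt] := leP (expR (2 * t * Phi (reflect xi eta))) N; last first.
  apply: (le_trans (capw_le_cap N t xi)); rewrite [X in _ <= X * _]/capw (min_idPr (ltW lt)).
  by rewrite ler_peMr.
have [le'|lt'] := leP (expR (2 * t * Phi eta)) N; last first.
  apply: (le_trans (capw_le_cap N t xi)); rewrite [X in _ <= _ * X]/capw (min_idPr (ltW lt')).
  by rewrite ler_peMl.
apply: (le_trans (capw_le_exp N t xi)); rewrite /capw (min_idPl le) (min_idPl le').
by rewrite -expRD -mulrDr ler_expR ler_wpM2l ?mulr_ge0// aniso_subadd.
Qed.

(** If the weight at the earlier time is uncapped the exponentials multiply; if it is capped, the
    right side is at least N. *)
Lemma capw_time N t r xi : 0 <= N -> 0 <= r <= t ->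
  capw N t xi <= expR (2 * (t - r) * Phi xi) * capw N r xi.
Proof.
move=> N0 /andP[r0 rt].
have [le|lt] := leP (expR (2 * r * Phi xi)) N.
  rewrite [X in _ <= _ * X]/capw (min_idPl le) -expRD.
  by apply: (le_trans (capw_le_exp N t xi)); rewrite ler_expR; apply: le_of_eq; ring.
rewrite [X in _ <= _ * X]/capw (min_idPr (ltW lt)); apply: (le_trans (capw_le_cap N t xi)).
by rewrite ler_peMl// -[leLHS]expR0 ler_expR !mulr_ge0// ?subr_ge0// aniso_ge0.
Qed.

Lemma capw_double N t xi : 0 <= N -> capw (2 * N) t xi <= 2 * capw N t xi.
Proof.
move=> N0; rewrite /capw.
have [le|lt] := leP (expR (2 * t * Phi xi)) N.
  apply: (@le_trans _ _ (expR (2 * t * Phi xi))); first by rewrite ge_min lexx.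
  by have := expR_ge0 (2 * t * Phi xi); lra.
by rewrite ge_min lexx orbT.
Qed.

Lemma capw_cvg t xi : (fun k : nat => capw (2 ^+ k) t xi) @ \oo --> expR (2 * t * Phi xi).
Proof.
apply: cvg_near_cst; near=> k; rewrite /capw; apply/min_idPl.
have kk : (k.+1)%:R <= (2 : R) ^+ k.
  by rewrite -natrX ler_nat ltn_expl.
apply: le_trans kk; apply: (@le_trans _ _ k%:R); last by rewrite ler_nat.
by near: k; exact: nbhs_infty_ger.
Unshelve. all: by end_near. Qed.

End CappedWeight.

(** The kernel is singular at t, so the fundamental theorem is applied on intervals ending before t,
    and the bound passes to their increasing union. *)
Lemma integral_time_kernel p t : 0 < p < 1 -> 0 < t ->
  (\int[leb1 R]_(x in `[0%R, t[) ((t - x) `^ (- p))%:E <= (t `^ (1 - p) / (1 - p))%:E)%E.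
Proof.
move=> /andP[p0 p1] t0; have q0 : 0 < 1 - p by rewrite subr_gt0.
pose F (x : R) := - ((t - x) `^ (1 - p) / (1 - p)).
have dF x : x < t -> is_derive x 1 F ((t - x) `^ (- p)).
  move=> xt; have tx : 0 < t - x by rewrite subr_gt0.
  have d1 : is_derive x 1 (fun y : R => t - y) (0 + - 1).
    exact: is_derive_add (is_derive_const _ _) (is_derive_opp (is_derive_var _)).
  have d2 := is_derive_powR (1 - p) d1 tx.
  have d3 := is_derive_opp (is_derive_mul d2 (is_derive_const (1 - p)^-1 x)).
  apply: is_derive_eq d3 _.
  have -> : 1 - p - 1 = - p by ring.
  by rewrite /=; field; rewrite gt_eqF.
have cF x : x < t -> {for x, continuous F} by move=> xt; exact: is_derive_continuous (dF x xt).
have cf x : x < t -> {for x, continuous (fun x => (t - x) `^ (- p))}.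
  move=> xt; have tx : 0 < t - x by rewrite subr_gt0.
  have d1 : is_derive x 1 (fun y : R => t - y) (0 + - 1).
    exact: is_derive_add (is_derive_const _ _) (is_derive_opp (is_derive_var _)).
  exact: is_derive_continuous (is_derive_powR (- p) d1 tx).
(* The shift to [n.+2] keeps [b 0] positive, so that every interval is nondegenerate. *)
pose b (n : nat) := t - t / n.+2%:R.
have bt n : b n < t by rewrite /b ltrBlDr ltrDl divr_gt0.
have b0 n : 0 < b n by rewrite /b subr_gt0 ltr_pdivrMr// ltr_pMr// ltr1n.
have mk : measurable_fun setT (fun x : line R => ((t - x) `^ (- p))%:E).
  by apply/measurable_EFinP; apply: (measurableT_comp (measurable_powR (- p))); apply: measurable_funB.
have -> : `[0, t[%classic = \bigcup_n (`[0, b n]%classic : set (line R)).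
  apply/seteqP; split=> x; rewrite /= in_itv/=.
    move=> /andP[x0 xt]; have tx : 0 < t - x by rewrite subr_gt0.
    exists (Num.trunc (t / (t - x))) => //=; rewrite in_itv/= x0/= /b.
    rewrite lerBrDr -lerBrDl ler_pdivrMr// mulrC -ler_pdivrMr//.
    apply: ltW; have := truncnS_gt (t / (t - x)); move=> h; apply: (lt_trans h).
    by rewrite ltr_nat.
  by move=> [n _] /=; rewrite in_itv/= => /andP[-> h]; rewrite (le_lt_trans h).
have nd : {homo (fun n => `[0, b n]%classic : set (line R)) : n m / (n <= m)%N >-> (n <= m)%O}.
  apply/nondecreasing_seqP => n; apply/subsetPset => x; rewrite /= !in_itv/= => /andP[-> h] /=.
  by apply: (le_trans h); rewrite /b lerB// ler_wpM2l ?ltW// ltf_pV2 ?posrE// ltr_nat.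
have cv := @ge0_nondecreasing_set_cvg_integral _ (line R) R (fun n => `[0, b n]%classic)
  (fun x => ((t - x) `^ (- p))%:E) (leb1 R) nd (fun n => measurable_itv _)
  (fun n => measurable_funTS mk) (fun n x _ => powR_ge0 _ _).
rewrite -(cvg_lim _ cv)//; apply: lime_le; first exact: cvgP cv.
apply: nearW => n.
rewrite (@continuous_FTC2 _ (fun x => (t - x) `^ (- p)) F 0 (b n) (b0 n)).
- rewrite -EFinB lee_fin /F subr0 opprK.
  by rewrite gerDr oppr_le0 divr_ge0 ?powR_ge0 ?ltW.
- apply: continuous_in_subspaceT => x; rewrite inE/= in_itv/= => /andP[_ xb].
  by apply: cf; exact: le_lt_trans xb (bt n).
- split.
  + move=> x; rewrite in_itv/= => /andP[_ xb].
    by have [] := dF x (lt_trans xb (bt n)).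
  + apply: cvg_at_right_filter; exact: cF.
  + apply: cvg_at_left_filter; exact: cF.
- move=> x; rewrite in_itv/= => /andP[_ xb].
  by rewrite derive1E; have [] := dF x (lt_trans xb (bt n)).
Qed.

Lemma integral_decay1 (q : R) : 1 < q ->
  (\int[leb1 R]_(x in `[0%R, +oo[) ((1 + x) `^ (- q))%:E < +oo)%E.
Proof.
move=> q1; have q0 : 0 < q - 1 by rewrite subr_gt0.
pose F (x : R) := - ((1 + x) `^ (1 - q) / (q - 1)).
have dd x : is_derive x 1 (fun y : R => 1 + y) (0 + 1).
  exact: is_derive_add (is_derive_const _ _) (is_derive_var _).
have pos x : 0 <= x -> 0 < 1 + x by move=> x0; lra.
have dF x : 0 <= x -> is_derive x 1 F ((1 + x) `^ (- q)).
  move=> x0.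
  have d2 := is_derive_powR (1 - q) (dd x) (pos _ x0).
  have d3 := is_derive_opp (is_derive_mul d2 (is_derive_const (q - 1)^-1 x)).
  apply: is_derive_eq d3 _.
  have -> : 1 - q - 1 = - q by ring.
  by rewrite /=; field; rewrite gt_eqF.
have cf x : 0 <= x -> {for x, continuous (fun x => (1 + x) `^ (- q))}.
  move=> x0.
  exact: is_derive_continuous (is_derive_powR (- q) (dd x) (pos _ x0)).
rewrite (@ge0_continuous_FTC2y _ (fun x => (1 + x) `^ (- q)) F 0 0) ?ltry//.
- by move=> x _; exact: powR_ge0.
- apply: continuous_in_subspaceT => x; rewrite inE/= in_itv/= andbT => x0.
  exact: cf.
- have c1 : (1 + x) `^ (q - 1) @[x --> +oo] --> +oo.
    apply/cvgryPge => A; near=> x.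
    have A1 : 0 <= Num.max A 0 by rewrite le_max lexx orbT.
    apply: (@le_trans _ _ (Num.max A 0)); first by rewrite le_max lexx.
    have e : Num.max A 0 = ((Num.max A 0) `^ (q - 1)^-1) `^ (q - 1).
      by rewrite -powRrM mulVf ?gt_eqF// powRr1.
    have hx : (Num.max A 0) `^ (q - 1)^-1 <= x by near: x; exact: nbhs_pinfty_ge.
    rewrite e; apply: ge0_ler_powR; rewrite ?nnegrE ?powR_ge0 ?ltW//.
      by apply: pos; exact: le_trans (powR_ge0 _ _) hx.
    by rewrite (le_lt_trans hx)// ltrDr.
  rewrite -[0]oppr0 -[X in - X](mul0r (q - 1)^-1); apply: cvgN; apply: cvgMl.
  rewrite (_ : (fun x => (1 + x) `^ (1 - q)) = (fun x => ((1 + x) `^ (q - 1))^-1)); last first.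
    by apply/funext => x; rewrite -powRN opprB.
  apply/gtr0_cvgV0 => //; near=> x; rewrite powR_gt0// pos// ltW//; near: x; exact: nbhs_pinfty_gt.
- by move=> x x0; have [] := dF x (ltW x0).
- apply: cvg_at_right_filter; exact: is_derive_continuous (dF 0 (lexx 0)).
- move=> x; rewrite in_itv/= andbT => x0.
  by rewrite derive1E; have [] := dF x (ltW x0).
Unshelve. all: by end_near. Qed.

End Weights.

(** * Convolution estimates *)

Section Estimates.
Context (R : realType).
Notation mu := (leb2 R).
Implicit Types (xi eta zeta : R * R) (V G g : R * R -> R).

Lemma integral_decay_line (q : R) : 1 < q ->
  (leb1 R).-integrable setT (EFin \o (fun x : line R => (1 + `|x|) `^ (- q))).
Proof.
move=> q1; have mk : measurable_fun [set: line R] (fun x : line R => (1 + `|x|) `^ (- q)).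
  apply: (measurableT_comp (measurable_powR (- q))); exact: measurable_funD.
apply/integrableP; split; first exact/measurable_EFinP.
under eq_integral do rewrite /= ger0_norm ?powR_ge0//.
rewrite ge0_symfun_integralT.
- have h : (\int[leb1 R]_(x in [set x : R | (0 <= x)%R]) ((1 + `|x|) `^ (- q))%:E < +oo)%E.
    apply: le_lt_trans (integral_decay1 q1); rewrite set_itvcy; rewrite le_eqVlt; apply/orP; left; apply/eqP.
    by apply: eq_integral => x; rewrite inE/= => x0; rewrite ger0_norm.
  exact: lte_mul_pinfty.
- by move=> x; exact: powR_ge0.
- move=> x.
  have p0 : 0 < 1 + `|x| by rewrite (lt_le_trans ltr01)// lerDl.
  have c1 : {for 1 + `|x|, continuous (fun y : R => y `^ (- q))}.
    exact: is_derive_continuous (is_derive1_powR (- q) p0).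
  apply: (@continuous_comp _ _ _ (fun x : R => 1 + `|x|) (fun y => y `^ (- q))) => //.
  by apply: cvgD; [exact: cvg_cst|exact: norm_continuous].
- by move=> x /=; rewrite normrN.
Qed.

(** Comparison with a tensor product, from (1 + u) (1 + v) <= 2 (1 + u^2 + v^2). *)
Lemma integral_jb (q : R) : 1 < q -> (\int[mu]_xi (jb xi `^ (- q))%:E < +oo)%E.
Proof.
move=> q1; have i1 := integral_decay_line q1.
have := integrableZl measurableT (2 `^ q) (integrable_tensor i1 i1).
move=> /integrableP[mt it]; apply: le_lt_trans it.
apply: ge0_le_integral => //.
- by move=> x _; rewrite lee_fin powR_ge0.
- by apply/measurable_EFinP; exact: measurable_jb_pow.
- exact: measurableT_comp.
- move=> xi _; rewrite /tensor /comp -EFinM /= lee_fin; apply: le_trans (ler_norm _).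
  have p1 : 0 <= 1 + `|xi.1| by rewrite addr_ge0.
  have p2 : 0 <= 1 + `|xi.2| by rewrite addr_ge0.
  rewrite -powRM// !powRN -[X in X / _]invrK -invfM lef_pV2 ?posrE ?powR_gt0 ?jb_gt0//.
  rewrite mulrC ler_pdivrMr ?powR_gt0// -powRM ?(ltW (jb_gt0 _))//.
  apply: ge0_ler_powR; rewrite ?nnegrE ?mulr_ge0 ?(ltW (jb_gt0 _))//.
    by rewrite (le_trans ler01)// ltW.
  rewrite jbE; move: p1 p2.
  rewrite -[xi.1 ^+ 2]real_normK ?num_real// -[xi.2 ^+ 2]real_normK ?num_real//.
  move: (`|xi.1|) (`|xi.2|) => u v p1 p2.
  have := sqr_ge0 (u - v); have := sqr_ge0 (u - 2^-1); have := sqr_ge0 (v - 2^-1); nra.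
Qed.

Lemma jb_reflectC xi eta : jb (reflect xi eta) = jb (reflect eta xi).
Proof. by rewrite !jbE /reflect /=; ring. Qed.

Lemma integral_jb_reflect (q : R) zeta :
  (\int[mu]_xi (jb (reflect xi zeta) `^ (- q))%:E = \int[mu]_xi (jb xi `^ (- q))%:E)%E.
Proof.
rewrite -(@ge0_integral_reflect R zeta (fun xi => (jb xi `^ (- q))%:E)).
- by apply: eq_integral => xi _; rewrite jb_reflectC.
- by apply/measurable_EFinP; exact: measurable_jb_pow.
- by move=> x; rewrite lee_fin powR_ge0.
Qed.

Lemma integral_jb_pair (k s : R) zeta : 0 <= k -> 0 <= s ->
  (\int[mu]_xi (jb xi `^ (- k) * jb (reflect xi zeta) `^ (- s))%:E <=
   2%:E * \int[mu]_xi (jb xi `^ (- (k + s)))%:E)%E.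
Proof.
move=> k0 s0.
have mr q : mfun2 R (fun xi => jb (reflect xi zeta) `^ q).
  rewrite (_ : (fun xi => _) = (fun xi => jb (reflect zeta xi) `^ q)); last first.
    by apply/funext => xi; rewrite jb_reflectC.
  exact: (measurableT_comp (measurable_jb_pow q) (measurable_reflect zeta)).
have mj q := @measurable_jb_pow R q.
have -> : (2%:E * \int[mu]_xi (jb xi `^ (- (k + s)))%:E =
    \int[mu]_xi ((jb xi `^ (- (k + s)))%:E + (jb (reflect xi zeta) `^ (- (k + s)))%:E))%E.
  rewrite ge0_integralD//.
  - by rewrite integral_jb_reflect (_ : 2%:E = 1%:E + 1%:E)%E// ge0_muleDl// mul1e.
  - by move=> x _; rewrite lee_fin powR_ge0.
  - exact/measurable_EFinP.
  - by move=> x _; rewrite lee_fin powR_ge0.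
  - exact/measurable_EFinP.
apply: ge0_le_integral => //.
- by move=> x _; rewrite lee_fin mulr_ge0 ?powR_ge0.
- by apply/measurable_EFinP; exact: measurable_funM.
- by apply: emeasurable_funD; exact/measurable_EFinP.
- by move=> xi _; rewrite -EFinD lee_fin jb_pow_mul_le.
Qed.

Lemma convC u v xi : mfun2 R u -> mfun2 R v -> conv u v xi = conv v u xi.
Proof.
move=> mu_ mv; rewrite /conv.
have h := @ip_reflect R xi (u \o reflect xi) v (measurableT_comp mu_ (measurable_reflect xi)) mv.
rewrite -h ipC; apply: eq_Rintegral => x _; congr (_ * _); by rewrite /= reflectK.
Qed.

Lemma measurable_reflect2 :
  measurable_fun [set: plane R * plane R] (fun z : plane R * plane R => (reflect z.1 z.2 : plane R)).
Proof.
have m1 : measurable_fun [set: plane R * plane R] (fun z : plane R * plane R => z.1) by exact: measurable_fst.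
have m2 : measurable_fun [set: plane R * plane R] (fun z : plane R * plane R => z.2) by exact: measurable_snd.
apply/measurable_fun_pairP; split; rewrite /comp /reflect /=.
- apply: measurable_funB; [exact: (measurableT_comp (@measurable_fst _ _ (line R) (line R)) m1)|exact: (measurableT_comp (@measurable_fst _ _ (line R) (line R)) m2)].
- apply: measurable_funB; [exact: (measurableT_comp (@measurable_snd _ _ (line R) (line R)) m1)|exact: (measurableT_comp (@measurable_snd _ _ (line R) (line R)) m2)].
Qed.

Lemma measurable_conv u v : mfun2 R u -> mfun2 R v -> mfun2 R (conv u v).
Proof.
move=> mu_ mv.
have mg : measurable_fun setT (fun z : plane R * plane R => (u \o reflect z.1) z.2 * v z.2).
  apply: measurable_funM; first exact: (measurableT_comp mu_ measurable_reflect2).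
  exact: (measurableT_comp mv (@measurable_snd _ _ (plane R) (plane R))).
exact: (measurable_Rintegral_param (leb2_sigma_finite R) mg).
Qed.

(** Cauchy-Schwarz at fixed xi, with the decay kept in the factor that contains the shifted [V].
    After a reflection and Tonelli's theorem, [V ^ 2] is integrated against a pair of brackets that
    [integral_jb_pair] bounds uniformly in the shift. *)
Lemma conv_weighted (k s : R) V : 0 <= k -> 0 <= s -> Lsq mu V ->
  (\int[mu]_xi (jb xi `^ (- k) * (conv V (fun x => (jb x) `^ (- (s / 2)) * V x) xi) ^+ 2)%:E <=
   2%:E * \int[mu]_xi (jb xi `^ (- (k + s)))%:E * (ip mu V V ^+ 2)%:E)%E.
Proof.
move=> k0 s0 LV; have mV := Lsq_meas LV.
set B := fun x : R * R => jb x `^ (- (s / 2)).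
have mB : mfun2 R B by exact: measurable_jb_pow.
have B0 x : 0 <= B x by exact: powR_ge0.
have B1 x : `|B x| <= 1.
  rewrite ger0_norm// /B powRN invf_le1 ?powR_gt0 ?jb_gt0//.
  by have := ler_powR (jb_ge1 x) (divr_ge0 s0 (ler0n R 2)); rewrite powRr0.
have mBV : mfun2 R (fun x => B x * V x) by exact: measurable_funM.
have LVr xi : Lsq mu (fun x => V (reflect xi x) * B x) by apply: Lsq_mul_bounded1 => //; exact: Lsq_reflect.
pose q xi := ip mu (fun x => V (reflect xi x) * B x) (fun x => V (reflect xi x) * B x).
have cs xi : (conv V (fun x => B x * V x) xi) ^+ 2 <= q xi * ip mu V V.
  have -> : conv V (fun x => B x * V x) xi = ip mu (fun x => V (reflect xi x) * B x) V.
    by apply: eq_Rintegral => x _ /=; ring.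
  exact: ip_cauchy.
pose f (z : plane R * plane R) : R := V z.2 ^+ 2 * (jb z.1 `^ (- k) * jb (reflect z.1 z.2) `^ (- s)).
have f0 z : 0 <= f z by rewrite /f mulr_ge0 ?sqr_ge0// mulr_ge0 ?powR_ge0.
have m1 : measurable_fun [set: plane R * plane R] (fun z : plane R * plane R => z.1) by exact: measurable_fst.
have m2 : measurable_fun [set: plane R * plane R] (fun z : plane R * plane R => z.2) by exact: measurable_snd.
have mrefl := measurable_reflect2.
have mf : measurable_fun setT (EFin \o f).
  apply/measurable_EFinP; apply: measurable_funM.
    by apply: measurable_funX; exact: (measurableT_comp mV m2).
  apply: measurable_funM; first exact: (measurableT_comp (measurable_jb_pow (- k)) m1).
  exact: (measurableT_comp (measurable_jb_pow (- s)) mrefl).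
have qE xi : ((jb xi `^ (- k) * q xi)%:E = \int[mu]_zeta (f (xi, zeta))%:E)%E.
  rewrite EFinM -(Lsq_ip (LVr xi)) /sqint.
  rewrite -(@ge0_integral_reflect R xi (fun x => ((V (reflect xi x) * B x) ^+ 2)%:E)); first last.
  - by move=> x; rewrite lee_fin sqr_ge0.
  - by apply/measurable_EFinP; apply: measurable_funX; exact: Lsq_meas (LVr xi).
  rewrite -ge0_integralZl//; first last.
  - by rewrite lee_fin powR_ge0.
  - by move=> x _; rewrite lee_fin sqr_ge0.
  - apply/measurable_EFinP; apply: measurable_funX.
    exact: (measurableT_comp (Lsq_meas (LVr xi)) (measurable_reflect xi)).
  apply: eq_integral => x _; rewrite -EFinM /f /= reflectK; congr EFin.
  have -> : jb (reflect xi x) `^ (- s) = B (reflect xi x) ^+ 2.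
    by rewrite /B -powR_mulrn ?powR_ge0// -powRrM; congr (_ `^ _); field.
  by ring.
have mq : measurable_fun [set: plane R] (fun xi => (jb xi `^ (- k) * q xi)%:E).
  rewrite (_ : (fun xi => _) = (fun xi => \int[mu]_zeta (f (xi, zeta))%:E)%E); last first.
    by apply/funext => xi; exact: qE.
  exact: (@measurable_fun_fubini_tonelli_F _ _ (plane R) (plane R) R (leb2_sigma_finite R) (EFin \o f) mf (fun z => f0 z)).
apply: (@le_trans _ _ (\int[mu]_xi ((jb xi `^ (- k) * q xi)%:E * (ip mu V V)%:E))%E).
  apply: ge0_le_integral => //.
  - by move=> x _; rewrite lee_fin mulr_ge0 ?powR_ge0// sqr_ge0.
  - apply/measurable_EFinP; apply: measurable_funM; first exact: measurable_jb_pow.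
    by apply: measurable_funX; exact: measurable_conv.
  - by apply: emeasurable_funM.
  - by move=> xi _; rewrite -EFinM lee_fin -mulrA ler_wpM2l ?powR_ge0.
rewrite ge0_integralZr//; first last.
- by rewrite lee_fin ip_ge0.
- by move=> x _; rewrite lee_fin mulr_ge0 ?powR_ge0 ?ip_ge0.
rewrite expr2 EFinM muleA; apply: lee_wpmul2r; first by rewrite lee_fin ip_ge0.
under eq_integral do rewrite qE.
rewrite (@fubini_tonelli _ _ (plane R) (plane R) R (leb2_sigma_finite R) (leb2_sigma_finite R) (EFin \o f) mf (fun z => f0 z)).
rewrite -(Lsq_ip LV) /sqint -ge0_integralZl//; first last.
- by apply: mule_ge0 => //; apply: integral_ge0 => x _; rewrite lee_fin powR_ge0.
- by move=> x _; rewrite lee_fin sqr_ge0.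
- by apply/measurable_EFinP; exact: measurable_funX.
apply: ge0_le_integral => //.
- by move=> zeta _; apply: integral_ge0 => x _; rewrite lee_fin.
- exact: (@measurable_fun_fubini_tonelli_G _ _ (plane R) (plane R) R (leb2_sigma_finite R) (EFin \o f) mf (fun z => f0 z)).
- by apply: emeasurable_funM => //; apply/measurable_EFinP; exact: measurable_funX.
- move=> zeta _; rewrite /f /= [leRHS]muleC.
  under eq_integral do rewrite EFinM.
  rewrite ge0_integralZl//; first last.
  + by rewrite lee_fin sqr_ge0.
  + by move=> x _; rewrite lee_fin mulr_ge0 ?powR_ge0.
  + apply/measurable_EFinP; apply: measurable_funM; first exact: measurable_jb_pow.
    rewrite (_ : (fun xi => _) = (fun xi => jb (reflect zeta xi) `^ (- s))); last first.
      by apply/funext => xi; rewrite jb_reflectC.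
    exact: (measurableT_comp (measurable_jb_pow (- s)) (measurable_reflect zeta)).
  by apply: lee_wpmul2l; [rewrite lee_fin sqr_ge0|exact: integral_jb_pair].
Qed.
End Estimates.

(** * The Gevrey estimate *)

Section WeightedCauchy.
Context d (T : measurableType d) (R : realType) (m : {measure set T -> \bar R}).

(** Cauchy-Schwarz for the measure with density [k], through k h = sqrt k (sqrt k h). It is stated
    in [\bar R] because the right side may be infinite at some frequencies. *)
Lemma weighted_cauchy (k h : T -> R) (M : R) : 0 < M -> measurable_fun setT k ->
  measurable_fun setT h -> (forall x, 0 <= k x) -> (forall x, 0 <= h x) ->
  (\int[m]_x (k x)%:E <= M%:E)%E ->
  ((\int[m]_x (k x * h x)%:E) * (\int[m]_x (k x * h x)%:E) <=
   M%:E * \int[m]_x (k x * h x ^+ 2)%:E)%E.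
Proof.
move=> M0 mk mh k0 h0 kM.
have J0 : (0 <= \int[m]_x (k x * h x ^+ 2)%:E)%E.
  by apply: integral_ge0 => x _; rewrite lee_fin mulr_ge0 ?sqr_ge0.
have [jf|] := boolP ((\int[m]_x (k x * h x ^+ 2)%:E)%E \is a fin_num); last first.
  by rewrite ge0_fin_numE// -leNgt leye_eq => /eqP ->; rewrite gt0_muley ?lte_fin// leey.
pose f x := Num.sqrt (k x); pose g x := Num.sqrt (k x) * h x.
have mf : measurable_fun setT f.
  by rewrite /f; under eq_fun do rewrite -powR12_sqrt//; exact: (measurableT_comp (measurable_powR 2^-1) mk).
have mg : measurable_fun setT g by exact: measurable_funM.
have ef : sqint m f = (\int[m]_x (k x)%:E)%E by apply: eq_integral => x _; rewrite /f sqr_sqrtr.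
have eg : sqint m g = (\int[m]_x (k x * h x ^+ 2)%:E)%E.
  by apply: eq_integral => x _; rewrite /g exprMn sqr_sqrtr.
have Lf : Lsq m f by split => //; rewrite ef (le_lt_trans kM)// ltry.
have Lg : Lsq m g by split => //; rewrite eg -ge0_fin_numE.
have -> : (\int[m]_x (k x * h x)%:E = (ip m f g)%:E)%E.
  rewrite /ip /Rintegral fineK; last exact/integrable_fin_num/Lsq_mul.
  by apply: eq_integral => x _; rewrite /f /g mulrA -expr2 sqr_sqrtr.
rewrite -eg (Lsq_ip Lg) -!EFinM lee_fin -expr2.
apply: (le_trans (ip_cauchy Lf Lg)); rewrite ler_wpM2r ?ip_ge0//.
by rewrite -lee_fin -(Lsq_ip Lf) ef.
Qed.

Lemma ip_le (u v u' v' : T -> R) : Lsq m u -> Lsq m v -> Lsq m u' -> Lsq m v' ->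
  (forall x, u x * v x <= u' x * v' x) -> ip m u v <= ip m u' v'.
Proof.
move=> Lu Lv Lu' Lv' h; have i1 := Lsq_mul Lu Lv; have i2 := Lsq_mul Lu' Lv'.
apply: fine_le; [exact: integrable_fin_num|exact: integrable_fin_num|].
by apply: le_integral => // x _; rewrite lee_fin.
Qed.

End WeightedCauchy.

Section GevreyEstimate.
Context (R : realType).
Notation mu := (leb2 R).
Implicit Types (xi eta : R * R) (t r tau N L : R).

Lemma sq_add_ereal (v x : R) (y : \bar R) : 0 <= v -> 0 <= x -> (0 <= y)%E ->
  (v%:E <= x%:E + y)%E -> ((v ^+ 2)%:E <= (2 * x ^+ 2)%:E + 2%:E * (y * y))%E.
Proof.
move=> v0 x0; case: y => [y| |]// y0; rewrite ?lee_fin.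
  rewrite lee_fin in y0; move=> h; have := sqr_ge0 (x - y).
  have : v ^+ 2 <= (x + y) ^+ 2 by rewrite ler_pXn2r// nnegrE addr_ge0.
  nra.
by move=> _; rewrite mulyy gt0_muley ?lte_fin// addey ?leey.
Qed.

Lemma Lsq_weight_inv (s : R) (G : R * R -> R) : 0 <= s -> mfun2 R G ->
  Lsq mu (fun xi => jb xi `^ (s / 2) * G xi) -> Lsq mu G.
Proof.
move=> s0 mG LV; apply: (Lsq_le mG LV) => xi.
rewrite normrM ler_peMl// ger0_norm ?powR_ge0//.
by have := ler_powR (jb_ge1 xi) (divr_ge0 s0 (ler0n R 2)); rewrite powRr0.
Qed.

(** The weight at xi is at most a sum of weights at xi - x and at x. The two resulting convolutions
    are equal by [convC], which accounts for the factor 2. *)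
Lemma weight_conv_le (s : R) (G : R * R -> R) xi : 0 <= s -> mfun2 R G -> (forall x, 0 <= G x) ->
  Lsq mu (fun x => jb x `^ (s / 2) * G x) ->
  jb xi `^ (s / 2) * conv G G xi <= 2 * 4 `^ (s / 2) * conv (fun x => jb x `^ (s / 2) * G x) G xi.
Proof.
move=> s0 mG G0 LV; have LG := Lsq_weight_inv s0 mG LV.
set V := fun x => _; have mV : mfun2 R V := Lsq_meas LV.
have LGr := Lsq_reflect xi LG; have LVr := Lsq_reflect xi LV.
have e1 : conv V G xi = conv G V xi by exact: convC.
have -> : 2 * 4 `^ (s / 2) * conv V G xi = 4 `^ (s / 2) * conv V G xi + 4 `^ (s / 2) * conv V G xi by ring.
rewrite [X in _ + _ * X]e1 -mulrDr /conv.
rewrite -(ipZl _ LGr LG).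
have -> : ip mu (V \o reflect xi) G + ip mu (G \o reflect xi) V =
  \int[mu]_x ((V \o reflect xi) x * G x + (G \o reflect xi) x * V x).
  by rewrite RintegralD//; exact: Lsq_mul.
have i3 := integrableD measurableT (Lsq_mul LVr LG) (Lsq_mul LGr LV).
rewrite -RintegralZl//.
apply: fine_le.
- exact: integrable_fin_num (Lsq_mul (LsqZ _ LGr) LG).
- exact: integrable_fin_num (integrableZl measurableT _ i3).
apply: le_integral; first exact: measurableT.
- exact: (Lsq_mul (LsqZ _ LGr) LG).
- exact: (integrableZl measurableT _ i3).
move=> x _; rewrite lee_fin /=.
have h := jb_pow_add_le xi x (divr_ge0 s0 (ler0n R 2)).
have GG : 0 <= G (reflect xi x) * G x by exact: mulr_ge0.
have h2 := ler_wpM2r GG h.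
rewrite -mulrA; apply: (le_trans h2); apply: le_of_eq; rewrite /V /=.
by move: (G (reflect xi x)) (G x) (jb (reflect xi x) `^ _) (jb x `^ _) (4 `^ _) => *; ring.
Qed.

(** The estimate concerns nonnegative real functions only: [g0] and [g] stand for the amplitudes of
    the data and of the solution, [D] for a majorant of the flux. In [mild] the time interval is
    half open because the kernel (t - tau)^(-p) is split off below, which requires tau < t. *)
Context (alpha beta s a p T C : R) (g0 : R * R -> R) (g D : R -> R * R -> R).
Context (ha : 0 < a <= 1) (haa : a <= alpha) (hab : a <= beta).
Context (halpha : 0 < alpha <= 1) (hbeta : 0 < beta <= 1).
Context (hp : 0 < p < 1) (hk : 0 <= 2 * a * p - 1) (hs : 0 <= s) (hks : 1 < 2 * a * p - 1 + s).
Context (hT : 0 < T <= 1) (hC : 0 <= C).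
Let A := aniso (2 * alpha) (2 * beta).
Let b xi := jb xi `^ (s / 2).
Context (g0_ge0 : forall xi, 0 <= g0 xi) (Lg0 : Lsq mu (fun xi => b xi * g0 xi)).
Context (g_ge0 : forall t xi, 0 <= g t xi) (mg : forall t, 0 <= t <= T -> mfun2 R (g t)).
Context (Lg : forall t, 0 <= t <= T -> Lsq mu (fun xi => b xi * g t xi)).
Context (D_ge0 : forall t xi, 0 <= D t xi).
Context (mD : measurable_fun [set: line R * plane R] (fun z => D z.1 z.2)).
Context (D_le : forall t xi, 0 <= t <= T -> D t xi <= C * norm2 xi * conv (g t) (g t) xi).
Context (mild : forall t, 0 <= t <= T -> {ae mu, forall xi,
  ((g t xi)%:E <= (expR (- (t * A xi)) * g0 xi)%:E +
    \int[leb1 R]_tau (\1_`[0, t[ tau * (expR (- ((t - tau) * A xi)) * D tau xi))%:E)%E}).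

Let w N t := capw alpha beta N t.
Let V N t xi := b xi * (w N t xi * g t xi).
Let J0 := fine (\int[mu]_xi (jb xi `^ (- (2 * a * p - 1 + s)))%:E)%E.

Lemma J0_ge0 : 0 <= J0.
Proof. by apply: fine_ge0; apply: integral_ge0 => x _; rewrite lee_fin powR_ge0. Qed.

Lemma J0E : (\int[mu]_xi (jb xi `^ (- (2 * a * p - 1 + s)))%:E = J0%:E)%E.
Proof.
rewrite /J0 fineK// ge0_fin_numE; first exact: integral_jb.
by apply: integral_ge0 => x _; rewrite lee_fin powR_ge0.
Qed.

Let b_ge0 xi : 0 <= b xi. Proof. exact: powR_ge0. Qed.
Let mb : mfun2 R b. Proof. exact: measurable_jb_pow. Qed.

Lemma V_ge0 N t xi : 0 <= N -> 0 <= V N t xi.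
Proof. by move=> N0; rewrite mulr_ge0// mulr_ge0// capw_ge0. Qed.

Lemma measurable_wg N t : 0 <= t <= T -> mfun2 R (fun xi => w N t xi * g t xi).
Proof. by move=> ht; apply: measurable_funM; [exact: measurable_capw|exact: mg]. Qed.

Lemma Lsq_V N t : 0 <= N -> 0 <= t <= T -> Lsq mu (V N t).
Proof.
move=> N0 ht; apply: (Lsq_le _ (LsqZ N (Lg ht))).
  by apply: measurable_funM => //; exact: measurable_wg.
move=> xi; rewrite /V mulrCA !normrM (ger0_norm (b_ge0 _)) (ger0_norm N0).
rewrite ler_wpM2r// ?mulr_ge0//.
by rewrite ger0_norm ?capw_ge0// capw_le_cap.
Qed.

(** The Duhamel integrand with half of the dissipation already spent on moving the weight,
    multiplied by (t - tau)^p to remove the time singularity, which is restored by [ker]. *)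
Let H N t tau xi := (t - tau) `^ p * (expR (- ((t - tau) * (A xi / 2))) *
  (b xi * (w N tau xi * D tau xi))).

Let H_ge0 N t tau xi : 0 <= N -> 0 <= H N t tau xi.
Proof.
by move=> N0; rewrite mulr_ge0 ?powR_ge0// mulr_ge0 ?expR_ge0// mulr_ge0// mulr_ge0// capw_ge0.
Qed.

Lemma measurable_H N t : measurable_fun [set: line R * plane R] (fun z => H N t z.1 z.2).
Proof.
have m1 : measurable_fun [set: line R * plane R] (fun z : line R * plane R => z.1) by exact: measurable_fst.
have m2 : measurable_fun [set: line R * plane R] (fun z : line R * plane R => z.2) by exact: measurable_snd.
have mt : measurable_fun [set: line R * plane R] (fun z : line R * plane R => t - z.1) by exact: measurable_funB.
apply: measurable_funM; first exact: (measurableT_comp (measurable_powR p) mt).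
apply: measurable_funM.
  apply: (measurableT_comp (@measurable_expR R)); apply: measurable_funN; apply: measurable_funM => //.
  by apply: measurable_funM => //; exact: (measurableT_comp (measurable_aniso _ _) m2).
apply: measurable_funM; first exact: (measurableT_comp mb m2).
apply: measurable_funM => //; apply: measurable_minr => //.
apply: (measurableT_comp (@measurable_expR R)); apply: measurable_funM.
  exact: measurable_funM.
exact: (measurableT_comp (measurable_aniso _ _) m2).
Qed.

Lemma measurable_H1 N t tau : mfun2 R (H N t tau).
Proof. exact: (measurableT_comp (measurable_H N t) (measurable_pair1 tau)). Qed.

Definition flux_const := 2 * expR 2 * (C * (2 * 4 `^ (s / 2))).

(** Submultiplicativity puts the capped weight on both factors of the convolution, [weight_conv_le]
    puts the Sobolev weight on one of them, and [dissipation_decay] pays for |xi|. The factor left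
    without Sobolev weight is [jb ^ (- (s / 2)) * V]. *)
Lemma flux_le N t tau xi : 1 <= N -> t <= T -> 0 <= tau < t ->
  H N t tau xi <= flux_const * (jb xi `^ (- ((2 * a * p - 1) / 2)) *
    conv (V N tau) (fun x => jb x `^ (- (s / 2)) * V N tau x) xi).
Proof.
move=> N1 tT /andP[tau0 taut].
have N0 : 0 <= N by exact: le_trans N1.
have htau : 0 <= tau <= T by rewrite tau0 (le_trans (ltW taut)).
have /andP[T0 T1] := hT.
set G := fun xi => w N tau xi * g tau xi.
have mG : mfun2 R G by exact: measurable_wg.
have G0 x : 0 <= G x by rewrite mulr_ge0// capw_ge0.
have LV : Lsq mu (V N tau) by exact: Lsq_V.
have LG : Lsq mu G := Lsq_weight_inv hs mG LV.
have Lgt : Lsq mu (g tau) := Lsq_weight_inv hs (mg htau) (Lg htau).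
have -> : conv (V N tau) (fun x => jb x `^ (- (s / 2)) * V N tau x) xi = conv (V N tau) G xi.
  congr conv; apply/funext => x; rewrite /V /b mulrA -powRD ?(gt_eqF (jb_gt0 _)) ?implybT//.
  by rewrite addNr powRr0 mul1r.
have s1 : w N tau xi * conv (g tau) (g tau) xi <= conv G G xi.
  rewrite /conv -(ipZl _ (Lsq_reflect xi Lgt) Lgt).
  apply: ip_le => //; [exact: LsqZ (Lsq_reflect xi Lgt)|exact: Lsq_reflect|].
  move=> x /=; rewrite /G.
  have := capw_submul xi x halpha hbeta N1 tau0.
  rewrite -/(w N tau xi) -/(w N tau (reflect xi x)) -/(w N tau x).
  move: (g_ge0 tau (reflect xi x)) (g_ge0 tau x).
  move: (g tau _) (g tau x) (w N tau xi) (w N tau _) (w N tau x) => g1 g2 w1 w2 w3 h1 h2 h.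
  by rewrite -mulrA [leRHS]mulrACA ler_wpM2r// mulr_ge0.
have s2 := weight_conv_le xi hs mG G0 LV.
have s3 : b xi * (w N tau xi * D tau xi) <= norm2 xi * (C * (2 * 4 `^ (s / 2) * conv (V N tau) G xi)).
  apply: (@le_trans _ _ (b xi * (w N tau xi * (C * norm2 xi * conv (g tau) (g tau) xi)))).
    by rewrite ler_wpM2l// ler_wpM2l ?capw_ge0// D_le.
  have -> : b xi * (w N tau xi * (C * norm2 xi * conv (g tau) (g tau) xi)) =
    norm2 xi * (C * (b xi * (w N tau xi * conv (g tau) (g tau) xi))) by ring.
  rewrite ler_wpM2l ?norm2_ge0// ler_wpM2l//.
  by apply: le_trans s2; rewrite ler_wpM2l.
have r1 : 0 < t - tau <= 1.
  by rewrite subr_gt0 taut/=; lra.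
have hp' : 0 < p <= 1 by case/andP: hp => ? ?; rewrite ltW ?andbT//; lra.
have s4 := dissipation_decay xi ha haa hab hp' r1.
have cV0 : 0 <= conv (V N tau) G xi.
  by apply: Rintegral_ge0 => x _; rewrite mulr_ge0// /comp V_ge0.
apply: (@le_trans _ _ ((t - tau) `^ p * (expR (- ((t - tau) * (A xi / 2))) * (norm2 xi * (C * (2 * 4 `^ (s / 2) * conv (V N tau) G xi)))))).
  by rewrite ler_wpM2l ?powR_ge0// ler_wpM2l ?expR_ge0.
have c0 : 0 <= C * (2 * 4 `^ (s / 2) * conv (V N tau) G xi).
  by rewrite !mulr_ge0 ?powR_ge0.
have := ler_wpM2r c0 s4; rewrite /flux_const /A.
by move: (conv _ _ _) (expR _) (expR 2) (_ `^ p) (jb xi `^ _) (4 `^ _) (norm2 xi) => *; lra.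
Qed.

Lemma integral_flux_le N t tau L : 1 <= N -> t <= T -> 0 <= tau < t -> ip mu (V N tau) (V N tau) <= L ->
  (\int[mu]_xi ((H N t tau xi) ^+ 2)%:E <= (flux_const ^+ 2 * (2 * J0 * L ^+ 2))%:E)%E.
Proof.
move=> N1 tT ht VL; have N0 : 0 <= N by exact: le_trans N1.
have htau : 0 <= tau <= T by case/andP: ht => t0 t1; rewrite t0 (le_trans (ltW t1)).
have LV := Lsq_V N0 htau.
have h := conv_weighted hk hs LV; rewrite J0E -!EFinM in h.
pose q xi := jb xi `^ (- (2 * a * p - 1)) * conv (V N tau) (fun x => jb x `^ (- (s / 2)) * V N tau x) xi ^+ 2.
have mV := Lsq_meas LV.
have mq : mfun2 R (fun xi => (q xi)%:E).
  apply/measurable_EFinP; apply: measurable_funM; first exact: measurable_jb_pow.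
  apply: measurable_funX; apply: measurable_conv => //.
  by apply: measurable_funM => //; exact: measurable_jb_pow.
have q0 xi : 0 <= q xi by rewrite mulr_ge0 ?powR_ge0 ?sqr_ge0.
apply: (@le_trans _ _ (\int[mu]_xi ((flux_const ^+ 2)%:E * (q xi)%:E))%E).
  apply: ge0_le_integral => //.
  - by move=> x _; rewrite lee_fin sqr_ge0.
  - by apply/measurable_EFinP; apply: measurable_funX; exact: measurable_H1.
  - by apply: emeasurable_funM.
  - move=> xi _; rewrite -EFinM lee_fin.
    have e : flux_const ^+ 2 * q xi = (flux_const * (jb xi `^ (- ((2 * a * p - 1) / 2)) *
      conv (V N tau) (fun x => jb x `^ (- (s / 2)) * V N tau x) xi)) ^+ 2.
      rewrite !exprMn /q; congr (_ * (_ * _)).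
      by rewrite -powR_mulrn ?powR_ge0// -powRrM; congr (_ `^ _); field.
    have hf := flux_le xi N1 tT ht.
    by rewrite e ler_pXn2r ?nnegrE ?H_ge0// (le_trans _ hf)// H_ge0.
rewrite ge0_integralZl//; [|by move=> x _; rewrite lee_fin|by rewrite lee_fin sqr_ge0].
rewrite [leRHS]EFinM; apply: lee_wpmul2l; first by rewrite lee_fin sqr_ge0.
apply: (le_trans h); rewrite lee_fin ler_wpM2l ?mulr_ge0 ?J0_ge0//.
by rewrite ler_pXn2r ?nnegrE ?ip_ge0// (le_trans (ip_ge0 _ _) VL).
Qed.

Let ker t tau := (t - tau) `^ (- p) * \1_`[0, t[ tau.

Let ker_ge0 t tau : 0 <= ker t tau.
Proof. by rewrite mulr_ge0 ?powR_ge0// indicE. Qed.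

Let mker t : measurable_fun [set: line R] (ker t).
Proof.
apply: measurable_funM; last exact: measurable_indic.
by apply: (measurableT_comp (measurable_powR (- p))); apply: measurable_funB.
Qed.

Lemma integral_ker t M : 0 <= t -> 0 < M -> t `^ (1 - p) / (1 - p) <= M ->
  (\int[leb1 R]_tau (ker t tau)%:E <= M%:E)%E.
Proof.
move=> t0 M0 tM; have /andP[p0 p1] := hp.
have -> : (\int[leb1 R]_tau (ker t tau)%:E = \int[leb1 R]_(tau in `[0%R, t[) ((t - tau) `^ (- p))%:E)%E.
  rewrite [RHS]integral_mkcond; apply: eq_integral => x _; rewrite patchE /ker indicE.
  by case: ifP => _; rewrite ?mulr1// mulr0.
have [->|tn0] := eqVneq t 0.
  by rewrite set_itvco0 integral_set0 lee_fin ltW.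
have tp : 0 < t by rewrite lt_neqAle eq_sym tn0.
by apply: (le_trans (integral_time_kernel hp tp)); rewrite lee_fin.
Qed.

Let I N t xi : \bar R := (\int[leb1 R]_tau (ker t tau * H N t tau xi)%:E)%E.

(** [capw_time] and [aniso_double] use up half of the dissipation; the constant 4 in the latter
    contributes at most exp 4, since times are at most 1. *)
Lemma V_le N t : 1 <= N -> 0 <= t <= T -> {ae mu, forall xi,
  ((V N t xi)%:E <= (expR 4 * (b xi * g0 xi))%:E + (expR 4)%:E * I N t xi)%E}.
Proof.
move=> N1 ht; have N0 : 0 <= N by exact: le_trans N1.
have /andP[t0 tT] := ht; have /andP[T0 T1] := hT.
apply: ae2_imp (mild ht) => xi h.
have A0 : 0 <= A xi by exact: aniso_ge0.
have dbl := aniso_double alpha beta xi; rewrite -/(A xi) in dbl.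
have c0 : 0 <= b xi * w N t xi by rewrite mulr_ge0// capw_ge0.
have -> : V N t xi = (b xi * w N t xi) * g t xi by rewrite /V mulrA.
rewrite EFinM; apply: (le_trans (lee_wpmul2l _ h)); first by rewrite lee_fin.
rewrite ge0_muleDr ?lee_fin ?mulr_ge0 ?expR_ge0//; last first.
  by apply: integral_ge0 => x _; rewrite lee_fin mulr_ge0 ?mulr_ge0 ?expR_ge0 ?indicE.
apply: leeD.
  rewrite -EFinM lee_fin.
  have -> : b xi * w N t xi * (expR (- (t * A xi)) * g0 xi) = (w N t xi * expR (- (t * A xi))) * (b xi * g0 xi) by ring.
  rewrite ler_wpM2r ?mulr_ge0//.
  apply: (@le_trans _ _ (expR (2 * t * aniso alpha beta xi) * expR (- (t * A xi)))).
    by rewrite ler_wpM2r ?expR_ge0// capw_le_exp.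
  rewrite -expRD ler_expR; have : t * (2 * aniso alpha beta xi) <= t * (A xi / 2 + 4) by rewrite ler_wpM2l.
  by move: (aniso _ _ _) (A xi) A0 => x y y0; nra.
have m2 : measurable_fun [set: line R] (fun tau => D tau xi).
  exact: (measurableT_comp mD (measurable_pair2 xi)).
have mi : measurable_fun [set: line R] (fun tau => \1_`[0, t[ tau * (expR (- ((t - tau) * A xi)) * D tau xi)).
  apply: measurable_funM; first exact: measurable_indic.
  apply: measurable_funM => //; apply: (measurableT_comp (@measurable_expR R)).
  by apply: measurable_funN; apply: measurable_funM => //; exact: measurable_funB.
have mH : measurable_fun [set: line R] (fun tau => ker t tau * H N t tau xi).
  apply: measurable_funM; first exact: mker.
  exact: (measurableT_comp (measurable_H N t) (measurable_pair2 xi)).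
rewrite -ge0_integralZl//; first last.
- by move=> x _; rewrite lee_fin mulr_ge0 ?mulr_ge0 ?expR_ge0 ?indicE.
- exact/measurable_EFinP.
rewrite -ge0_integralZl//; first last.
- by move=> x _; rewrite lee_fin mulr_ge0 ?H_ge0.
- exact/measurable_EFinP.
apply: ge0_le_integral => //.
- by move=> x _; rewrite -EFinM lee_fin mulr_ge0// mulr_ge0 ?mulr_ge0 ?expR_ge0 ?indicE.
- by apply: emeasurable_funM => //; exact/measurable_EFinP.
- by apply: emeasurable_funM => //; exact/measurable_EFinP.
move=> tau _; rewrite -!EFinM lee_fin /ker indicE.
case: (boolP (tau \in _)) => [|_]; last by rewrite !(mul0r, mulr0).
rewrite inE/= in_itv/= => /andP[tau0 taut]; rewrite mulr1 mul1r.
have r0 : 0 < t - tau by rewrite subr_gt0.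
have hw : w N t xi * expR (- ((t - tau) * A xi)) <= expR 4 * (expR (- ((t - tau) * (A xi / 2))) * w N tau xi).
  have hr : 0 <= tau <= t by rewrite tau0 ltW.
  apply: (@le_trans _ _ (expR (2 * (t - tau) * aniso alpha beta xi) * w N tau xi * expR (- ((t - tau) * A xi)))).
    by rewrite ler_wpM2r ?expR_ge0//; exact: capw_time.
  rewrite mulrAC -expRD mulrA -expRD ler_wpM2r ?capw_ge0// ler_expR.
  have : (t - tau) * (2 * aniso alpha beta xi) <= (t - tau) * (A xi / 2 + 4) by rewrite ler_wpM2l// ltW.
  have : t - tau <= 1 by lra.
  by move: (aniso _ _ _) (A xi) (t - tau) => x y z; nra.
have -> : b xi * w N t xi * (expR (- ((t - tau) * A xi)) * D tau xi) =
  (w N t xi * expR (- ((t - tau) * A xi))) * (b xi * D tau xi) by ring.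
apply: (@le_trans _ _ ((expR 4 * (expR (- ((t - tau) * (A xi / 2))) * w N tau xi)) * (b xi * D tau xi))).
  by rewrite ler_wpM2r// mulr_ge0.
rewrite /H powRN; apply: le_of_eq.
have rp : (t - tau) `^ p != 0 by rewrite gt_eqF// powR_gt0.
by move: (_ `^ p) rp (expR _) (expR 4) (w _ _ _) (D _ _) (b _) => P P0 *; field.
Qed.

Definition data_const := 2 * (expR 4) ^+ 2 * ip mu (fun xi => b xi * g0 xi) (fun xi => b xi * g0 xi).
Definition flux_const2 := 2 * (expR 4) ^+ 2 * (flux_const ^+ 2 * (2 * J0)).

(** Cauchy-Schwarz in time against the kernel costs its mass once, and integrating the squares
    against the same kernel costs it again. The resulting [M ^+ 2] is what becomes small on short
    intervals. *)
Lemma V_bound N t L M : 1 <= N -> 0 <= t <= T -> 0 < M -> t `^ (1 - p) / (1 - p) <= M ->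
  (forall tau, 0 <= tau < t -> ip mu (V N tau) (V N tau) <= L) ->
  ip mu (V N t) (V N t) <= data_const + flux_const2 * (M * L) ^+ 2.
Proof.
move=> N1 ht M0 tM VL; have N0 : 0 <= N by exact: le_trans N1.
have /andP[t0 tT] := ht.
have LV := Lsq_V N0 ht; have mV := Lsq_meas LV.
pose f (z : line R * plane R) : R := ker t z.1 * H N t z.1 z.2 ^+ 2.
have f0 z : 0 <= f z by rewrite mulr_ge0 ?sqr_ge0.
have mf : measurable_fun setT (EFin \o f).
  apply/measurable_EFinP; apply: measurable_funM.
    exact: (measurableT_comp (mker t) (@measurable_fst _ _ (line R) (plane R))).
  by apply: measurable_funX; exact: measurable_H.
have tonelli := @fubini_tonelli _ _ (line R) (plane R) R (leb1 R) (leb2_sigma_finite R) (EFin \o f) mf (fun z => f0 z).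
have mG := @measurable_fun_fubini_tonelli_G _ _ (line R) (plane R) R (leb1 R) (EFin \o f) mf (fun z => f0 z).
have mF := @measurable_fun_fubini_tonelli_F _ _ (line R) (plane R) R (leb2_sigma_finite R) (EFin \o f) mf (fun z => f0 z).
have m0 := Lsq_meas Lg0.
have I2 xi : (I N t xi * I N t xi <= M%:E * \int[leb1 R]_tau (f (tau, xi))%:E)%E.
  apply: weighted_cauchy => //; [|by move=> x; exact: H_ge0|exact: integral_ker].
  exact: (measurableT_comp (measurable_H N t) (measurable_pair2 xi)).
have pt : {ae mu, forall xi, (((V N t xi) ^+ 2)%:E <= (2 * (expR 4 * (b xi * g0 xi)) ^+ 2)%:E +
   (2 * (expR 4) ^+ 2 * M)%:E * \int[leb1 R]_tau (f (tau, xi))%:E)%E}.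
  apply: ae2_imp (V_le N1 ht) => xi h.
  have x0 : 0 <= expR 4 * (b xi * g0 xi) by rewrite mulr_ge0 ?expR_ge0// mulr_ge0.
  have i0 : (0 <= I N t xi)%E by apply: integral_ge0 => x _; rewrite lee_fin mulr_ge0// H_ge0.
  apply: (le_trans (sq_add_ereal (V_ge0 t xi N0) x0 (mule_ge0 _ i0) h)); first by rewrite lee_fin expR_ge0.
  apply: leeD => //.
  have -> : (2%:E * ((expR 4)%:E * I N t xi * ((expR 4)%:E * I N t xi)) =
    (2 * (expR 4) ^+ 2)%:E * (I N t xi * I N t xi))%E by rewrite [in RHS]EFinM expr2 [in RHS]EFinM -[in RHS]muleA [in LHS]muleACA.
  rewrite [(2 * expR 4 ^+ 2 * M)%:E]EFinM -muleA; apply: lee_wpmul2l; last exact: I2.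
  by rewrite lee_fin mulr_ge0// sqr_ge0.
have step1 : (sqint mu (V N t) <= data_const%:E + (2 * (expR 4) ^+ 2 * M)%:E *
    \int[leb1 R]_tau \int[mu]_xi (f (tau, xi))%:E)%E.
  apply: (@le_trans _ _ (\int[mu]_xi ((2 * (expR 4 * (b xi * g0 xi)) ^+ 2)%:E +
   (2 * (expR 4) ^+ 2 * M)%:E * \int[leb1 R]_tau (f (tau, xi))%:E))%E).
    apply: ae_ge0_le_integral => //.
    - by move=> x _; rewrite lee_fin sqr_ge0.
    - by apply/measurable_EFinP; exact: measurable_funX.
    - move=> x _; apply: adde_ge0; first by rewrite lee_fin mulr_ge0 ?sqr_ge0.
      apply: mule_ge0; first by rewrite lee_fin mulr_ge0 ?ltW// mulr_gt0 ?exprn_gt0 ?expR_gt0.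
      by apply: integral_ge0 => y _; rewrite lee_fin.
    - apply: emeasurable_funD.
        apply/measurable_EFinP; apply: measurable_funM => //; apply: measurable_funX.
        exact: measurable_funM.
      by apply: emeasurable_funM.
    - by apply: ae2_imp pt => x h _.
  rewrite ge0_integralD//; first last.
  - by apply: emeasurable_funM.
  - move=> x _; apply: mule_ge0; first by rewrite lee_fin mulr_ge0 ?ltW// mulr_gt0 ?exprn_gt0 ?expR_gt0.
    by apply: integral_ge0 => y _; rewrite lee_fin.
  - apply/measurable_EFinP; apply: measurable_funM => //; apply: measurable_funX.
    exact: measurable_funM.
  - by move=> x _; rewrite lee_fin mulr_ge0 ?sqr_ge0.
  apply: leeD.
    rewrite /data_const EFinM -(Lsq_ip Lg0) /sqint -ge0_integralZl//; first last.
    - by move=> x _; rewrite lee_fin sqr_ge0.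
    - by apply/measurable_EFinP; exact: measurable_funX.
    rewrite le_eqVlt; apply/orP; left; apply/eqP; apply: eq_integral => x _.
    by rewrite -EFinM exprMn mulrA.
  rewrite ge0_integralZl//; first last.
  - by rewrite lee_fin mulr_ge0 ?ltW// mulr_gt0 ?exprn_gt0 ?expR_gt0.
  - by move=> x _; apply: integral_ge0 => y _; rewrite lee_fin.
  by rewrite [X in (_ * X <= _)%E](esym tonelli).
have K0 : 0 <= flux_const ^+ 2 * (2 * J0 * L ^+ 2).
  by rewrite mulr_ge0 ?sqr_ge0// mulr_ge0 ?sqr_ge0// mulr_ge0 ?J0_ge0.
have step2 : (\int[leb1 R]_tau \int[mu]_xi (f (tau, xi))%:E <= (M * (flux_const ^+ 2 * (2 * J0 * L ^+ 2)))%:E)%E.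
  apply: (@le_trans _ _ (\int[leb1 R]_tau ((flux_const ^+ 2 * (2 * J0 * L ^+ 2))%:E * (ker t tau)%:E))%E).
    apply: ge0_le_integral => //.
    - by move=> x _; apply: integral_ge0 => y _; rewrite lee_fin.
    - by apply: emeasurable_funM => //; apply/measurable_EFinP; exact: mker.
    - move=> tau _; rewrite /f /=.
      under eq_integral do rewrite EFinM.
      rewrite ge0_integralZl//; first last.
      + by rewrite lee_fin.
      + by move=> x _; rewrite lee_fin sqr_ge0.
      + by apply/measurable_EFinP; apply: measurable_funX; exact: measurable_H1.
      rewrite muleC {1 2}/ker indicE.
      case: (boolP (tau \in _)) => [|_]; last by rewrite mulr0 !mule0.
      rewrite inE/= in_itv/= => ht'; apply: lee_wpmul2r; first by rewrite lee_fin mulr1 powR_ge0.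
      exact: integral_flux_le (VL _ ht').
  rewrite ge0_integralZl//; first last.
  - by move=> x _; rewrite lee_fin.
  - by apply/measurable_EFinP; exact: mker.
  apply: (@le_trans _ _ ((flux_const ^+ 2 * (2 * J0 * L ^+ 2))%:E * M%:E)%E); last by rewrite -EFinM mulrC.
  by apply: lee_wpmul2l; [rewrite lee_fin K0|exact: integral_ker].
rewrite -lee_fin -(Lsq_ip LV); apply: (le_trans step1); rewrite EFinD; apply: leeD => //.
apply: (le_trans (lee_wpmul2l _ step2)); first by rewrite lee_fin !mulr_ge0 ?sqr_ge0// ltW.
by rewrite -EFinM lee_fin /flux_const2; apply: le_of_eq; ring.
Qed.


Context (E0 : R) (gE0 : forall t, 0 <= t <= T -> ip mu (fun xi => b xi * g t xi) (fun xi => b xi * g t xi) <= E0).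

(* Induction on the cap 2^k: doubling the cap multiplies the squared norm by at most 4, and
   V_bound brings the bound 4 L back to L when the time is short.  No continuity in time of
   the weighted norms is needed. *)
Lemma gevrey_bound : exists T1 L, 0 < T1 <= T /\ forall t, 0 <= t <= T1 ->
  (sqint mu (fun xi => (b xi * (expR (2 * t * aniso alpha beta xi) * g t xi))%R) <= L%:E)%E.
Proof.
have /andP[T0 _] := hT; have /andP[p0 p1] := hp; have q0 : 0 < 1 - p by rewrite subr_gt0.
have d0 : 0 <= data_const by rewrite /data_const mulr_ge0 ?ip_ge0// mulr_ge0 ?sqr_ge0.
have F0 : 0 <= flux_const2.
  by rewrite /flux_const2; apply: mulr_ge0; [|apply: mulr_ge0; [|apply: mulr_ge0]]; rewrite ?mulr_ge0 ?sqr_ge0 ?J0_ge0.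
have E00 : 0 <= E0.
  have t00 : 0 <= (0 : R) <= T by rewrite lexx ltW.
  exact: le_trans (ip_ge0 _ _) (gE0 t00).
(* [E0] covers the start of the induction, where the cap is 1, and [2 * data_const] leaves room L /
   2 for the flux. *)
pose L := 2 * data_const + E0 + 1; have L1 : 1 <= L by rewrite /L; lra.
(* With 32 M F L <= 1, where F is [flux_const2], the flux term F (4 M L)^2 is at most L / 2; the 4 L
   is the bound after doubling the cap. *)
pose M := (1 + 32 * flux_const2 * L)^-1.
have FL : 0 <= flux_const2 * L by rewrite mulr_ge0// (le_trans ler01).
have M0 : 0 < M by rewrite invr_gt0; lra.
have MF : M * (1 + 32 * flux_const2 * L) = 1 by rewrite mulVf// gt_eqF//; lra.
have M1 : M <= 1 by rewrite invf_le1; lra.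
have small : flux_const2 * (M * (4 * L)) ^+ 2 <= L / 2.
  have e : flux_const2 * (M * (4 * L)) ^+ 2 = (16 * M * (flux_const2 * L)) * (L * M) by ring.
  have h1 : 16 * M * (flux_const2 * L) <= 2^-1 by lra.
  rewrite e; apply: (@le_trans _ _ (2^-1 * L)); last by rewrite mulrC.
  apply: ler_pM => //; first by rewrite mulr_ge0// mulr_ge0// ltW.
    by rewrite mulr_ge0 ?(ltW M0)//; lra.
  by rewrite ler_piMr//; lra.
(* The second entry solves t^(1 - p) / (1 - p) = M. *)
pose T1 := Num.min T ((M * (1 - p)) `^ (1 - p)^-1).
have Mp : 0 < M * (1 - p) by rewrite mulr_gt0.
have T10 : 0 < T1 by rewrite lt_min T0 powR_gt0.
have T1T : T1 <= T by rewrite ge_min lexx.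
have T1M t : 0 <= t <= T1 -> t `^ (1 - p) / (1 - p) <= M.
  move=> /andP[t0 tT]; rewrite ler_pdivrMr//.
  have -> : M * (1 - p) = ((M * (1 - p)) `^ (1 - p)^-1) `^ (1 - p).
    by rewrite -powRrM mulVf ?gt_eqF// powRr1// ltW.
  apply: ge0_ler_powR; rewrite ?nnegrE ?powR_ge0//; first exact: ltW.
  by rewrite (le_trans tT)// ge_min lexx orbT.
have tT1 t : 0 <= t <= T1 -> 0 <= t <= T by move=> /andP[-> tT]; rewrite (le_trans tT).
have N1 k : 1 <= (2 : R) ^+ k by rewrite exprn_ege1// ler1n.
have N0 k : 0 <= (2 : R) ^+ k by rewrite exprn_ge0.
have boot k : forall t, 0 <= t <= T1 -> ip mu (V (2 ^+ k) t) (V (2 ^+ k) t) <= L.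
  elim: k => [|k IH] t ht.
    have ht' := tT1 t ht.
    apply: (@le_trans _ _ E0); last by rewrite /L; lra.
    apply: (le_trans _ (gE0 ht')); apply: ip_le; [exact: Lsq_V|exact: Lsq_V|exact: Lg|exact: Lg|].
    move=> x; apply: ler_pM; rewrite ?V_ge0// ler_wpM2l// ler_piMl// expr0; exact: capw_le_cap.
  have ht' := tT1 t ht.
  apply: (le_trans (@V_bound _ t (4 * L) M (N1 k.+1) ht' M0 (T1M t ht) _)).
    move=> tau /andP[tau0 taut].
    have htau : 0 <= tau <= T1 by rewrite tau0; case/andP: ht => _ h; rewrite (le_trans (ltW taut)).
    have htau' := tT1 tau htau.
    have LV := Lsq_V (N0 k) htau'.
    apply: (@le_trans _ _ (4 * ip mu (V (2 ^+ k) tau) (V (2 ^+ k) tau))); last by rewrite ler_wpM2l// IH.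
    have -> : 4 * ip mu (V (2 ^+ k) tau) (V (2 ^+ k) tau) =
      ip mu (fun x => 2 * V (2 ^+ k) tau x) (fun x => 2 * V (2 ^+ k) tau x).
      by rewrite (ipZl _ LV (LsqZ _ LV)) (ipZr _ LV LV); ring.
    have le2 x : V (2 ^+ k.+1) tau x <= 2 * V (2 ^+ k) tau x.
      have -> : 2 * V (2 ^+ k) tau x = b x * ((2 * w (2 ^+ k) tau x) * g tau x) by rewrite /V; ring.
      by rewrite /V ler_wpM2l// ler_wpM2r// exprS; exact: capw_double.
    apply: ip_le; [exact: Lsq_V|exact: Lsq_V|exact: LsqZ|exact: LsqZ|].
    by move=> x; apply: ler_pM; rewrite ?V_ge0.
  by move: small; rewrite /L; lra.
exists T1, L; split; first by rewrite T10.
move=> t ht; have ht' := tT1 t ht.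
apply: (@fatou_sqint _ (plane R) R mu (fun k => V (2 ^+ k) t)).
- by move=> k; exact: Lsq_meas (Lsq_V (N0 k) ht').
- move=> x; apply: cvgMl_tmp; apply: cvgMr_tmp; exact: capw_cvg.
- by apply: nearW => k; rewrite (Lsq_ip (Lsq_V (N0 k) ht')) lee_fin boot.
Qed.

End GevreyEstimate.

(** * Mild solutions *)

Section Sobolev.
Context (R : realType).
Notation mu := (leb2 R).
Implicit Types (f g : R * R -> R) (xi : R * R) (s t : R).

Definition bessel s f xi := jb xi `^ (s / 2) * ampl f xi.

Lemma bessel_ge0 s f xi : 0 <= bessel s f xi.
Proof. by rewrite mulr_ge0 ?powR_ge0// ampl_ge0. Qed.

Lemma sobolev_norm_sqint s f : sobolev_norm s f = ((sqint mu (bessel s f)) `^ 2^-1)%E.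
Proof.
congr (_ `^ _)%E; apply: eq_integral => xi _; congr EFin.
by rewrite /bessel exprMn -[(_ `^ _) ^+ 2]powR_mulrn ?powR_ge0// -powRrM divfK.
Qed.

Lemma measurable_bessel s f : Lsq mu f -> mfun2 R (bessel s f).
Proof. by move=> Lf; apply: measurable_funM; [exact: measurable_jb_pow|exact: measurable_ampl]. Qed.

Lemma sobolevP s f : sobolev s f <-> Lsq mu f /\ Lsq mu (bessel s f).
Proof.
split => [[/L2P Lf h]|[Lf [_ h]]]; split => //; last 2 first.
- exact/L2P.
- by rewrite sobolev_norm_sqint poweR_lty.
split; first exact: measurable_bessel.
move: h; rewrite sobolev_norm_sqint; have := sqint_ge0 mu (bessel s f).
by case: (sqint _ _) => [x| |]//; rewrite ?ltry// poweRyr ?invr_eq0.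
Qed.

Definition sob s f := Num.sqrt (ip mu (bessel s f) (bessel s f)).

Lemma sobolev_normE s f : sobolev s f -> sobolev_norm s f = (sob s f)%:E.
Proof.
move=> /sobolevP[_ Lb]; rewrite sobolev_norm_sqint (Lsq_ip Lb) poweR_EFin.
by rewrite powR12_sqrt// ip_ge0.
Qed.

Lemma sobolevB s f g : sobolev s f -> sobolev s g -> sobolev s (fun x => f x - g x).
Proof.
move=> /sobolevP[Lf Bf] /sobolevP[Lg Bg]; have Ld := LsqB Lf Lg.
apply/sobolevP; split; first exact: Ld.
split; first exact: measurable_bessel Ld.
apply: le_lt_trans (LsqD Bf Bg).2.
apply: ae_ge0_le_integral => //.
- by move=> x _; rewrite lee_fin sqr_ge0.
- by apply/measurable_EFinP; apply: measurable_funX; exact: measurable_bessel.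
- by move=> x _; rewrite lee_fin sqr_ge0.
- by apply/measurable_EFinP; apply: measurable_funX; exact: Lsq_meas (LsqD Bf Bg).
apply: ae2_imp (fourierB Lf Lg) => xi e _; rewrite lee_fin.
rewrite ler_pXn2r ?nnegrE ?addr_ge0 ?bessel_ge0//.
rewrite /bessel -mulrDr ler_wpM2l ?powR_ge0// /ampl.
by rewrite e; apply: le_trans (le_normcD _ _) _; rewrite normcN.
Qed.

Lemma ip_le_sob s f : 0 <= s -> sobolev s f -> c2pi R * ip mu f f <= sob s f ^+ 2.
Proof.
move=> s0 /sobolevP[Lf Lb]; rewrite /sob sqr_sqrtr ?ip_ge0// -(ip_ampl Lf).
have La := Lsq_ampl Lf; apply: ip_le => // xi.
have h : ampl f xi <= bessel s f xi.
  rewrite /bessel ler_peMl ?ampl_ge0//.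
  by have := ler_powR (jb_ge1 xi) (divr_ge0 s0 (ler0n R 2)); rewrite powRr0.
by apply: ler_pM => //; exact: ampl_ge0.
Qed.

End Sobolev.

(** * Left-endpoint grids and joint measurability *)

Section Grid.
Context (R : realType).
Implicit Types (t T : R).

Definition cell (n i : nat) : set R := `[i%:R / n.+1%:R, i.+1%:R / n.+1%:R[%classic.
(** Rounding down keeps the sampled times inside the given time interval and makes the Gevrey weight
    at the sampled time no larger than the one at t. *)
Definition grid (n : nat) t : R := (Num.trunc (t * n.+1%:R))%:R / n.+1%:R.

Lemma measurable_cell n i : measurable (cell n i).
Proof. exact: measurable_itv. Qed.

Lemma indic_cell n i t : 0 <= t -> \1_(cell n i) t = (Num.trunc (t * n.+1%:R) == i)%:R :> R.
Proof.
move=> t0; rewrite indicE; congr ((nat_of_bool _)%:R).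
rewrite truncn_eq ?mulr_ge0//; apply/idP/idP; rewrite inE /cell /= in_itv/=.
  by rewrite ler_pdivrMr// ltr_pdivlMr.
by rewrite ler_pdivrMr// ltr_pdivlMr.
Qed.

Lemma cell_sum n K (c : nat -> R) t : 0 <= t -> (Num.trunc (t * n.+1%:R) < K)%N ->
  \sum_(i < K) \1_(cell n i) t * c i = c (Num.trunc (t * n.+1%:R)).
Proof.
move=> t0 tK; rewrite (bigD1 (Ordinal tK))//= indic_cell// eqxx mul1r big1 ?addr0// => i hi.
rewrite indic_cell//; case: eqP => [e|_]; last by rewrite mul0r.
by move: hi; rewrite -val_eqE /= e eqxx.
Qed.

Lemma grid_ge0 n t : 0 <= grid n t. Proof. by rewrite divr_ge0. Qed.

Lemma grid_le n t : 0 <= t -> grid n t <= t.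
Proof. by move=> t0; rewrite ler_pdivrMr// truncn_le mulr_ge0. Qed.

Lemma grid_in n t T : 0 <= t <= T -> 0 <= grid n t <= T.
Proof. by move=> /andP[t0 tT]; rewrite grid_ge0 (le_trans (grid_le n t0)). Qed.

Lemma grid_dist n t : 0 <= t -> t - grid n t <= n.+1%:R^-1.
Proof.
move=> t0; have /andP[_ h] := truncn_itv (mulr_ge0 t0 (ler0n R n.+1)).
rewrite lerBlDr -[X in _ <= X + _]mul1r -mulrDl ler_pdivlMr//.
by rewrite (le_trans (ltW h))// -addn1 natrD addrC.
Qed.

Lemma near_grid t (d : R) : 0 <= t -> 0 < d -> \forall n \near \oo, `|grid n t - t| < d.
Proof.
move=> t0 d0; near=> n; rewrite distrC ger0_norm ?subr_ge0 ?grid_le//.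
apply: (le_lt_trans (grid_dist n t0)); near: n.
have h := @near_infty_natSinv_lt R (PosNum d0).
by apply: h.
Unshelve. all: by end_near. Qed.

Lemma trunc_lt n t T : t <= T ->
  (Num.trunc (t * n.+1%:R) < (Num.trunc (T * n.+1%:R)).+1)%N.
Proof. by move=> tT; rewrite ltnS le_truncn// ler_wpM2r. Qed.

(** Sampling at left endpoints gives finite sums of products of a function of time and a function of
    frequency, which are jointly measurable and converge everywhere. *)
Lemma measurable_grid_limit T (F : R -> R * R -> R) : 0 <= T ->
  (forall t, 0 <= t <= T -> mfun2 R (F t)) ->
  (forall t xi, 0 <= t <= T -> (fun n => F (grid n t) xi) @ \oo --> F t xi) ->
  measurable_fun [set: line R * plane R] (fun z => \1_`[0, T] z.1 * F z.1 z.2).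
Proof.
move=> T0 mF cF.
have m1 : measurable_fun [set: line R * plane R] (fun z : line R * plane R => z.1) by exact: measurable_fst.
have m2 : measurable_fun [set: line R * plane R] (fun z : line R * plane R => z.2) by exact: measurable_snd.
pose c n i xi := if i%:R / n.+1%:R <= T then F (i%:R / n.+1%:R) xi else 0.
pose h n (z : line R * plane R) := \1_`[0, T] z.1 *
  \sum_(i < (Num.trunc (T * n.+1%:R)).+1) \1_(cell n i) z.1 * c n i z.2.
apply: (@measurable_fun_cvg _ _ _ _ h).
- move=> n; apply: measurable_funM; first exact: (measurableT_comp (measurable_indic _) m1).
  apply: measurable_sum => i; apply: measurable_funM.
    exact: (measurableT_comp (measurable_indic (measurable_cell n i)) m1).
  have [h'|h'] := boolP (i%:R / n.+1%:R <= T).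
    have mFi : mfun2 R (F (i%:R / n.+1%:R)) by apply: mF; rewrite divr_ge0.
    have -> : c n i = F (i%:R / n.+1%:R) by apply/funext => xi; rewrite /c h'.
    exact: (measurableT_comp mFi m2).
  have -> : c n i = fun=> 0 by apply/funext => xi; rewrite /c (negbTE h').
  exact: measurable_cst.
- move=> z _; rewrite /h indicE.
  case: (boolP (z.1 \in _)) => [|_]; last first.
    by rewrite mul0r (_ : (fun n => _) = cst 0); [exact: cvg_cst|apply/funext => n; rewrite mul0r].
  rewrite inE/= in_itv/= => hz; have /andP[z0 zT] := hz.
  rewrite mul1r (_ : (fun n => _) = (fun n => F (grid n z.1) z.2)); first exact: cF.
  apply/funext => n; rewrite mul1r (@cell_sum n _ (fun i => c n i z.2) z.1 z0 (trunc_lt n zT)) /c.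
  by rewrite (le_trans (grid_le n z0)).
Qed.

End Grid.

(** * The mild equation as an inequality between amplitudes *)

Section MildAmplitude.
Context (R : realType) (alpha beta s T0 : R) (theta0 : R * R -> R) (theta : R -> R * R -> R).
Context (s0 : 0 <= s) (T00 : 0 < T0) (htheta0 : sobolev s theta0)
  (hmild : mild_solution alpha beta s T0 theta0 theta).
Notation mu := (leb2 R).

Lemma sobolev_theta t : 0 <= t <= T0 -> sobolev s (theta t).
Proof. by have [[h _] _] := hmild; exact: h. Qed.

Lemma Lsq_theta t : 0 <= t <= T0 -> Lsq mu (theta t).
Proof. by move=> /sobolev_theta/sobolevP[]. Qed.

Lemma sob_grid_cvg t : 0 <= t <= T0 ->
  (fun n => sob s (fun x => theta (grid n t) x - theta t x)) @ \oo --> (0 : R).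
Proof.
move=> ht; have /andP[t0 tT] := ht; have [[_ hc] _] := hmild.
apply/cvgrPdist_lt => e e0; have [d d0 hd] := hc t ht e e0.
have [N _ hN] := near_grid t0 d0; exists N => //= n Nn.
have h := hd _ (grid_in n ht) (hN n Nn).
have hs := sobolevB (sobolev_theta (grid_in n ht)) (sobolev_theta ht).
rewrite sub0r normrN ger0_norm ?sqrtr_ge0// -lte_fin -(sobolev_normE hs).
exact: h.
Qed.

Lemma theta_grid_cvg t : 0 <= t <= T0 -> cvgL2 mu (fun n => theta (grid n t)) (theta t).
Proof.
move=> ht; have c0 := c2pi_gt0 R.
have h2 : (fun n => (c2pi R)^-1 * (sob s (fun x => theta (grid n t) x - theta t x) *
    sob s (fun x => theta (grid n t) x - theta t x))) @ \oo --> (0 : R).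
  rewrite -[X in _ --> X](mulr0 (c2pi R)^-1) -[X in _ * X](mulr0 0).
  by apply: cvgMl_tmp; apply: cvgM; exact: sob_grid_cvg.
apply: (squeeze_cvgr _ (cvg_cst 0) h2); apply: nearW => n; rewrite ip_ge0/=.
have hn := ip_le_sob s0 (sobolevB (sobolev_theta (grid_in n ht)) (sobolev_theta ht)).
rewrite (ler_pdivlMl _ _ c0) -expr2; exact: hn.
Qed.

(** The cutoff in time extends the flux by 0, so that joint measurability can be stated on the whole
    line. *)
Definition fluxR t xi := \1_`[0, T0] t * complex.Re (div_flux_hat (theta t) xi).
Definition fluxI t xi := \1_`[0, T0] t * complex.Im (div_flux_hat (theta t) xi).

Lemma measurable_fluxR : measurable_fun [set: line R * plane R] (fun z => fluxR z.1 z.2).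
Proof.
apply: (measurable_grid_limit (ltW T00) (F := fun t xi => complex.Re (div_flux_hat (theta t) xi))).
- by move=> t ht; have [] := measurable_div_flux (Lsq_theta ht).
- move=> t xi ht.
  by have [] := div_flux_cvg xi (fun n => Lsq_theta (grid_in n ht)) (Lsq_theta ht) (theta_grid_cvg ht).
Qed.

Lemma measurable_fluxI : measurable_fun [set: line R * plane R] (fun z => fluxI z.1 z.2).
Proof.
apply: (measurable_grid_limit (ltW T00) (F := fun t xi => complex.Im (div_flux_hat (theta t) xi))).
- by move=> t ht; have [] := measurable_div_flux (Lsq_theta ht).
- move=> t xi ht.
  by have [] := div_flux_cvg xi (fun n => Lsq_theta (grid_in n ht)) (Lsq_theta ht) (theta_grid_cvg ht).
Qed.

Definition flux t xi := `|fluxR t xi| + `|fluxI t xi|.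

Lemma flux_ge0 t xi : 0 <= flux t xi.
Proof. by rewrite addr_ge0. Qed.

Lemma measurable_flux : measurable_fun [set: line R * plane R] (fun z => flux z.1 z.2).
Proof.
apply: measurable_funD; apply: measurableT_comp => //; [exact: measurable_fluxR|exact: measurable_fluxI].
Qed.

Lemma flux_le_conv t xi : 0 <= t <= T0 ->
  flux t xi <= (32 / c2pi R) * norm2 xi * conv (ampl (theta t)) (ampl (theta t)) xi.
Proof.
move=> ht; have h := div_flux_le xi (Lsq_theta ht).
have e : flux t xi = `|complex.Re (div_flux_hat (theta t) xi)| + `|complex.Im (div_flux_hat (theta t) xi)|.
  by rewrite /flux /fluxR /fluxI indicE mem_set ?mul1r//= in_itv.
have hn (z : R[i]) : `|complex.Re z| + `|complex.Im z| <= 2 * Normc.normc z.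
  have n0 := normc_ge0 z; have nz := normc_sqr z.
  have key (u : R) : u ^+ 2 <= Normc.normc z ^+ 2 -> `|u| <= Normc.normc z.
    by move=> hu; rewrite -(@ler_pXn2r _ 2)// ?nnegrE// real_normK ?num_real.
  have := key (complex.Re z); have := key (complex.Im z).
  rewrite nz lerDl lerDr !sqr_ge0 => /(_ isT) h1 /(_ isT) h2; lra.
rewrite e; apply: (le_trans (hn _)).
have -> : 32 / c2pi R * norm2 xi * conv (ampl (theta t)) (ampl (theta t)) xi =
  2 * (16 / c2pi R * norm2 xi * conv (ampl (theta t)) (ampl (theta t)) xi) by ring.
by rewrite ler_wpM2l.
Qed.

(** Without integrability there is still something to say: if the integral is infinite, [fine] gives
    the real value 0, and the inequality holds trivially. *)
Lemma normr_Rintegral_le (D : set R) (f : R -> R) : measurable D -> measurable_fun D f ->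
  ((`|Rintegral (leb1 R) D f|)%:E <= \int[leb1 R]_(x in D) (`|f x|)%:E)%E.
Proof.
move=> mD mf; have mfE : measurable_fun D (EFin \o f) by exact/measurable_EFinP.
have := le_abse_integral (leb1 R) mD mfE; rewrite /Rintegral.
have i0 : (0 <= \int[leb1 R]_(x in D) (`|f x|)%:E)%E by apply: integral_ge0 => x _; rewrite lee_fin.
by case: (\int[_]_(_ in _) (EFin \o f) _)%E => [r| |] //= _; rewrite normr0.
Qed.

(** The Duhamel integrand is not known to be integrable at a given frequency, so the right side is
    kept in [\bar R]. *)
Lemma mild_ampl t : 0 <= t <= T0 -> {ae mu, forall xi,
  ((ampl (theta t) xi)%:E <= (expR (- (t * aniso (2 * alpha) (2 * beta) xi)) * ampl theta0 xi)%:E +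
    \int[leb1 R]_tau (\1_`[0, t[ tau *
       (expR (- ((t - tau) * aniso (2 * alpha) (2 * beta) xi)) * flux tau xi))%:E)%E}.
Proof.
move=> ht; have /andP[t0 tT] := ht; have [_ hm] := hmild.
apply: ae2_imp (hm t ht) => xi; set A := aniso _ _ xi => e.
pose ex tau := expR (- ((t - tau) * A)).
pose q (tau : R) := (ex tau)%:C%C * div_flux_hat (theta tau) xi.
have mex : measurable_fun [set: line R] ex.
  apply: (measurableT_comp (@measurable_expR R)); apply: measurable_funN.
  by apply: measurable_funM => //; exact: measurable_funB.
have in0T tau : `[0, t]%classic tau -> 0 <= tau <= T0.
  by rewrite /= in_itv/= => /andP[-> h]; rewrite (le_trans h).
have reE tau : `[0, t]%classic tau -> complex.Re (q tau) = ex tau * fluxR tau xi.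
  move=> h; rewrite /fluxR indicE mem_set ?mul1r; last by rewrite /= in_itv/= in0T.
  by rewrite /q; case: (div_flux_hat _ _) => u v /=; ring.
have imE tau : `[0, t]%classic tau -> complex.Im (q tau) = ex tau * fluxI tau xi.
  move=> h; rewrite /fluxI indicE mem_set ?mul1r; last by rewrite /= in_itv/= in0T.
  by rewrite /q; case: (div_flux_hat _ _) => u v /=; ring.
have mR : measurable_fun [set: line R] (fun tau => fluxR tau xi).
  exact: (measurableT_comp measurable_fluxR (measurable_pair2 xi)).
have mI : measurable_fun [set: line R] (fun tau => fluxI tau xi).
  exact: (measurableT_comp measurable_fluxI (measurable_pair2 xi)).
have mt : measurable (`[0, t]%classic : set (line R)) by exact: measurable_itv.
have Rle : ((`|Rintegral (leb1 R) `[0, t] (fun tau => complex.Re (q tau))|)%:E <=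
   \int[leb1 R]_(tau in `[0%R, t]) (ex tau * `|fluxR tau xi|)%:E)%E.
  have -> : Rintegral (leb1 R) `[0, t] (fun tau => complex.Re (q tau)) =
      Rintegral (leb1 R) `[0, t] (fun tau => ex tau * fluxR tau xi).
    by apply: eq_Rintegral => tau; rewrite inE => /reE.
  apply: (le_trans (normr_Rintegral_le mt (measurable_funTS (measurable_funM mex mR)))).
  rewrite le_eqVlt; apply/orP; left; apply/eqP; apply: eq_integral => tau _.
  by rewrite normrM (ger0_norm (expR_ge0 _)).
have Ile : ((`|Rintegral (leb1 R) `[0, t] (fun tau => complex.Im (q tau))|)%:E <=
   \int[leb1 R]_(tau in `[0%R, t]) (ex tau * `|fluxI tau xi|)%:E)%E.
  have -> : Rintegral (leb1 R) `[0, t] (fun tau => complex.Im (q tau)) =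
      Rintegral (leb1 R) `[0, t] (fun tau => ex tau * fluxI tau xi).
    by apply: eq_Rintegral => tau; rewrite inE => /imE.
  apply: (le_trans (normr_Rintegral_le mt (measurable_funTS (measurable_funM mex mI)))).
  rewrite le_eqVlt; apply/orP; left; apply/eqP; apply: eq_integral => tau _.
  by rewrite normrM (ger0_norm (expR_ge0 _)).
have -> : (\int[leb1 R]_tau (\1_`[0, t[ tau * (ex tau * flux tau xi))%:E =
   \int[leb1 R]_(tau in `[0%R, t]) (ex tau * `|fluxR tau xi|)%:E +
   \int[leb1 R]_(tau in `[0%R, t]) (ex tau * `|fluxI tau xi|)%:E)%E.
  rewrite -ge0_integralD//; first last.
  - apply/measurable_EFinP/measurable_funTS; apply: measurable_funM => //; exact: measurableT_comp.
  - by move=> tau _; rewrite lee_fin mulr_ge0 ?expR_ge0.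
  - apply/measurable_EFinP/measurable_funTS; apply: measurable_funM => //; exact: measurableT_comp.
  - by move=> tau _; rewrite lee_fin mulr_ge0 ?expR_ge0.
  (* The endpoint t is a null set; the half-open interval is the form used by the Gevrey
     estimate. *)
  rewrite -integral_itv_bndo_bndc; last first.
    apply: emeasurable_funD; apply/measurable_EFinP/measurable_funTS; apply: measurable_funM => //; exact: measurableT_comp.
  rewrite [RHS]integral_mkcond; apply: eq_integral => tau _; rewrite patchE indicE.
  case: ifP => _; last by rewrite mul0r.
  by rewrite mul1r -EFinD -mulrDr.
apply: (@le_trans _ _ ((expR (- (t * A)) * ampl theta0 xi)%:E +
   ((`|Rintegral (leb1 R) `[0, t] (fun tau => complex.Re (q tau))|)%:E +
    (`|Rintegral (leb1 R) `[0, t] (fun tau => complex.Im (q tau))|)%:E))%E).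
  rewrite -!EFinD lee_fin /ampl.
  move: e; rewrite /q; set z1 := Cintegral _ _ _ => e.
  move: e; move: (fourier (theta t) xi) (fourier theta0 xi) => z z0 ->.
  apply: (le_trans (le_normcD _ _)); apply: lerD.
    rewrite Normc.normcM /= expr0n/= addr0 sqrtr_sqr ger0_norm ?expR_ge0//.
  rewrite normcN; exact: le_normc.
by apply: leeD => //; exact: leeD.
Qed.

End MildAmplitude.

(** * Choice of exponents and the Gevrey bound for the solution *)

Section GevreyMild.
Context (R : realType) (alpha beta s T0 : R) (theta0 : R * R -> R) (theta : R -> R * R -> R).
Context (halpha : 2^-1 < alpha < 1) (hbeta : 2^-1 < beta < 1)
    (hs : Num.max (2 - 2 * alpha) (2 - 2 * beta) < s < 2)
    (htheta0 : sobolev s theta0) (hT0 : 0 < T0)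
    (hmild : mild_solution alpha beta s T0 theta0 theta)
    (hbound : (ereal_sup [set sobolev_norm s (theta t) | t in `[0%R, T0]]
               <= 2%:E * sobolev_norm s theta0)%E).
Notation mu := (leb2 R).

Lemma gevrey_mild : exists T1 L, 0 < T1 <= T0 /\ forall t, 0 <= t <= T1 ->
  (sqint mu (fun xi => (expR (2 * t * aniso alpha beta xi) * bessel s (theta t) xi)%R) <= L%:E)%E.
Proof.
have /andP[s1 s2] := hs; have /andP[a1 a2] := halpha; have /andP[b1 b2] := hbeta.
move: s1; rewrite gt_max => /andP[sa sb].
have s0 : 0 < s by lra.
pose a := Num.min alpha beta.
have haa : a <= alpha by rewrite ge_min lexx.
have hab : a <= beta by rewrite ge_min lexx orbT.
have ha1 : 2^-1 < a by rewrite lt_min a1.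
have ha2 : a < 1 by rewrite gt_min a2.
have has : 2 - 2 * a < s by rewrite /a; case: (leP alpha beta) => _.
(* The threshold for 2 a p: exceeding 1 makes the frequency decay nonnegative, exceeding 2 - s makes
   the power of [jb] integrable over the plane. *)
pose m := Num.max 1 (2 - s).
have m1 : 1 <= m by rewrite le_max lexx.
have m2 : 2 - s <= m by rewrite le_max lexx orbT.
have m3 : m < 2 * a by rewrite gt_max; apply/andP; split; lra.
(* The midpoint between the smallest admissible value m / (2 a) and 1. *)
pose p := (1 + m / (2 * a)) / 2.
have a20 : 0 < 2 * a by lra.
have q1 : m / (2 * a) < 1 by rewrite ltr_pdivrMr// mul1r.
have q0 : 0 < m / (2 * a) by rewrite divr_gt0//; lra.
have hp : 0 < p < 1 by rewrite /p; apply/andP; split; lra.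
have pm : m < 2 * a * p.
  have e : 2 * a * p = (2 * a + m) / 2 by rewrite /p; field; rewrite gt_eqF//; lra.
  by rewrite e; lra.
pose T := Num.min T0 1.
have hT : 0 < T <= 1 by rewrite lt_min hT0 ltr01/= ge_min lexx orbT.
have TT0 t : 0 <= t <= T -> 0 <= t <= T0.
  by move=> /andP[-> h]; rewrite (le_trans h)// ge_min lexx.
have s0' := ltW s0.
have h0 := proj2 ((sobolevP s theta0).1 htheta0).
have hC : 0 <= 32 / c2pi R by rewrite divr_ge0// ltW// c2pi_gt0.
have E0 t : 0 <= t <= T -> ip mu (bessel s (theta t)) (bessel s (theta t)) <= (2 * sob s theta0) ^+ 2.
  move=> ht; have st := sobolev_theta hmild (TT0 t ht).
  have : (sobolev_norm s (theta t) <= 2%:E * sobolev_norm s theta0)%E.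
    apply: le_trans hbound; apply: ereal_sup_ubound; exists t => //=.
    by rewrite in_itv/= TT0.
  rewrite (sobolev_normE st) (sobolev_normE htheta0) -EFinM lee_fin => h.
  rewrite -[leLHS]sqr_sqrtr ?ip_ge0// -/(sob _ _).
  by rewrite ler_pXn2r// ?nnegrE ?mulr_ge0 ?sqrtr_ge0.
have [|||||||||||||T1 [L [/andP[T10 T1T] hL]]] := @gevrey_bound R alpha beta s a p T (32 / c2pi R) (ampl theta0)
   (fun t => ampl (theta t)) (flux T0 theta) _ haa hab _ _ hp _ s0' _ hT hC _ h0 _ _ _ _ _ _ _ _ E0.
- by rewrite (lt_trans _ ha1) ?invr_gt0//= ltW.
- by rewrite (lt_trans _ a1) ?invr_gt0//= ltW.
- by rewrite (lt_trans _ b1) ?invr_gt0//= ltW.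
- by rewrite subr_ge0 ltW// (le_lt_trans m1 pm).
- lra.
- exact: ampl_ge0.
- by move=> t; exact: ampl_ge0.
- by move=> t ht; exact: measurable_ampl (Lsq_theta hmild (TT0 t ht)).
- by move=> t ht; exact: proj2 ((sobolevP s _).1 (sobolev_theta hmild (TT0 t ht))).
- by move=> t xi; exact: flux_ge0.
- exact: measurable_flux s0' hT0 hmild.
- by move=> t xi ht; apply: (flux_le_conv hmild); exact: TT0.
- by move=> t ht; apply: (mild_ampl s0' hT0 hmild); exact: TT0.
exists T1, L; split.
  by rewrite T10 (le_trans T1T)// ge_min lexx.
move=> t ht; apply: le_trans (hL t ht).
rewrite le_eqVlt; apply/orP; left; apply/eqP; apply: eq_integral => xi _.
by rewrite /bessel; congr (_ ^+ 2)%:E; ring.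
Qed.

End GevreyMild.

(** * Regularity of the smoothed solution *)

Section GevreyRegularity.
Context (R : realType) (alpha beta s T1 L : R) (theta G : R -> R * R -> R).
Notation mu := (leb2 R).
Notation Phi := (aniso alpha beta).
Implicit Types (xi : R * R) (t : R) (f g : R * R -> R).

Lemma normc_lin_le (x y : R) (z1 z2 : R[i]) :
  Normc.normc (x%:C%C * z1 + y%:C%C * z2) <= `|x| * Normc.normc z1 + `|y| * Normc.normc z2.
Proof.
apply: (le_trans (le_normcD _ _)).
by rewrite !Normc.normcM /= expr0n/= !addr0 !sqrtr_sqr.
Qed.

Lemma Lsq_le_ae f g : mfun2 R f -> Lsq mu g -> (forall x, 0 <= f x) ->
  {ae mu, forall x, f x <= g x} -> Lsq mu f.
Proof.
move=> mf Lg f0 fg; split => //; apply: le_lt_trans Lg.2.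
have mg := Lsq_meas Lg.
apply: ae_ge0_le_integral => //.
- by move=> x _; rewrite lee_fin sqr_ge0.
- by apply/measurable_EFinP; exact: measurable_funX.
- by move=> x _; rewrite lee_fin sqr_ge0.
- by apply/measurable_EFinP; exact: measurable_funX.
- apply: ae2_imp fg => x h _; rewrite lee_fin ler_pXn2r// nnegrE//.
  exact: le_trans h.
Qed.

Lemma ip_ae_le f g : Lsq mu f -> Lsq mu g -> (forall x, 0 <= f x) ->
  {ae mu, forall x, f x <= g x} -> ip mu f f <= ip mu g g.
Proof.
move=> Lf Lg f0 fg; apply: (le_trans (ler_norm _)).
have h : {ae mu, forall x, `|f x| <= g x} by apply: ae2_imp fg => x; rewrite ger0_norm.
exact: ip_le_ae.
Qed.

Definition gexp t xi := expR (t * Phi xi).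

Lemma gexp_ge0 t xi : 0 <= gexp t xi. Proof. exact: expR_ge0. Qed.

Lemma gexp_le t t' xi : t <= t' -> gexp t xi <= gexp t' xi.
Proof. by move=> tt'; rewrite ler_expR ler_wpM2r// aniso_ge0. Qed.

Lemma measurable_gexp t : mfun2 R (gexp t).
Proof.
apply: (measurableT_comp (@measurable_expR R)); apply: measurable_funM => //.
exact: measurable_aniso.
Qed.

Context (T10 : 0 < T1) (stheta : forall t, 0 <= t <= T1 -> sobolev s (theta t)).
Context (ctheta : forall t, 0 <= t <= T1 ->
  (fun n => sob s (fun x => theta (grid n t) x - theta t x)) @ \oo --> (0 : R)).
Context (bound : forall t, 0 <= t <= T1 ->
  (sqint mu (fun xi => (expR (2 * t * Phi xi) * bessel s (theta t) xi)%R) <= L%:E)%E).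

Lemma Lsq_stheta t : 0 <= t <= T1 -> Lsq mu (theta t).
Proof. by move=> /stheta/sobolevP[]. Qed.

Lemma Lsq_bound t : 0 <= t <= T1 -> Lsq mu (fun xi => gexp (2 * t) xi * bessel s (theta t) xi).
Proof.
move=> ht; split; last by apply: le_lt_trans (bound ht) _; exact: ltry.
by apply: measurable_funM; [exact: measurable_gexp|exact: measurable_bessel (Lsq_stheta ht)].
Qed.

Lemma Lsq_gexp t : 0 <= t <= T1 -> Lsq mu (fun xi => gexp t xi * bessel s (theta t) xi).
Proof.
move=> ht; apply: (Lsq_le _ (Lsq_bound ht)).
  by apply: measurable_funM; [exact: measurable_gexp|exact: measurable_bessel (Lsq_stheta ht)].
move=> xi; rewrite !normrM ler_wpM2r// !ger0_norm ?gexp_ge0// gexp_le//.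
by case/andP: ht => t0 _; lra.
Qed.

Lemma ip_bound t : 0 <= t <= T1 ->
  ip mu (fun xi => gexp (2 * t) xi * bessel s (theta t) xi) (fun xi => gexp (2 * t) xi * bessel s (theta t) xi) <= L.
Proof. by move=> ht; rewrite -lee_fin -(Lsq_ip (Lsq_bound ht)) bound. Qed.

(** The L^2 condition for the multiplier follows from the weighted bound because the Sobolev weight
    is at least 1 for s >= 0. *)
Lemma gevrey_dom (s0 : 0 <= s) t : 0 <= t <= T1 ->
  exists g, is_multiplier (gevrey_symbol alpha beta t) (theta t) g.
Proof.
move=> ht; have Lf := Lsq_stheta ht.
apply: (multiplier_exists Lf).
- exact: measurable_gexp.
- exact: measurable_cst.
- by move=> xi /=; rewrite aniso_opp2.
- by move=> xi /=; rewrite oppr0.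
- apply: (Lsq_le _ (Lsq_gexp ht)).
    apply: measurable_funM; last exact: measurable_ampl.
    rewrite (_ : (fun xi => _) = gexp t); first exact: measurable_gexp.
    by apply/funext => xi; rewrite /gevrey_symbol /= expr0n/= addr0 sqrtr_sqr ger0_norm ?expR_ge0.
  move=> xi; rewrite !normrM /= expr0n/= addr0 sqrtr_sqr normr_id ler_wpM2l//.
  rewrite !ger0_norm ?powR_ge0 ?ampl_ge0// ler_peMl ?ampl_ge0//.
  by have := ler_powR (jb_ge1 xi) (divr_ge0 s0 (ler0n R 2)); rewrite powRr0.
Qed.

(** [G] is described through its transform, which is what a chosen representative of the multiplier
    provides. *)
Context (hG : forall t, 0 <= t <= T1 -> Lsq mu (G t) /\
  {ae mu, forall xi, fourier (G t) xi = (gexp t xi)%:C%C * fourier (theta t) xi}).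

Lemma bessel_G t : 0 <= t <= T1 ->
  {ae mu, forall xi, bessel s (G t) xi = gexp t xi * bessel s (theta t) xi}.
Proof.
move=> ht; have [_ h] := hG ht; apply: ae2_imp h => xi e.
rewrite /bessel /ampl e Normc.normcM /= expr0n/= addr0 sqrtr_sqr ger0_norm ?gexp_ge0//.
by rewrite mulrCA.
Qed.

Lemma sobolev_G t : 0 <= t <= T1 -> sobolev s (G t).
Proof.
move=> ht; have [LG _] := hG ht; apply/sobolevP; split; first exact: LG.
apply: (Lsq_le_ae (measurable_bessel s LG) (Lsq_gexp ht)).
- by move=> x; exact: bessel_ge0.
- by apply: ae2_imp (bessel_G ht) => xi ->.
Qed.

Lemma sob_G_le t : 0 <= t <= T1 -> (sobolev_norm s (G t) <= (Num.sqrt L)%:E)%E.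
Proof.
move=> ht; have sG := sobolev_G ht; rewrite (sobolev_normE sG) lee_fin /sob ler_wsqrtr//.
have [_ LB] := (sobolevP s (G t)).1 sG.
apply: (le_trans _ (ip_bound ht)); apply: ip_ae_le.
- exact: LB.
- exact: Lsq_bound.
- by move=> x; exact: bessel_ge0.
- apply: ae2_imp (bessel_G ht) => xi ->; rewrite ler_wpM2r ?bessel_ge0// gexp_le//.
  by case/andP: ht => t0 _; lra.
Qed.

(* exp (t' Phi) (theta t' - theta t) is small in H^s by interpolation between theta t' - theta t
   and its image under exp (2 t' Phi), which is bounded. *)
Lemma ip_split_le t t' : 0 <= t <= T1 -> 0 <= t' <= T1 -> t' <= t ->
  ip mu (bessel s (fun x => G t' x - G t x)) (bessel s (fun x => G t' x - G t x)) <=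
  2 * (sob s (fun x => theta t' x - theta t x) * Num.sqrt (4 * L)) +
  2 * ip mu (fun xi => gexp t' xi * bessel s (theta t) xi - gexp t xi * bessel s (theta t) xi)
            (fun xi => gexp t' xi * bessel s (theta t) xi - gexp t xi * bessel s (theta t) xi).
Proof.
move=> ht ht' tt'; have /andP[t0 _] := ht; have /andP[t0' _] := ht'.
have sd := sobolevB (stheta ht') (stheta ht).
have [Ld Lbd] := (sobolevP s _).1 sd.
have sGd := sobolevB (sobolev_G ht') (sobolev_G ht).
have [LGd LbGd] := (sobolevP s _).1 sGd.
have [LGt eG] := hG ht; have [LGt' eG'] := hG ht'.
have Lt := Lsq_stheta ht; have Lt' := Lsq_stheta ht'.
set d := (fun x => theta t' x - theta t x) in sd Ld Lbd *.
have dle : {ae mu, forall xi, bessel s d xi <= bessel s (theta t') xi + bessel s (theta t) xi}.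
  apply: ae2_imp (fourierB Lt' Lt) => xi e.
  rewrite /bessel -mulrDr ler_wpM2l ?powR_ge0// /ampl.
  by apply: (le_trans (le_of_eq (congr1 (@Normc.normc R) e))); apply: le_trans (le_normcD _ _) _; rewrite normcN.
pose w xi := gexp (2 * t') xi * bessel s d xi.
have mw : mfun2 R w by apply: measurable_funM; [exact: measurable_gexp|exact: measurable_bessel Ld].
have LB := LsqD (Lsq_bound ht') (Lsq_bound ht).
(* Here t' <= t enters: the weight at time t' is dominated by the one at time t, so the bounds at
   both times apply. *)
have wle : {ae mu, forall xi, w xi <= gexp (2 * t') xi * bessel s (theta t') xi + gexp (2 * t) xi * bessel s (theta t) xi}.
  apply: ae2_imp dle => xi h; apply: (le_trans (ler_wpM2l (gexp_ge0 _ _) h)).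
  rewrite mulrDr lerD2l ler_wpM2r ?bessel_ge0// gexp_le// ler_wpM2l//.
have w0 xi : 0 <= w xi by rewrite mulr_ge0 ?gexp_ge0 ?bessel_ge0.
have Lw : Lsq mu w := Lsq_le_ae mw LB w0 wle.
have wL : ip mu w w <= 4 * L.
  apply: (le_trans (ip_ae_le Lw LB w0 wle)).
  apply: (le_trans (ip_sq_add_le (Lsq_bound ht') (Lsq_bound ht))).
  have h1 := ler_wpM2l (ler0n R 2) (ip_bound ht'); have h2 := ler_wpM2l (ler0n R 2) (ip_bound ht).
  by apply: (le_trans (lerD h1 h2)); apply: le_of_eq; ring.
pose u xi := gexp t' xi * bessel s d xi.
have mu_ : mfun2 R u by apply: measurable_funM; [exact: measurable_gexp|exact: measurable_bessel Ld].
have Lu : Lsq mu u.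
  apply: (Lsq_le mu_ Lw) => xi; rewrite !normrM ler_wpM2r// !ger0_norm ?gexp_ge0// gexp_le//.
  by rewrite mulr2n mulrDl mul1r lerDl.
have uu : ip mu u u <= sob s d * Num.sqrt (4 * L).
  have -> : ip mu u u = ip mu (bessel s d) w.
    apply: eq_Rintegral => xi _; rewrite /u /w.
    have -> : gexp (2 * t') xi = gexp t' xi * gexp t' xi by rewrite /gexp -expRD; congr expR; ring.
    by ring.
  apply: (le_trans (ler_norm _)); apply: (le_trans (ip_cauchy_norm Lbd Lw)).
  by rewrite ler_wpM2l ?sqrtr_ge0// ler_wsqrtr.
pose v xi := gexp t' xi * bessel s (theta t) xi - gexp t xi * bessel s (theta t) xi.
have Lgt' : Lsq mu (fun xi => gexp t' xi * bessel s (theta t) xi).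
  apply: (Lsq_le _ (Lsq_gexp ht)).
    by apply: measurable_funM; [exact: measurable_gexp|exact: measurable_bessel Lt].
  by move=> xi; rewrite !normrM ler_wpM2r// !ger0_norm ?gexp_ge0// gexp_le.
have Lv : Lsq mu v := LsqB Lgt' (Lsq_gexp ht).
have main : {ae mu, forall xi, bessel s (fun x => G t' x - G t x) xi <= u xi + `|v xi|}.
  apply: ae2_imp (ae2_and (ae2_and eG eG') (ae2_and (fourierB LGt' LGt) (fourierB Lt' Lt))) => xi [[e1 e2] [e3 e4]].
  have e : fourier (fun x => G t' x - G t x) xi = (gexp t' xi)%:C%C * fourier d xi +
     (gexp t' xi - gexp t xi)%:C%C * fourier (theta t) xi.
    apply: (etrans e3); apply: (etrans (congr2 (fun p q => p - q) e2 e1)).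
    move: e4; rewrite -/d; move: (fourier d xi) (fourier (theta t) xi) (fourier (theta t') xi) => z1 z2 z3 ->.
    by rewrite rmorphB /= mulrBr mulrBl; ring.
  rewrite /bessel /ampl; apply: (@le_trans _ _ (jb xi `^ (s / 2) * (gexp t' xi * ampl d xi + `|gexp t' xi - gexp t xi| * ampl (theta t) xi))).
    rewrite ler_wpM2l ?powR_ge0//; apply: (le_trans (le_of_eq (congr1 (@Normc.normc R) e))).
    have h := normc_lin_le (gexp t' xi) (gexp t' xi - gexp t xi) (fourier d xi) (fourier (theta t) xi).
    by rewrite (ger0_norm (gexp_ge0 _ _)) in h; exact: h.
  have e5 : `|v xi| = `|gexp t' xi - gexp t xi| * bessel s (theta t) xi.
    by rewrite /v -mulrBl normrM (ger0_norm (bessel_ge0 s (theta t) xi)).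
  apply: le_of_eq; rewrite e5 /u /bessel.
  move: (jb xi `^ (s / 2)) (ampl d xi) (ampl (theta t) xi) (gexp t' xi) (`|_|) => *; ring.
apply: (le_trans (ip_ae_le LbGd (LsqD Lu (Lsq_norm Lv)) (fun x => bessel_ge0 _ _ x) main)).
apply: (le_trans (ip_sq_add_le Lu (Lsq_norm Lv))).
have -> : ip mu (fun x => `|v x|) (fun x => `|v x|) = ip mu v v.
  by apply: eq_Rintegral => x _; rewrite -!expr2 real_normK ?num_real.
by rewrite lerD2r ler_wpM2l.
Qed.

(** Of the two terms in [ip_split_le], the first vanishes by continuity of theta in H^s. The second
    vanishes by dominated convergence, since grid times stay below t. *)
Lemma G_grid_cvg t : 0 <= t <= T1 ->
  (fun n => sob s (fun x => G (grid n t) x - G t x)) @ \oo --> (0 : R).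
Proof.
move=> ht; have /andP[t0 tT] := ht.
have cv : cvgL2 mu (fun n xi => gexp (grid n t) xi * bessel s (theta t) xi) (fun xi => gexp t xi * bessel s (theta t) xi).
  apply: (@dominated_cvgL2 _ (plane R) R mu _ _ (fun xi => gexp t xi * bessel s (theta t) xi)).
  - by move=> n; apply: measurable_funM; [exact: measurable_gexp|exact: measurable_bessel (Lsq_stheta ht)].
  - exact: Lsq_meas (Lsq_gexp ht).
  - exact: Lsq_gexp.
  - by move=> n xi; rewrite !normrM ler_wpM2r// !ger0_norm ?gexp_ge0// gexp_le// grid_le.
  - by move=> xi.
  - apply: aeW => xi; apply: cvgMr_tmp; apply: (@cvg_comp _ _ _ (fun n => grid n t * Phi xi) expR); last exact: continuous_expR.
    apply: cvgMr_tmp; apply/cvgrPdist_lt => e e0; have [N _ hN] := near_grid t0 e0.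
    by exists N => //= n Nn; rewrite distrC; exact: hN.
have c1 : (fun n => 2 * (sob s (fun x => theta (grid n t) x - theta t x) * Num.sqrt (4 * L)) +
  2 * ip mu (fun xi => gexp (grid n t) xi * bessel s (theta t) xi - gexp t xi * bessel s (theta t) xi)
            (fun xi => gexp (grid n t) xi * bessel s (theta t) xi - gexp t xi * bessel s (theta t) xi)) @ \oo --> (0 : R).
  have z : 2 * (0 * Num.sqrt (4 * L)) + 2 * 0 = 0 :> R by rewrite mul0r mulr0 addr0.
  rewrite -[X in _ --> X]z; apply: cvgD; apply: cvgMl_tmp; last exact: cv.
  by apply: cvgMr_tmp; exact: ctheta.
have c2 : (fun n => ip mu (bessel s (fun x => G (grid n t) x - G t x)) (bessel s (fun x => G (grid n t) x - G t x))) @ \oo --> (0 : R).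
  apply: (squeeze_cvgr _ (cvg_cst 0) c1); apply: nearW => n; rewrite ip_ge0/=.
  exact: ip_split_le ht (grid_in n ht) (grid_le n t0).
rewrite -[X in _ --> X](@sqrtr0 R).
by apply: (@cvg_comp _ _ _ _ (@Num.sqrt R) _ _ _ c2); exact: sqrt_continuous.
Qed.

Lemma Linfty_G : Linfty_sobolev T1 s G.
Proof.
have in0 : 0 <= (0 : R) <= T1 by rewrite lexx ltW.
(* The default [G 0] makes every coefficient an element of H^s, whatever the index. *)
pose c n i := if i%:R / n.+1%:R <= T1 then G (i%:R / n.+1%:R) else G 0.
have sc n i : sobolev s (c n i).
  by rewrite /c; case: ifP => h; apply: sobolev_G => //; rewrite divr_ge0.
split; first exact: sobolev_G.
- exists (fun n t x => \sum_(i < (Num.trunc (T1 * n.+1%:R)).+1) \1_(cell n i) t * c n i x).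
    move=> n; exists (Num.trunc (T1 * n.+1%:R)).+1, (fun i => cell n i), (fun i => c n i).
    by split; [move=> i; exact: measurable_cell|split].
  apply: aeW => t ht; have /andP[t0 tT] := ht.
  have e n : (fun x => \sum_(i < (Num.trunc (T1 * n.+1%:R)).+1) \1_(cell n i) t * c n i x) = G (grid n t).
    apply/funext => x; rewrite (@cell_sum R n _ (fun i => c n i x) t t0 (trunc_lt n tT)) /c.
    by rewrite (le_trans (grid_le n t0)).
  have -> : (fun n => sobolev_norm s ((fun x => \sum_(i < (Num.trunc (T1 * n.+1%:R)).+1) \1_(cell n i) t * c n i x) \- G t)%R)
     = EFin \o (fun n => sob s (fun x => G (grid n t) x - G t x)).
    apply/funext => n /=; rewrite e.
    exact: (sobolev_normE (sobolevB (sobolev_G (grid_in n ht)) (sobolev_G ht))).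
  by apply: cvg_EFin; [exact: nearW|exact: G_grid_cvg].
- exists (Num.sqrt L); apply: aeW => t ht; exact: sob_G_le.
Qed.

End GevreyRegularity.

Theorem proposition4p1 (R : realType) (alpha beta s T0 : R)
    (theta0 : R * R -> R) (theta : R -> R * R -> R)
    (halpha : 2^-1 < alpha < 1) (hbeta : 2^-1 < beta < 1)
    (hs : Num.max (2 - 2 * alpha) (2 - 2 * beta) < s < 2)
    (htheta0 : sobolev s theta0)
    (hT0 : 0 < T0)
    (htheta : unique_mild_solution alpha beta s T0 theta0 theta)
    (hbound : (ereal_sup [set sobolev_norm s (theta t) | t in `[0%R, T0]]
               <= 2%:E * sobolev_norm s theta0)%E) :
  exists T1 : R, 0 < T1 <= T0 /\
    (forall t, 0 <= t <= T1 ->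
       multiplier_dom (gevrey_symbol alpha beta t) (theta t)) /\
    Linfty_sobolev T1 s
      (fun t => multiplier (gevrey_symbol alpha beta t) (theta t)).
Proof.
have [hmild _] := htheta.
have [T1 [L [/andP[T10 T1T0] bound]]] := gevrey_mild halpha hbeta hs htheta0 hT0 hmild hbound.
have s0 : 0 <= s.
  case/andP: hs; rewrite gt_max => /andP[h _] _; case/andP: halpha => _ h2; lra.
have TT t : 0 <= t <= T1 -> 0 <= t <= T0 by move=> /andP[-> h]; exact: le_trans T1T0.
have st t : 0 <= t <= T1 -> sobolev s (theta t) by move=> ht; apply: (sobolev_theta hmild); exact: TT.
have ct t : 0 <= t <= T1 -> (fun n => sob s (fun x => theta (grid n t) x - theta t x)) @ \oo --> (0 : R).
  by move=> ht; apply: (sob_grid_cvg hmild); exact: TT.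
have dom t : 0 <= t <= T1 -> exists g, is_multiplier (gevrey_symbol alpha beta t) (theta t) g.
  exact: gevrey_dom st bound s0 t.
exists T1; split; first by rewrite T10.
split.
  by move=> t ht; split; [case: (st t ht)|exact: dom].
apply: (Linfty_G T10 st ct bound) => t ht.
have [/L2P LG eG] := is_multiplierP (dom t ht).
by split; [exact: LG|exact: eG].
Qed.
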